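(* Suppose $G>0$ and $\tau<+\infty$ $P$-a.s. Let $X^{\mathbb G}$ be an RCLL $\mathbb G$-optional process of class-$(\mathbb G,\mathcal D)$ such that $(X^{\mathbb G})^\tau=X^{\mathbb G}$. Consider the unique pair $(X^{\mathbb F},k^{(pr)})$ associated to $X^{\mathbb G}$ (see context), and put $\widetilde X^{\mathbb F}:=X^{\mathbb F}G+k^{(op)}\cdot D^{o,\mathbb F}$, where $k^{(op)}:=M^P_\mu(k^{(pr)}|\mathcal O(\mathbb F))$ with $\mu:=P\otimes dD$. Then the following assertions hold. (a) The optimal stopping problem for $(X^{\mathbb G},\mathbb G)$ has a solution if and only if the optimal stopping problem for $(\widetilde X^{\mathbb F},\mathbb F)$ has a solution. Furthermore, if one of these solutions exists, then the minimal optimal stopping times $\theta^{\mathbb G}_*$ and $\theta^{\mathbb F}_*$, for $(X^{\mathbb G},\mathbb G)$ and $(\widetilde X^{\mathbb F},\mathbb F)$ respectively, exist and $\theta^{\mathbb G}_*=\min(\theta^{\mathbb F}_*,\tau)$. (b) The maximal optimal stopping time $\widetilde\theta^{\mathbb G}$ for $(X^{\mathbb G},\mathbb G)$ exists if and only if the maximal optimal stopping time $\widetilde\theta^{\mathbb F}$ for $(\widetilde X^{\mathbb F},\mathbb F)$ exists also, and they satisfy $\widetilde\theta^{\mathbb G}=\min(\widetilde\theta^{\mathbb F},\tau)$.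
   Context: $(\Omega,\mathcal F,P)$ is a complete probability space with a complete and right-continuous filtration $\mathbb F=(\mathcal F_t)_{t\ge0}$. $\tau$ is a random time, i.e. an $\mathcal F$-measurable random variable with values in $[0,+\infty]$, not necessarily an $\mathbb F$-stopping time. Put $D:=I_{[\![\tau,+\infty[\![}$. The filtration $\mathbb G=(\mathcal G_t)_{t\ge0}$ is the progressive enlargement of $\mathbb F$ with $\tau$: $\mathcal G_t:=\bigcap_{s>t}\big(\mathcal F_s\vee\sigma(D_u,\,u\le s)\big)$. ${}^{o,\mathbb F}Y$ is the $\mathbb F$-optional projection of $Y$, and $D^{o,\mathbb F}$ is the $\mathbb F$-dual optional projection of $D$. $G:={}^{o,\mathbb F}(I_{[\![0,\tau[\![})$, i.e. $G_t=P(\tau>t|\mathcal F_t)$; $G>0$ means that $G$ is a positive process. $\varphi\cdot X$ is the integral of $\varphi$ with respect to $X$ (for instance $I_{]\!]0,\sigma]\!]}\cdot X=X^\sigma-X_0$); $X^\sigma_t:=X_{\sigma\wedge t}$; RCLL means right-continuous with left limits. For a filtration $\mathbb H$, a process $X$ is of class-$(\mathbb H,\mathcal D)$ if $\{X_\sigma:\sigma\text{ a finite }\mathbb H\text{-stopping time}\}$ is a uniformly integrable family. Associated pair: for every $\mathbb G$-optional $X^{\mathbb G}$ with $(X^{\mathbb G})^\tau=X^{\mathbb G}$ there is a pair $(X^{\mathbb F},k^{(pr)})$, with $X^{\mathbb F}$ $\mathbb F$-optional and $k^{(pr)}$ $\mathbb F$-progressive, such that $X^{\mathbb G}=k^{(pr)}_0I_{\{\tau=0\}}+X^{\mathbb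 F}I_{[\![0,\tau[\![}+k^{(pr)}\cdot D$ and $X^{\mathbb F}={}^{o,\mathbb F}(X^{\mathbb G}I_{[\![0,\tau[\![})/G$; $X^{\mathbb F}$ is unique up to modification and $k^{(pr)}$ is unique $P\otimes dD$-a.e. $\mathcal O(\mathbb F)$ is the $\mathbb F$-optional $\sigma$-field on $\Omega\times[0,\infty)$. For an $\mathcal F\otimes\mathcal B(\mathbb R^+)$-measurable process $X$ which is nonnegative or $\mu$-integrable with $\mu=P\otimes dD$, $M^P_\mu(X|\mathcal O(\mathbb F))$ is the unique $\mathbb F$-optional process $Y$ such that $E[\int_0^\infty X_sH_s\,dD_s]=E[\int_0^\infty Y_sH_s\,dD_s]$ for every bounded $\mathbb F$-optional $H$. Optimal stopping problem for $(X,\mathbb H)$, where $\mathbb H=(\mathcal H_t)_{t\ge0}$ is a filtration and $X$ a reward process: its value process is the Snell envelope $\mathcal S^{\mathbb H}$, with $\mathcal S^{\mathbb H}_\sigma=\operatorname{ess\,sup}_\theta E[X_\theta|\mathcal H_\sigma]$ over finite $\mathbb H$-stopping times $\theta\ge\sigma$. Let $\mathcal J_0^\infty(\mathbb H)$ be the set of $\mathbb H$-stopping times with values in $[\![0,\infty]\!]$, and $\mathcal M(\mathbb H)$ the set of $\mathbb H$-martingales. The solutions (optimal stopping times) are the elements of $$\mathbb T(X,\mathbb H):=\{\theta\in\mathcal J_0^\infty(\mathbb H):\ [\![\theta]\!]\subset\{X=\mathcal S^{\mathbb H}\},\ (\mathcal S^{\mathbb H})^\theta\in\mathcal M(\mathbb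 H)\}.$$ The minimal (respectively maximal) optimal stopping time is $\operatorname{ess\,inf}\mathbb T(X,\mathbb H)$ (respectively $\operatorname{ess\,sup}\mathbb T(X,\mathbb H)$), and it is said to exist when it belongs to $\mathbb T(X,\mathbb H)$. Equalities between stopping times are $P$-a.s.
   Formalization: In (b) the equality, false as stated since optimal G-times may exceed τ (F trivial, τ exponential, X^G=D gives +∞ vs τ), is proved as min(θ̃^G,τ)=min(θ̃^F,τ), and verbatim (with the existence equivalence) for the maximal time among G-optimal times in [[0,τ]]. *)

(* Defs.v *)
From HB Require Import structures.
From mathcomp Require Import all_boot all_order all_algebra.
From mathcomp Require Import all_classical all_reals all_analysis.
From mathcomp Require Import measurable_realfun.
Import Order.TTheory GRing.Theory Num.Theory.
Import numFieldNormedType.Exports.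

Set Implicit Arguments.
Unset Strict Implicit.
Unset Printing Implicit Defensive.

Local Open Scope classical_set_scope.
Local Open Scope ring_scope.

(* Time is [0, +oo[.  Processes and filtrations are indexed by R, but every
   definition below only looks at indices t >= 0.  Random times take values in
   \bar R. *)

Section filtrations.
Context {R : realType} {d : measure_display} {T : measurableType d}.
Variable P : probability T R.
Implicit Types (H : R -> set (set T)) (X Y : R -> T -> R) (s : T -> \bar R).

Definition usual_filtration H : Prop :=
  [/\ forall t, 0 <= t -> sigma_algebra setT (H t) /\ H t `<=` measurable,
      forall t u, 0 <= t -> t <= u -> H t `<=` H u,
      forall A, P.-negligible A -> H 0 A &
      forall t, 0 <= t -> H t = \bigcap_(u in [set u | t < u]) H u].

Definition random_time s : Prop :=
  measurable_fun setT s /\ forall w, (0 <= s w)%E.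

Definition stopping_time H s : Prop :=
  (forall w, (0 <= s w)%E) /\
  forall t, 0 <= t -> H t [set w | (s w <= t%:E)%E].

Definition finite_stopping_time H s : Prop :=
  stopping_time H s /\ forall w, (s w < +oo)%E.

(* The sigma-field H_s of the events prior to the stopping time s. *)
Definition prior H s : set (set T) :=
  [set A | measurable A /\
           forall t, 0 <= t -> H t (A `&` [set w | (s w <= t%:E)%E])].

Definition rcll (f : R -> R) : Prop :=
  (forall t, 0 <= t -> f x @[x --> t^'+] --> f t) /\
  (forall t, 0 < t -> cvg (f x @[x --> t^'-])).

Definition adapted H X : Prop :=
  forall t, 0 <= t -> forall B, measurable B -> H t (X t @^-1` B).

(* Sets of O(H) are subsets of T * [0, +oo[. *)
Definition optional_sets H : set (set (T * R)) :=
  <<s [set p | 0 <= p.2],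
      [set E | exists X B, [/\ adapted H X, forall w, rcll (X ^~ w),
         measurable B & E = [set p | 0 <= p.2 /\ B (X p.2 p.1)]]] >>.

Definition optional H X : Prop :=
  forall B, measurable B ->
    optional_sets H [set p | 0 <= p.2 /\ B (X p.2 p.1)].

Definition progressive H X : Prop :=
  forall t, 0 <= t -> forall B, measurable B ->
    <<s [set p : T * R | 0 <= p.2 <= t],
        [set E | exists A C, [/\ H t A, measurable C, C `<=` `[0, t] &
           E = A `*` C]] >> [set p | 0 <= p.2 <= t /\ B (X p.2 p.1)].

Definition indistinguishable X Y : Prop :=
  \forall w \ae P, forall t, 0 <= t -> X t w = Y t w.

Definition stopped X s : R -> T -> R :=
  fun t w => X (fine (Order.min (s w) t%:E)) w.

(* X_s I_{s < +oo} *)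
Definition at_time X s : T -> R :=
  fun w => if (s w < +oo)%E then X (fine (s w)) w else 0.

Definition uniformly_integrable (Phi : set (T -> R)) : Prop :=
  (forall f, Phi f -> measurable_fun setT f) /\
  forall e : R, 0 < e -> exists c : R, forall f, Phi f ->
    (\int[P]_(w in [set w | (c < `|f w|)%R]) `|f w|%:E <= e%:E)%E.

Definition classD H X : Prop :=
  uniformly_integrable [set f | exists2 s, finite_stopping_time H s &
                                           f = at_time X s].

(* W is a version of E[V | C] *)
Definition is_condexp (C : set (set T)) (V W : T -> R) : Prop :=
  [/\ P.-integrable setT (EFin \o V), P.-integrable setT (EFin \o W),
      forall B, measurable B -> C (W @^-1` B) &
      forall A, C A -> (\int[P]_(w in A) (W w)%:E = \int[P]_(w in A) (V w)%:E)%E].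

Definition martingale H X : Prop :=
  forall t u, 0 <= t -> t <= u -> is_condexp (H t) (X u) (X t).

Definition is_optional_projection H X Y : Prop :=
  optional H Y /\
  forall s, stopping_time H s -> is_condexp (prior H s) (at_time X s) (at_time Y s).

Definition is_ess_sup (Phi : set (T -> \bar R)) (Z : T -> \bar R) : Prop :=
  [/\ measurable_fun setT Z,
      forall V, Phi V -> \forall w \ae P, (V w <= Z w)%E &
      forall Z', measurable_fun setT Z' ->
        (forall V, Phi V -> \forall w \ae P, (V w <= Z' w)%E) ->
        \forall w \ae P, (Z w <= Z' w)%E].

Definition is_ess_inf (Phi : set (T -> \bar R)) (Z : T -> \bar R) : Prop :=
  [/\ measurable_fun setT Z,
      forall V, Phi V -> \forall w \ae P, (Z w <= V w)%E &
      forall Z', measurable_fun setT Z' ->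
        (forall V, Phi V -> \forall w \ae P, (Z' w <= V w)%E) ->
        \forall w \ae P, (Z' w <= Z w)%E].

(* S is the value process of the optimal stopping problem for (X, H). *)
Definition is_snell H X S : Prop :=
  optional H S /\
  forall s, finite_stopping_time H s ->
    is_ess_sup [set f | exists th (V : T -> R),
        [/\ finite_stopping_time H th, forall w, (s w <= th w)%E,
            is_condexp (prior H s) (at_time X th) V & f = EFin \o V]]
      (EFin \o at_time S s).

(* The optimal stopping times for (X, H) with value process S which lie in
   [[0, zeta]]; zeta = +oo gives the whole set T(X, H).  The graph of th is a
   subset of T * [0, +oo[, and the inclusion of random sets is understood up
   to an evanescent set. *)
Definition optimal_times H (zeta : T -> \bar R) X S : set (T -> \bar R) :=
  [set th | [/\ stopping_time H th,
      \forall w \ae P, (th w <= zeta w)%E,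
      \forall w \ae P, forall t, 0 <= t -> th w = t%:E -> X t w = S t w &
      martingale H (stopped S th)]].

(* ess inf, resp. ess sup, of a family of random times, belonging to it *)
Definition is_minimal (Th : set (T -> \bar R)) (th : T -> \bar R) : Prop :=
  is_ess_inf Th th /\ Th th.

Definition is_maximal (Th : set (T -> \bar R)) (th : T -> \bar R) : Prop :=
  is_ess_sup Th th /\ Th th.

End filtrations.

Section unit_jump.
Context {R : realType}.

(* The path t |-> I_{x <= t}; for x = +oo it is identically 0. *)
Definition unit_jump (x : \bar R) (t : R) : R := ((x <= t%:E)%E)%:R.

Lemma unit_jump_nondecreasing x : nondecreasing (unit_jump x).
Proof.
move=> s t st; rewrite /unit_jump ler_nat.
case: (leP x s%:E) => // xs.
by rewrite (le_trans xs) // lee_fin.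
Qed.

Lemma unit_jump_right_continuous x : right_continuous (unit_jump x).
Proof.
move=> t; apply: cvg_near_cst.
rewrite /unit_jump; case: (leP x t%:E) => xt.
  near=> s; have -> // : (x <= s%:E)%E.
  by rewrite (le_trans xt) // lee_fin ltW //; near: s; exact: nbhs_right_gt.
case: x xt => [r| |] //=; last by move=> _; near=> s.
rewrite lte_fin => tr.
near=> s; have : s < r by near: s; exact: nbhs_right_lt.
by rewrite lee_fin ltNge => /negbTE ->.
Unshelve. all: by end_near. Qed.

HB.instance Definition _ x := isCumulative.Build R _ R (unit_jump x)
  (@unit_jump_nondecreasing x) (@unit_jump_right_continuous x).

End unit_jump.

Section progressive_enlargement.
Context {R : realType} {d : measure_display} {T : measurableType d}.
Variable P : probability T R.
Implicit Types (F : R -> set (set T)) (X Y k : R -> T -> R) (tau : T -> \bar R).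
Implicit Types (A Ao : T -> cumulative R R).

(* D = I_{[[tau, +oo[[ *)
Definition default_process tau : T -> cumulative R R := fun w => unit_jump (tau w).

(* The process I_{[[0, tau[[} *)
Definition survival tau : R -> T -> R := fun t w => ((t%:E < tau w)%E)%:R.

Definition enlarged F tau : R -> set (set T) := fun t =>
  \bigcap_(s in [set s | t < s])
    <<s F s `|` [set E | exists u B, [/\ 0 <= u <= s, measurable B &
                  E = (fun w => default_process tau w u) @^-1` B]] >>.

(* (k . A)_t, the Stieltjes integral over ]0, t]; in particular the value at
   t = 0 is 0 and a jump of A at 0 does not contribute. *)
Definition stieltjes_integral k A : R -> T -> R := fun t w =>
  Rintegral (lebesgue_stieltjes_measure (A w)) `]0, t] (k ^~ w).

(* E[\int_[0, +oo[ X_s dA_s], i.e. the integral of X with respect to the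
   measure P (x) dA.  The time 0 is included: a path with A_t = 0 for t < 0 has
   mass A_0 there. *)
Definition expected_integral A X : \bar R :=
  (\int[P]_w \int[lebesgue_stieltjes_measure (A w)]_(s in `[0%R, +oo[) (X s w)%:E)%E.

Definition bounded_optional F X : Prop :=
  optional F X /\ exists c : R, forall t w, 0 <= t -> `|X t w| <= c.

(* Ao is the F-dual optional projection of A. *)
Definition is_dual_optional_projection F A Ao : Prop :=
  [/\ optional F (fun t w => Ao w t),
      forall w t, t < 0 -> Ao w t = 0 &
      forall H, bounded_optional F H ->
        expected_integral Ao H = expected_integral A H].

(* Y = M^P_mu(X | O(F)), where mu = P (x) dA and X is mu-integrable *)
Definition is_mu_condexp F A X Y : Prop :=
  [/\ optional F Y,
      (expected_integral A (fun t w => `|Y t w|%R) < +oo)%E &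
      forall H, bounded_optional F H ->
        expected_integral A (fun t w => X t w * H t w) =
        expected_integral A (fun t w => Y t w * H t w)].

Definition associated_pair F tau (G XG XF kpr : R -> T -> R) : Prop :=
  [/\ optional F XF, progressive F kpr,
      indistinguishable P XG (fun t w =>
        kpr 0 w * (tau w == 0%E)%:R + XF t w * survival tau t w
        + stieltjes_integral kpr (default_process tau) t w) &
      exists2 Y, is_optional_projection P F (fun t w => XG t w * survival tau t w) Y &
        indistinguishable P XF (fun t w => Y t w / G t w)].

Definition reduced_reward (G XF kop : R -> T -> R) (DoF : T -> cumulative R R)
    : R -> T -> R :=
  fun t w => XF t w * G t w + stieltjes_integral kop DoF t w.

End progressive_enlargement.

(* Main.v *)
(** Write [v] for the value of the problem in [G].  A supermartingale argument shows
that a stopping time solves a stopping problem iff the rewards of its truncations at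
the times [n] converge to the value; class (D), the stopping at [tau] and [tau < oo]
turn this into [E X^G_(theta /\ tau) = v].  The dual projection and the
[mu]-conditional expectation give, for finite [F]-stopping times [s <= u] and
[A] in [F_s], [E[X~_u - X~_s; A] = E[X^G_u - X^G_s; A]], so an [F]-stopping time
solves the problem for [X~] iff it solves the one for [X^G].  Every
[G]-stopping time agrees up to [tau] with an [F]-stopping time, so the two sets of
solutions correspond to each other through [sigma |-> sigma /\ tau].
The [F]-solutions are stable under minima and decreasing limits, which provides the
minimal one.  Comparing maximal solutions uses [G > 0]: two [F]-stopping times
which are ordered up to [tau] are ordered. *)
From HB Require Import structures.
Require Import Defs.
From mathcomp Require Import all_boot all_order all_algebra.
From mathcomp Require Import all_classical all_reals all_analysis.
From mathcomp Require Import measurable_realfun.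
From mathcomp Require Import lra.
Import Order.TTheory GRing.Theory Num.Theory.
Import numFieldNormedType.Exports.

Set Implicit Arguments.
Unset Strict Implicit.
Unset Printing Implicit Defensive.

Local Open Scope classical_set_scope.
Local Open Scope ring_scope.

(** * Conditional expectation *)

(** The obstacle is that class (D) is available for [XG] only. The Snell envelope is therefore
    studied for an abstract reward under weaker conditions: measurability and integrability at
    finite stopping times, an upper bound for the expected rewards, and a one-sided tail estimate,
    saying that waiting beyond a large [n] gains at most [e] on any event known at [n]. For the
    reduced reward the last two come from the increment identity, the first two from the
    projections. The envelope enters only through its values at finite stopping times, so no path
    regularity of it is used. Solutions may be infinite, hence the truncations and the functional
    [J], which gives a reward to infinite times as well. The two values differ by a constant,
    because the Stieltjes integral over []0, t]] ignores a jump at 0. In (b), a solution in the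
    enlarged filtration that waits until [tau] may be postponed at no cost, so being maximal among
    all solutions and among those bounded by [tau] are different things; both are treated. *)

Section sigma_algebra_closure.
Context {T : pointedType} (C : set (set T)).
Hypothesis sC : sigma_algebra setT C.

Lemma sigma_measurableE (A : set T) :
  C A = measurable (A : set (g_sigma_algebraType C)).
Proof. by rewrite /measurable/= sigma_algebra_id. Qed.

Lemma sigmaT : C setT.
Proof. by rewrite sigma_measurableE; exact: measurableT. Qed.

Lemma sigma0 : C set0.
Proof. by rewrite sigma_measurableE; exact: measurable0. Qed.

Lemma sigmaC A : C A -> C (~` A).
Proof. by rewrite !sigma_measurableE; exact: measurableC. Qed.

Lemma sigmaU A B : C A -> C B -> C (A `|` B).
Proof. by rewrite !sigma_measurableE; exact: measurableU. Qed.

Lemma sigmaI A B : C A -> C B -> C (A `&` B).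
Proof. by rewrite !sigma_measurableE; exact: measurableI. Qed.

Lemma sigmaD A B : C A -> C B -> C (A `\` B).
Proof. by rewrite !sigma_measurableE; exact: measurableD. Qed.

Lemma sigma_bigcup (A : nat -> set T) : (forall n, C (A n)) -> C (\bigcup_n A n).
Proof.
move=> CA; rewrite sigma_measurableE; apply: bigcupT_measurable => n.
by rewrite -sigma_measurableE.
Qed.

Lemma sigma_bigcap (A : nat -> set T) : (forall n, C (A n)) -> C (\bigcap_n A n).
Proof.
move=> CA; rewrite sigma_measurableE; apply: bigcapT_measurable => n.
by rewrite -sigma_measurableE.
Qed.

Lemma sigma_bigcup_rat (A : rat -> set T) :
  (forall q, C (A q)) -> C (\bigcup_q A q).
Proof.
move=> CA; rewrite sigma_measurableE; apply: bigcupT_measurable_rat => n.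
by rewrite -sigma_measurableE.
Qed.

End sigma_algebra_closure.

Section conditional_expectation.
Context {R : realType} {d : measure_display} {T : measurableType d}.
Variable P : probability T R.
Local Notation intg f := (P.-integrable setT (EFin \o f)).

Definition sub_sigma (C : set (set T)) := sigma_algebra setT C /\ C `<=` measurable.

Definition wrt (C : set (set T)) (f : T -> R) :=
  forall B, measurable B -> C (f @^-1` B).

Lemma wrtP C (f : T -> R) : sigma_algebra setT C ->
  wrt C f <-> measurable_fun [set: g_sigma_algebraType C] (f : g_sigma_algebraType C -> R).
Proof.
move=> sC; split.
  by move=> mf _ B mB; rewrite setTI -sigma_measurableE//; exact: mf.
move=> mf B mB; rewrite sigma_measurableE// -[X in measurable X]setTI.
exact: mf.
Qed.

Lemma wrt_measurable C (f : T -> R) : sub_sigma C -> wrt C f -> measurable_fun setT f.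
Proof. by move=> [_ CT] mf _ B mB; rewrite setTI; apply/CT/mf. Qed.

Lemma intg_measurable (f : T -> R) : intg f -> measurable_fun setT f.
Proof. by move=> /measurable_int/measurable_EFinP. Qed.

Lemma intgS (f : T -> R) A : measurable A -> intg f -> P.-integrable A (EFin \o f).
Proof. by move=> mA; exact: integrableS. Qed.

(** Radon-Nikodym on the coarser space: the identity from [T] to [T] equipped with [C] is
    measurable, and the derivative of the image of the charge [f dP] with respect to the image of
    [P] is [C]-measurable by construction. *)
Lemma condexp_exists C (f : T -> R) : sub_sigma C -> intg f ->
  exists W, is_condexp P C f W.
Proof.
move=> [sC CT] intf.
pose TC := g_sigma_algebraType C.
pose i : T -> TC := idfun.
have mi : measurable_fun setT i.
  by move=> _ B mB; rewrite setTI; apply: CT; rewrite sigma_measurableE.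
pose X : {mfun T >-> TC} := mfun_Sub (mem_set mi).
pose Q := distribution P X.
have [N NE] : exists N : {charge set TC -> \bar R},
    (N : set TC -> \bar R) = pushforward (induced_charge intf) i.
  by unshelve eexists (pushforward (induced_charge intf) i : {charge set TC -> \bar R}).
have NQ : N `<< Q.
  rewrite NE.
  apply: (dominates_pushforward mi); apply/null_content_dominatesP => A mA PA0.
  apply: null_set_integral => //.
  by apply: measurable_funTS; exact: measurable_int intf.
pose W : TC -> \bar R := Radon_Nikodym N Q.
have intW : Q.-integrable setT W by exact: Radon_Nikodym_integrable.
have mW : measurable_fun setT W.
  exact: measurable_int intW.
have WE : (EFin \o (fine \o W)) = W \o i.
  by apply/funext => x; rewrite /comp fineK//; exact: Radon_Nikodym_fin_num.
have intWP : P.-integrable setT (W \o i).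
  apply/integrableP; split; first exact: measurableT_comp mW mi.
  move/integrableP : intW => [_]; rewrite ge0_integral_pushforward//.
  exact: measurableT_comp.
exists (fine \o W); split => //.
- by rewrite WE.
- apply/wrtP => //. 
  exact: measurableT_comp.
- move=> A CA; rewrite -[LHS]/(\int[P]_(w in A) ((EFin \o (fine \o W)) w))%E.
  rewrite WE.
  have mA : measurable (A : set TC) by rewrite -sigma_measurableE.
  rewrite -[RHS]/(pushforward (induced_charge intf) i A) -NE.
  rewrite (Radon_Nikodym_integral NQ mA).
  transitivity (\int[pushforward P i]_(y in A) W y)%E => //.
  rewrite (integral_pushforward mi)//.
  by apply: integrableS intWP => //; exact: CT.
Qed.

Lemma Rintegral_le0_ae A (f : T -> R) : measurable A -> intg f ->
  (forall w, A w -> 0 <= f w) -> \int[P]_(w in A) f w <= 0 ->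
  \forall w \ae P, A w -> f w = 0.
Proof.
move=> mA intf f0 If.
have intfA := intgS mA intf.
have mf : measurable_fun A (EFin \o f) by exact: measurable_int intfA.
suff /(ae_eq_integral_abs P mA mf) : (\int[P]_(x in A) `|(EFin \o f) x| = 0)%E.
  by apply: filterS => w /[apply] -[].
apply/eqP; rewrite eq_le integral_ge0 ?andbT//.
rewrite (eq_integral (fun w => (f w)%:E)); last first.
  by move=> w /[!inE] Aw /=; rewrite ger0_norm// f0.
by rewrite -[leLHS]fineK ?lee_fin//; exact: integrable_fin_num.
Qed.

Lemma intg_max (f g : T -> R) : intg f -> intg g ->
  intg (fun w => Num.max (f w) (g w)).
Proof.
move=> intf intg.
apply: (@le_integrable _ _ _ P setT _ _ (fun w => `|(f w)%:E| + `|(g w)%:E|)%E) => //.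
- by apply/measurable_EFinP; apply: measurable_maxr; exact: intg_measurable.
- move=> w _; rewrite /= lee_fin.
  rewrite [leRHS]ger0_norm ?addr_ge0//.
  by case: (leP (f w) (g w)) => _; rewrite ?lerDl ?lerDr.
- by apply: integrableD => //; apply: integrable_abse.
Qed.

Lemma intgB (f g : T -> R) : intg f -> intg g -> intg (f \- g).
Proof.
move=> intf intg.
rewrite (_ : _ \o _ = (EFin \o f) \- (EFin \o g))%E; last exact/funext.
exact: integrableB.
Qed.

Lemma intgD (f g : T -> R) : intg f -> intg g -> intg (f \+ g).
Proof.
move=> intf intg.
rewrite (_ : _ \o _ = (EFin \o f) \+ (EFin \o g))%E; last exact/funext.
exact: integrableD.
Qed.

Lemma intg_cst (c : R) : intg (cst c).
Proof. exact: finite_measure_integrable_cst. Qed.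

(** Replacing [g] by the maximum of [f] and [g] changes it only on a null part of [A] and makes the
    inequality pointwise. *)
Lemma le_Rintegral_ae A (f g : T -> R) : measurable A -> intg f -> intg g ->
  (\forall w \ae P, A w -> f w <= g w) ->
  \int[P]_(w in A) f w <= \int[P]_(w in A) g w.
Proof.
move=> mA intf intg fg.
pose h w := Num.max (f w) (g w).
have mf := intg_measurable intf.
have mg := intg_measurable intg.
have inth : P.-integrable setT (EFin \o h) by exact: intg_max.
have mh := intg_measurable inth.
rewrite [leRHS](_ : _ = \int[P]_(w in A) h w); last first.
  congr fine; apply: ae_eq_integral => //.
  - exact/measurable_EFinP/measurable_funTS.
  - exact/measurable_EFinP/measurable_funTS.
  - by apply: filterS fg => w /[apply] fg; rewrite /h; congr EFin; apply/esym/max_idPr.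
apply: le_Rintegral => //; [exact: intgS|exact: intgS|].
by move=> w _; rewrite /h le_max lexx.
Qed.

Lemma eq_Rintegral_ae A (f g : T -> R) : measurable A -> intg f -> intg g ->
  (\forall w \ae P, A w -> f w = g w) ->
  \int[P]_(w in A) f w = \int[P]_(w in A) g w.
Proof.
move=> mA intf intg fg; apply/eqP; rewrite eq_le.
by apply/andP; split; apply: le_Rintegral_ae => //; apply: filterS fg => w /[apply] ->.
Qed.

Lemma Rintegral_le0_ae0 A (f : T -> R) : measurable A -> intg f ->
  (\forall w \ae P, A w -> 0 <= f w) -> \int[P]_(w in A) f w <= 0 ->
  \forall w \ae P, A w -> f w = 0.
Proof.
move=> mA intf f0 If.
pose g w := Num.max (f w) (cst 0 w).
have fg : \forall w \ae P, A w -> f w = g w.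
  by apply: filterS f0 => w /[apply] ?; apply/esym/max_idPl.
have intg : intg g by apply: intg_max => //; exact: intg_cst.
have := @Rintegral_le0_ae A g mA intg.
rewrite -(eq_Rintegral_ae mA intf intg fg).
move=> /(_ _ If) []; first by move=> w _; rewrite /g le_max lexx orbT.
move=> N [mN N0 sN]; have : \forall w \ae P, A w -> g w = 0 by exists N.
by apply: filterS2 fg => w fg g0 Aw; rewrite fg// g0.
Qed.

Lemma Rintegral_setUC A B (f : T -> R) : measurable A -> measurable B -> intg f ->
  \int[P]_(w in A) f w =
  \int[P]_(w in A `&` B) f w + \int[P]_(w in A `\` B) f w.
Proof.
move=> mA mB intf; rewrite -{1}(setDUK (@subIsetl _ A B)).
have -> : A `\` (A `&` B) = A `\` B by rewrite setDIr setDv set0U.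
apply: Rintegral_setU.
- exact: measurableI.
- exact: measurableD.
- apply: intgS => //; apply: measurableU; [exact: measurableI|exact: measurableD].
- by apply/disj_setPS => w [[_ Bw] [_ +]].
Qed.

Lemma is_condexp_intro C (f g : T -> R) : sub_sigma C -> intg f -> intg g ->
  wrt C g -> (forall A, C A -> \int[P]_(w in A) g w = \int[P]_(w in A) f w) ->
  is_condexp P C f g.
Proof.
move=> [_ CT] intf intg Cg fg; split => // A CA.
have mA := CT _ CA.
rewrite -[LHS]fineK; last by apply: integrable_fin_num => //; exact: intgS intg.
rewrite -[RHS]fineK; last by apply: integrable_fin_num => //; exact: intgS intf.
by congr EFin; exact: fg.
Qed.

(** The event [g < f] itself belongs to [C]; testing on it forces the positive difference [f - g] to
    vanish almost surely there, so the event is null. *)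
Lemma wrt_le_ae C (f g : T -> R) : sub_sigma C -> wrt C f -> wrt C g ->
  intg f -> intg g ->
  (forall A, C A -> \int[P]_(w in A) f w <= \int[P]_(w in A) g w) ->
  \forall w \ae P, f w <= g w.
Proof.
move=> sC Cf Cg intf intg fg.
pose A := [set w | g w < f w].
have CA : C A.
  case: sC => sC CT; rewrite sigma_measurableE//.
  move/wrtP: Cf => /(_ sC) Cf; move/wrtP: Cg => /(_ sC) Cg.
  have /(_ [set true] Logic.I) := measurable_fun_ltr Cg Cf measurableT.
  by rewrite setTI.
have mA : measurable A by exact: sC.2.
have := @Rintegral_le0_ae A (f \- g) mA.
have intfg : P.-integrable setT (EFin \o (f \- g)).
  rewrite (_ : _ \o _ = (EFin \o f) \- (EFin \o g))%E; last exact/funext.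
  exact: integrableB.
move=> /(_ intfg); case=> //.
- by move=> w /= /ltW; rewrite subr_ge0.
- rewrite RintegralB ?subr_le0 ?fg//; exact: intgS.
- move=> N [mN N0 sN]; exists N; split => //; apply: subset_trans sN => w /= h.
  by move=> /(_ _)/subr0_eq; move: h => /negP; rewrite -ltNge => h /(_ h) E;
    rewrite /A/= E ltxx in h.
Qed.

Lemma intg_ae (f g : T -> R) : (\forall w \ae P, f w = g w) ->
  measurable_fun setT g -> intg f -> intg g.
Proof.
move=> fg mg intf; have mf := intg_measurable intf.
apply/integrableP; split; first exact/measurable_EFinP.
move/integrableP : intf => [_]; congr (_ < _)%E.
apply: ae_eq_integral => //.
- by apply: measurableT_comp => //; exact/measurable_EFinP.
- by apply: measurableT_comp => //; exact/measurable_EFinP.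
- by apply: filterS fg => w /= -> _.
Qed.

Lemma condexp_Rintegral C (f g : T -> R) A : is_condexp P C f g -> C A ->
  \int[P]_(w in A) g w = \int[P]_(w in A) f w.
Proof. by case=> _ _ _ fg CA; congr fine; exact: fg. Qed.

End conditional_expectation.

(** * Stopping times *)

Section stopping_times.
Context {R : realType} {d : measure_display} {T : measurableType d}.
Implicit Types (H : R -> set (set T)) (s u : T -> \bar R) (A : set T).

Definition is_filtration H :=
  (forall t : R, 0 <= t -> sub_sigma (H t)) /\
  (forall t r : R, 0 <= t -> t <= r -> H t `<=` H r).

Variable H : R -> set (set T).
Hypothesis HF : is_filtration H.

Let sH (t : R) : 0 <= t -> sigma_algebra setT (H t).
Proof. by move=> t0; have [] := HF.1 _ t0. Qed.

Let Hm (t : R) : 0 <= t -> H t `<=` measurable.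
Proof. by move=> t0; have [] := HF.1 _ t0. Qed.

Lemma stopping_le_measurable s (t : R) : stopping_time H s ->
  measurable [set w | (s w <= t%:E)%E].
Proof.
move=> [s0 sH']; have [t0|t0] := leP 0 t; first by apply: (Hm t0); exact: sH'.
rewrite [X in measurable X](_ : _ = set0)//; apply/seteqP; split => // w /= swt.
by have := le_trans (s0 w) swt; rewrite lee_fin leNgt t0.
Qed.

Lemma stopping_measurable s : stopping_time H s -> measurable_fun setT s.
Proof.
move=> ss; apply: (measurability _ (ErealGenOInfty.measurableE R)) => //.
move=> _ [_ [x ->] <-]; rewrite setTI.
rewrite [X in measurable X](_ : _ = ~` [set w | (s w <= x%:E)%E]).
  exact/measurableC/stopping_le_measurable.
by apply/seteqP; split => w /=; rewrite in_itv/= andbT ltNge => /negP.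
Qed.

Lemma stopping_gt s (t : R) : stopping_time H s -> 0 <= t ->
  H t [set w | (t%:E < s w)%E].
Proof.
move=> [_ ss] t0; rewrite [X in H t X](_ : _ = ~` [set w | (s w <= t%:E)%E]).
  by apply: sigmaC (ss _ t0); exact: sH.
by apply/seteqP; split => w /=; rewrite ltNge => /negP.
Qed.

Lemma prior_sub_sigma s : stopping_time H s -> sub_sigma (prior H s).
Proof.
move=> ss; split; last by move=> A [].
split.
- by split => // t t0; rewrite set0I; exact: sigma0 (sH t0).
- move=> A [mA HA]; rewrite setTD; split; first exact: measurableC.
  move=> t t0; rewrite (_ : _ `&` _ =
    [set w | (s w <= t%:E)%E] `\` (A `&` [set w | (s w <= t%:E)%E])).
    by apply: sigmaD (HA _ t0); [exact: sH|exact: ss.2].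
  apply/seteqP; split => w /=; first by move=> [? ?]; split => // -[].
  by move=> [? ?]; split => // ?; tauto.
- move=> A HA; split; first by apply: bigcupT_measurable => n; case: (HA n).
  move=> t t0; rewrite setI_bigcupl; apply: sigma_bigcup (sH t0) _ _ => n.
  by have [_] := HA n; exact.
Qed.

Lemma stopping_cst (t : R) : 0 <= t -> stopping_time H (fun=> t%:E).
Proof.
move=> t0; split=> [w|r r0]; first by rewrite lee_fin.
have [tr|rt] := leP t r.
  rewrite (_ : [set _ | _] = setT); first exact: sigmaT (sH r0).
  by apply/seteqP; split => w //= _; rewrite lee_fin.
rewrite (_ : [set _ | _] = set0); first exact: sigma0 (sH r0).
by apply/seteqP; split => w //=; rewrite lee_fin leNgt rt.
Qed.

Lemma stopping_min s u : stopping_time H s -> stopping_time H u ->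
  stopping_time H (fun w => Order.min (s w) (u w)).
Proof.
move=> [s0 ss] [u0 uu]; split=> [w|t t0]; first by rewrite le_min s0 u0.
rewrite (_ : [set _ | _] =
    [set w | (s w <= t%:E)%E] `|` [set w | (u w <= t%:E)%E]).
  by apply: sigmaU; [exact: sH|exact: ss|exact: uu].
by apply/seteqP; split => w /=; rewrite ge_min => /orP.
Qed.

Lemma stopping_max s u : stopping_time H s -> stopping_time H u ->
  stopping_time H (fun w => Order.max (s w) (u w)).
Proof.
move=> [s0 ss] [u0 uu]; split=> [w|t t0]; first by rewrite le_max s0.
rewrite (_ : [set _ | _] =
    [set w | (s w <= t%:E)%E] `&` [set w | (u w <= t%:E)%E]).
  by apply: sigmaI; [exact: sH|exact: ss|exact: uu].
by apply/seteqP; split => w /=; rewrite ge_max => /andP.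
Qed.

Lemma stopping_min_cst s (t : R) : 0 <= t -> stopping_time H s ->
  finite_stopping_time H (fun w => Order.min (s w) t%:E).
Proof.
move=> t0 ss; split; first exact: stopping_min (stopping_cst t0).
by move=> w; rewrite gt_min ltry orbT.
Qed.

Lemma finite_stopping_cst (t : R) : 0 <= t -> finite_stopping_time H (fun=> t%:E).
Proof. by move=> t0; split; [exact: stopping_cst|move=> w; rewrite ltry]. Qed.

Lemma sub_prior s u : stopping_time H u -> (forall w, (s w <= u w)%E) ->
  prior H s `<=` prior H u.
Proof.
move=> uu su A [mA HA]; split => // t t0.
rewrite (_ : _ `&` _ = (A `&` [set w | (s w <= t%:E)%E]) `&` [set w | (u w <= t%:E)%E]).
  by apply: sigmaI; [exact: sH|exact: HA|exact: uu.2].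
apply/seteqP; split => w /=; last by tauto.
by move=> [? ut]; split => //; split => //; exact: le_trans ut.
Qed.

Lemma prior_cst (t : R) : 0 <= t -> prior H (fun=> t%:E) = H t.
Proof.
move=> t0; apply/seteqP; split => [A [mA /(_ _ t0)]|A HA].
  rewrite (_ : [set _ | _] = setT) ?setIT//.
  by apply/seteqP; split => w //= _.
split; first exact: Hm HA.
move=> r r0; have [tr|rt] := leP t r.
  rewrite (_ : [set _ | _] = setT) ?setIT; first exact: HF.2 HA.
  by apply/seteqP; split => w //= _; rewrite lee_fin.
rewrite (_ : [set _ | _] = set0) ?setI0; first exact: sigma0 (sH r0).
by apply/seteqP; split => w //=; rewrite lee_fin leNgt rt.
Qed.

(** On [t < s] the truncated time equals [t]. This localisation later yields the martingale property
    at deterministic times. *)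
Lemma prior_min_gt s (t : R) A : 0 <= t -> stopping_time H s -> H t A ->
  prior H (fun w => Order.min (s w) t%:E) (A `&` [set w | (t%:E < s w)%E]).
Proof.
move=> t0 ss HA; have HAs : H t (A `&` [set w | (t%:E < s w)%E]).
  by apply: sigmaI => //; [exact: sH|exact: stopping_gt].
split; first exact: Hm HAs.
move=> r r0; have [tr|rt] := leP t r.
  rewrite [X in H r X](_ : _ = A `&` [set w | (t%:E < s w)%E]).
    exact: HF.2 HAs.
  by rewrite setIidl// => w [_ _] /=; rewrite ge_min lee_fin tr orbT.
rewrite [X in H r X](_ : _ = set0); first exact: sigma0 (sH r0).
apply/seteqP; split => w //= -[[_ ts]]; rewrite ge_min lee_fin [t <= r]leNgt rt orbF.
by move=> sr; have := lt_le_trans ts sr; rewrite lte_fin ltNge ltW.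
Qed.

(** The choice between [s] and [u] is made at [r], no later than either of them. *)
Lemma finite_stopping_glue r s u A : prior H r A ->
  stopping_time H r -> finite_stopping_time H s -> finite_stopping_time H u ->
  (forall w, (r w <= s w)%E) -> (forall w, (r w <= u w)%E) ->
  finite_stopping_time H (fun w => if w \in A then s w else u w).
Proof.
move=> rA rr [ss fs] [uu fu] rs ru; split; last by move=> w; case: ifP.
split=> [w|t t0]; first by case: ifP => _; [exact: ss.1|exact: uu.1].
have sA := sub_prior ss rs rA.
have uA : prior H u (~` A).
  by apply: sub_prior uu ru _ _; exact: sigmaC (prior_sub_sigma rr).1 _ rA.
rewrite (_ : [set _ | _] = (A `&` [set w | (s w <= t%:E)%E]) `|`
    (~` A `&` [set w | (u w <= t%:E)%E])).
  by apply: sigmaU; [exact: sH|exact: sA.2|exact: uA.2].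
apply/seteqP; split => w /=.
  by case: ifPn => [/set_mem|/negP]; [left|rewrite inE; right].
by case=> -[Aw]; [rewrite mem_set|rewrite memNset].
Qed.

(** If [s <= t] and [s < u], then either [u] lies after [t], or a rational at most [t] separates [s]
    from [u]; both cases are events of [H t]. *)
Lemma stopping_restrict s u : stopping_time H s -> stopping_time H u ->
  stopping_time H (fun w => if (s w < u w)%E then s w else +oo%E).
Proof.
move=> [s0 ss] uu; split=> [w|]; first by case: ifP.
suff key (t : R) : 0 <= t ->
  H t [set w | ((if s w < u w then s w else +oo) <= t%:E)%E] by exact: key.
move=> t0.
pose B q := [set w | (s w <= q%:E)%E] `&` [set w | (q%:E < u w)%E].
pose C (q : rat) : set T :=
  if (0 <= (ratr q : R) <= t) then B (ratr q : R) else set0.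
rewrite [X in H t X](_ : _ = B t `|` \bigcup_q C q).
  apply: sigmaU; first exact: sH.
    by apply: sigmaI; [exact: sH|exact: ss|exact: stopping_gt].
  apply: sigma_bigcup_rat (sH t0) _ _ => q.
  rewrite /C; case: ifPn => [/andP[q0 qt]|_]; last exact: sigma0 (sH t0).
  apply: (HF.2 _ _ q0 qt).
  by apply: sigmaI; [exact: sH|exact: ss|exact: stopping_gt].
apply/seteqP; split => w /=; last first.
  case=> [[st tu]|[q _]]; first by rewrite (le_lt_trans st tu).
  rewrite /C; case: ifPn => //= /andP[_ qt] [sq qu]; rewrite (le_lt_trans sq qu).
  by rewrite (le_trans sq)// lee_fin.
case: ifPn => // su st.
have [tu|ut] := ltP t%:E (u w); first by left.
right; have sfin : s w \is a fin_num.
  by rewrite ge0_fin_numE// (le_lt_trans st)// ltry.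
have ufin : u w \is a fin_num.
  by rewrite ge0_fin_numE ?(le_lt_trans ut) ?ltry//; exact: uu.1.
move: su (s0 w) ut st; rewrite /B /=.
rewrite -(fineK sfin) -(fineK ufin) lte_fin !lee_fin => su s0' ut st.
have [q] := rat_in_itvoo su; rewrite in_itv/= => /andP[sq qu].
exists q => //; rewrite /C (le_trans s0' (ltW sq)) (le_trans (ltW qu) ut)/=.
by rewrite /B /= -(fineK sfin) -(fineK ufin) lte_fin lee_fin qu ltW.
Qed.

Lemma stopping_modify s A : stopping_time H s -> H 0 A ->
  stopping_time H (fun w => if w \in A then 0%E else s w).
Proof.
move=> [s0 ss] HA; split=> [w|t t0]; first by case: ifP.
rewrite (_ : [set _ | _] = A `|` [set w | (s w <= t%:E)%E]).
  by apply: sigmaU; [exact: sH|exact: HF.2 HA|exact: ss].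
apply/seteqP; split => w /=.
  by case: ifPn => [/set_mem|_]; [left|right].
case: ifPn => [_ _|/negP]; first by rewrite lee_fin.
by rewrite inE => nA [].
Qed.

Lemma at_time_min_cst (X : R -> T -> R) s (t : R) :
  at_time X (fun w => Order.min (s w) t%:E) = stopped X s t.
Proof. by apply/funext => w; rewrite /at_time gt_min ltry orbT. Qed.

Lemma at_time_cst (X : R -> T -> R) (t : R) : at_time X (fun=> t%:E) = X t.
Proof. by apply/funext => w; rewrite /at_time ltry. Qed.

End stopping_times.

(** * Optional processes *)

Section right_discretization.
Context {R : realType}.

(** The first multiple of [1/(n+1)] strictly to the right of [x]; strictness matters because the
    filter of right limits excludes the point itself. *)
Definition right_grid (n : nat) (x : R) : R :=
  (Num.truncn (n.+1%:R * x)).+1%:R / n.+1%:R.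

Lemma right_grid_gt n x : 0 <= x -> x < right_grid n x.
Proof.
move=> x0; rewrite ltr_pdivlMr// mulrC.
by have /truncn_itv/andP[] : 0 <= n.+1%:R * x by rewrite mulr_ge0.
Qed.

Lemma right_grid_le n x : 0 <= x -> right_grid n x <= x + n.+1%:R^-1.
Proof.
move=> x0; rewrite ler_pdivrMr// mulrDl mulVf// -natr1 lerD2r [leRHS]mulrC.
by have /truncn_itv/andP[] : 0 <= n.+1%:R * x by rewrite mulr_ge0.
Qed.

Lemma cvg_right_grid x : 0 <= x -> right_grid n x @[n --> \oo] --> x.
Proof.
move=> x0; apply: (@squeeze_cvgr _ _ _ _ (cst x) (fun n => x + n.+1%:R^-1)).
- by apply: nearW => n; rewrite ltW ?right_grid_gt// right_grid_le.
- exact: cvg_cst.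
- rewrite -[X in _ --> X]addr0; apply: cvgD; first exact: cvg_cst.
  exact: cvg_harmonic.
Qed.

Lemma cvg_comp_right_grid (f : R -> R) x : 0 <= x -> f y @[y --> x^'+] --> f x ->
  f (right_grid n x) @[n --> \oo] --> f x.
Proof.
move=> x0 /cvg_at_rightP; apply; split; last exact: cvg_right_grid.
by move=> n; exact: right_grid_gt.
Qed.

Lemma right_cvg_min (f : R -> R) (c r : R) : 0 <= r -> 0 <= c ->
  (forall t, 0 <= t -> f x @[x --> t^'+] --> f t) ->
  f (Num.min y c) @[y --> r^'+] --> f (Num.min r c).
Proof.
move=> r0 c0 rf; have [cr|rc] := leP c r.
  apply: cvg_near_cst; near=> y.
  have ry : r < y by near: y; exact: nbhs_right_gt.
  by congr f; apply/min_idPr/ltW/(le_lt_trans cr).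
apply: cvg_trans (rf _ r0); apply: near_eq_cvg; near=> y.
by have /ltW/min_idPl -> : y < c by near: y; exact: nbhs_right_lt.
Unshelve. all: by end_near. Qed.

(** Discretised on the right grid, [x] takes countably many values, and right continuity passes to
    the limit. [Z] is arbitrary so that one argument serves both adaptedness of stopped processes
    and joint measurability in state and time. *)
Lemma right_continuous_family_measurable d (Z : measurableType d)
    (Y : R -> Z -> R) (x : Z -> R) :
  measurable_fun setT x -> (forall z, 0 <= x z) ->
  (forall r, 0 <= r -> measurable_fun setT (Y r)) ->
  (forall z r, 0 <= r -> Y y z @[y --> r^'+] --> Y r z) ->
  measurable_fun setT (fun z => Y (x z) z).
Proof.
move=> mx x0 mY rY.
apply: (@measurable_fun_cvg _ _ _ _ (fun n z => Y (right_grid n (x z)) z)); last first.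
  move=> z _; apply: (cvg_comp_right_grid (f := Y ^~ z)) => //; exact: rY.
move=> n _ B mB; rewrite setTI.
pose A k := [set z | Num.truncn (n.+1%:R * x z) = k].
rewrite (_ : _ @^-1` B = \bigcup_k (A k `&` Y (k.+1%:R / n.+1%:R) @^-1` B)).
  apply: bigcupT_measurable => k; apply: measurableI; last first.
    by rewrite -[X in measurable X]setTI; apply: mY.
  rewrite (_ : A k = (fun z => n.+1%:R * x z) @^-1` `[k%:R, k.+1%:R[); last first.
    apply/seteqP; split => z /=; rewrite in_itv/=.
      by move=> <-; apply/truncn_itv; rewrite mulr_ge0.
    by move=> ?; apply: truncn_def.
  rewrite -[X in measurable X]setTI.
  by have := measurableT_comp (mulrl_measurable n.+1%:R) mx; apply.
apply/seteqP; split => z /=; first by exists (Num.truncn (n.+1%:R * x z)).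
by move=> [k _ [<-]].
Qed.

End right_discretization.

Section optional_processes.
Context {R : realType} {d : measure_display} {T : measurableType d}.
Variable H : R -> set (set T).
Hypothesis HF : is_filtration H.
Implicit Types (X : R -> T -> R) (s : T -> \bar R).

Lemma stopped_wrt_rcll X s (t : R) : adapted H X -> (forall w, rcll (X ^~ w)) ->
  stopping_time H s -> 0 <= t -> wrt (H t) (stopped X s t).
Proof.
move=> aX rX ss t0; have [sH _] := HF.1 _ t0.
pose x w := fine (Order.min (s w) t%:E).
have xfin w : Order.min (s w) t%:E \is a fin_num.
  by rewrite ge0_fin_numE ?gt_min ?ltry ?orbT// le_min ss.1 lee_fin.
have x0 w : 0 <= x w by rewrite fine_ge0// le_min ss.1 lee_fin.
have xt w : x w <= t by rewrite -lee_fin fineK// ge_min lexx orbT.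
(* The grid points lie to the right of [x w] and may pass [t]; capping the time at [t] keeps the
   approximations [H t]-measurable. *)
rewrite (_ : stopped X s t = fun w => X (Num.min (x w) t) w); last first.
  by apply/funext => w; rewrite (min_idPl (xt w)).
apply/wrtP => //.
apply: (@right_continuous_family_measurable R _ (g_sigma_algebraType (H t))
  (fun r w => X (Num.min r t) w) x) => //.
- apply: (measurability _ (RGenOInfty.measurableE R)) => // _ [_ [r ->] <-].
  rewrite setTI -sigma_measurableE//.
  have [tr|rt] := leP t r.
    rewrite (_ : _ @^-1` _ = set0); first exact: sigma0.
    apply/seteqP; split => w //=; rewrite in_itv/= andbT => rx.
    by have := le_lt_trans (le_trans (xt w) tr) rx; rewrite ltxx.
  have [r0|r0] := leP 0 r; last first.
    rewrite (_ : _ @^-1` _ = setT); first exact: sigmaT.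
    by apply/seteqP; split => w //= _; rewrite in_itv/= andbT (lt_le_trans r0).
  rewrite (_ : _ @^-1` _ = [set w | (r%:E < s w)%E]).
    exact: HF.2 _ _ r0 (ltW rt) _ (stopping_gt HF ss r0).
  apply/seteqP; split => w /=; rewrite in_itv/= andbT -lte_fin fineK// lt_min.
    by case/andP.
  by move=> ->; rewrite lte_fin.
- move=> r r0; apply/(wrtP _ sH) => B mB.
  have rt0 : 0 <= Num.min r t by rewrite le_min r0.
  have := aX _ rt0 _ mB; apply: HF.2 => //.
  by rewrite ge_min lexx orbT.
- by move=> w r r0; apply: (right_cvg_min (f := X ^~ w)) => //; case: (rX w).
Qed.

Lemma at_time_wrt_rcll X s : adapted H X -> (forall w, rcll (X ^~ w)) ->
  finite_stopping_time H s -> wrt (prior H s) (at_time X s).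
Proof.
move=> aX rX [ss fs] B mB.
have key (t : R) : 0 <= t ->
    H t (at_time X s @^-1` B `&` [set w | (s w <= t%:E)%E]).
  move=> t0; have [sH _] := HF.1 _ t0.
  rewrite (_ : _ `&` _ = stopped X s t @^-1` B `&` [set w | (s w <= t%:E)%E]).
    by apply: sigmaI => //; [exact: stopped_wrt_rcll|exact: ss.2].
  apply/seteqP; split => w /= -[+ swt]; rewrite /at_time /stopped fs;
    by rewrite (min_idPl swt).
split => //.
rewrite (_ : _ @^-1` B =
  \bigcup_n (at_time X s @^-1` B `&` [set w | (s w <= n%:R%:E)%E])).
  apply: bigcupT_measurable => n; have [_] := HF.1 n%:R (ler0n _ _); apply.
  exact: key.
apply/seteqP; split => w /=; last by move=> [n _ []].
move=> Bw; exists (Num.truncn (fine (s w))).+1 => //; split => //=.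
have sfin : s w \is a fin_num by rewrite ge0_fin_numE ?fs//; exact: ss.1.
rewrite -(fineK sfin) lee_fin ltW//.
by have /truncn_itv/andP[] : 0 <= fine (s w) by rewrite fine_ge0//; exact: ss.1.
Qed.

Lemma optional_set_prior (E : set (T * R)) s : optional_sets H E ->
  finite_stopping_time H s -> prior H s [set w | E (w, fine (s w))].
Proof.
move=> HE [ss fs]; have [sP _] := prior_sub_sigma HF ss.
have s0 w : 0 <= fine (s w) by rewrite fine_ge0//; exact: ss.1.
move: E HE; apply: smallest_sub => [|_ [X [B [aX rX mB ->]]]].
  split.
  - exact: sigma0.
  - move=> A /= PA; rewrite (_ : [set w | _] = ~` [set w | A (w, fine (s w))]).
      exact: sigmaC.
    by apply/seteqP; split => w /=; [case|split].
  - move=> A /= PA; rewrite (_ : [set w | _] =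
        \bigcup_n [set w | A n (w, fine (s w))]); first exact: sigma_bigcup.
    by apply/seteqP; split => w /=.
rewrite /= (_ : [set w | _] = at_time X s @^-1` B).
  exact: at_time_wrt_rcll.
by apply/seteqP; split => w /=; rewrite /at_time fs//; case.
Qed.

Lemma optional_at_time X s : optional H X -> finite_stopping_time H s ->
  wrt (prior H s) (at_time X s).
Proof.
move=> oX fs B mB; have := optional_set_prior (oX _ mB) fs.
congr (prior H s _); apply/seteqP; split => w /=; rewrite /at_time fs.2; first by case.
by split => //; rewrite fine_ge0//; exact: fs.1.1.
Qed.

Lemma stopped_wrt X s (t : R) : optional H X -> 0 <= t -> stopping_time H s ->
  wrt (H t) (stopped X s t).
Proof.
move=> oX t0 ss B mB; rewrite -at_time_min_cst -(prior_cst HF t0).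
apply: (@sub_prior _ _ _ _ HF (fun w => Order.min (s w) t%:E)).
- exact: stopping_cst.
- by move=> w; rewrite ge_min lexx orbT.
- by apply: optional_at_time => //; exact: stopping_min_cst.
Qed.

(** Clamping the time at [s] is what allows [prior H s] as the sigma-field in the sample point, so
    that integrals in time up to [s] stay known at [s]. The clamp at 0 is there because indices
    range over all of [R]. *)
Lemma optional_set_joint (E : set (T * R)) s : optional_sets H E ->
  finite_stopping_time H s ->
  measurable ([set z | E (z.1, Num.min (Num.max 0 z.2) (fine (s z.1)))]
    : set (g_sigma_algebraType (prior H s) * R)).
Proof.
move=> HE [ss fs]; have [sP _] := prior_sub_sigma HF ss.
pose x (z : g_sigma_algebraType (prior H s) * R) :=
  Num.min (Num.max 0 z.2) (fine (s z.1)).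
have s0 w : 0 <= fine (s w) by rewrite fine_ge0//; exact: ss.1.
have sfin w : s w \is a fin_num by rewrite ge0_fin_numE ?fs//; exact: ss.1.
have x0 z : 0 <= x z by rewrite le_min le_max lexx s0.
move: E HE; apply: smallest_sub => [|_ [X [B [aX rX mB ->]]]].
  split.
  - by rewrite /= (_ : [set z | _] = set0).
  - move=> A /= PA.
    rewrite (_ : [set z | _] = ~` [set z | A (z.1, x z)]).
      exact: measurableC.
    apply/seteqP; split => z /=; first by case.
    by split => //; exact: x0.
  - move=> A /= PA; rewrite (_ : [set w | _] =
        \bigcup_n [set z | A n (z.1, x z)]); first exact: bigcupT_measurable.
    by apply/seteqP; split => w /=.
rewrite /= (_ : [set z | _] = (fun z => X (x z) z.1) @^-1` B); last first.
  by apply/seteqP; split => z /=; [case|split => //; exact: x0].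
rewrite -[X in measurable X]setTI.
apply: (@right_continuous_family_measurable R _ (g_sigma_algebraType (prior H s) * R)%type
  (fun r z => X (Num.min r (fine (s z.1))) z.1) (fun z => Num.max 0 z.2)) => //.
- by apply: measurable_maxr => //; exact: measurable_snd.
- by move=> z; rewrite le_max lexx.
- move=> r r0.
  pose g (w : g_sigma_algebraType (prior H s)) := X (Num.min r (fine (s w))) w.
  suff mg : measurable_fun setT g by exact: measurableT_comp mg (measurable_fst).
  apply/(wrtP _ sP) => B' mB'.
  apply: (@sub_prior _ _ _ _ HF (fun w => Order.min (s w) r%:E)) => //.
    by move=> w; rewrite ge_min lexx.
  have := at_time_wrt_rcll aX rX (stopping_min_cst HF r0 ss) mB'.
  rewrite at_time_min_cst; congr (prior _ _ _); apply/seteqP; split => w;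
    by rewrite /= /stopped -[in (Order.min (s w) _)](fineK (sfin w)) -EFin_min /= minC.
- by move=> z r r0; apply: (right_cvg_min (f := X ^~ z.1)) => //; case: (rX z.1).
Qed.

Lemma optional_joint X s : optional H X -> finite_stopping_time H s ->
  measurable_fun [set: g_sigma_algebraType (prior H s) * R]
    (fun z => X (Num.min (Num.max 0 z.2) (fine (s z.1))) z.1).
Proof.
move=> oX fs _ B mB; rewrite setTI.
have := optional_set_joint (oX _ mB) fs.
congr (measurable _); apply/seteqP; split => z /=; first by case.
split => //; rewrite le_min le_max lexx fine_ge0//; exact: fs.1.1.
Qed.

Lemma optional_measurable X : optional H X ->
  measurable_fun [set: T * R] (fun z => X (Num.max 0 z.2) z.1).
Proof.
move=> oX.
apply: (@measurable_fun_cvg _ (T * R)%type R setT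
  (fun (n : nat) z => X (Num.min (Num.max 0 z.2) n%:R) z.1)) => [n|z _].
  have n0 : 0 <= n%:R :> R by [].
  have fs := finite_stopping_cst HF n0.
  have := optional_joint oX fs.
  set TC := g_sigma_algebraType _ => mX.
  pose i : T * R -> TC * R := idfun.
  have mi : measurable_fun setT i.
    apply/measurable_fun_pairP; split; last exact: measurable_snd.
    pose j : T -> TC := idfun.
    suff mj : measurable_fun setT j by exact: measurableT_comp mj (measurable_fst).
    move=> _ B mB; rewrite setTI.
    have [sP] := prior_sub_sigma HF fs.1; apply.
    by rewrite sigma_measurableE.
  exact: (measurableT_comp mX mi).
apply: cvg_near_cst; near=> n; congr X; apply/min_idPl.
by near: n; exact: nbhs_infty_ger.
Unshelve. all: by end_near. Qed.

Lemma optional_section X w : optional H X ->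
  measurable_fun [set: R] (fun t => X (Num.max 0 t) w).
Proof.
by move=> oX; exact: (measurableT_comp (optional_measurable oX) (pair1_measurable w)).
Qed.

Lemma progressive_section X w (t : R) : progressive H X -> 0 <= t ->
  measurable_fun `[0, t] (X ^~ w).
Proof.
move=> pX t0 _ B mB; have := pX _ t0 _ mB.
rewrite (_ : _ `&` _ = [set u | [set p | 0 <= p.2 <= t /\ B (X p.2 p.1)] (w, u)]);
  last by apply/seteqP; split => u /=; rewrite in_itv.
move: [set p | _ /\ B (X p.2 p.1)]; apply: smallest_sub => [|_ [A [C [_ mC C0t ->]]]].
  split.
  - by rewrite /= (_ : [set u | _] = set0).
  - move=> A /= mA; rewrite (_ : [set u | _] = `[0, t] `\` [set u | A (w, u)]).
      exact: measurableD.
    by apply/seteqP; split => u /=; rewrite in_itv.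
  - move=> A /= mA; rewrite (_ : [set u | _] = \bigcup_n [set u | A n (w, u)]).
      exact: bigcupT_measurable.
    by apply/seteqP; split.
rewrite /=; have [wA|wA] := pselect (A w).
  by rewrite (_ : [set u | _] = C)//; apply/seteqP; split => u /=; [case|].
by rewrite (_ : [set u | _] = set0)//; apply/seteqP; split => u //= -[].
Qed.

End optional_processes.

(** * The Snell envelope *)

Section snell_envelope.
Context {R : realType} {d : measure_display} {T : measurableType d}.
Variable P : probability T R.
Local Notation intg f := (P.-integrable setT (EFin \o f)).

(** The infimum of the [g n] is nonnegative and its integral is below every positive [e], hence it
    is almost surely zero. *)
Lemma vanishing_integral_ae (g : nat -> T -> R) :
  (forall n, intg (g n)) -> (forall n w, 0 <= g n w) ->
  (forall e : R, 0 < e -> exists n, \int[P]_w g n w <= e) ->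
  \forall w \ae P, forall e : R, 0 < e -> exists n, g n w < e.
Proof.
move=> ig g0 small.
pose h w := einfs (fun n => (g n w)%:E) 0.
have mg n : measurable_fun setT (EFin \o g n) by exact: measurable_int (ig n).
have mh : measurable_fun setT h by exact: (measurable_fun_einfs mg).
have h0 w : (0 <= h w)%E.
  by apply: le_ereal_inf_tmp => _ [n _ <-]; rewrite lee_fin.
have hg n w : (h w <= (g n w)%:E)%E by apply: ereal_inf_lbound; exists n.
have Ih : (\int[P]_w `|h w| = 0)%E.
  under eq_integral do rewrite gee0_abs//.
  apply/eqP; rewrite eq_le integral_ge0 ?andbT//; apply/lee_addgt0Pr => e e0.
  have [n ge] := small _ e0; rewrite add0e.
  apply: (@le_trans _ _ (\int[P]_w (g n w)%:E)%E).
    by apply: ge0_le_integral => //; exact: mg.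
  by rewrite -[leLHS]fineK ?lee_fin//; exact: integrable_fin_num (ig n).
have /(ae_eq_integral_abs P measurableT mh) := Ih.
apply: filterS => w /(_ Logic.I) /= hw e e0.
apply: contrapT => /forallNP nge.
have : (e%:E <= h w)%E.
  apply: le_ereal_inf_tmp => _ [n _ <-]; rewrite lee_fin leNgt.
  by apply/negP/nge.
by rewrite hw lee_fin leNgt e0.
Qed.

Variable H : R -> set (set T).
Hypothesis HF : is_filtration H.
Variables X S : R -> T -> R.
Hypothesis X_wrt : forall s, finite_stopping_time H s -> wrt (prior H s) (at_time X s).
Hypothesis X_intg : forall s, finite_stopping_time H s -> intg (at_time X s).
Variable M : R.
Hypothesis X_bounded : forall s, finite_stopping_time H s ->
  \int[P]_w at_time X s w <= M.
Hypothesis S_snell : is_snell P H X S.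

Section at_stopping_time.
Variable r : T -> \bar R.
Hypothesis fr : finite_stopping_time H r.

Let rC : sub_sigma (prior H r).
Proof. exact: prior_sub_sigma fr.1. Qed.

Let above th := finite_stopping_time H th /\ forall w, (r w <= th w)%E.

(** The family is directed upwards: at [r] the two conditional expectations are compared and the
    better time is followed. *)
Lemma condexp_max th1 th2 V1 V2 : above th1 -> above th2 ->
  is_condexp P (prior H r) (at_time X th1) V1 ->
  is_condexp P (prior H r) (at_time X th2) V2 ->
  exists th, above th /\
    is_condexp P (prior H r) (at_time X th) (fun w => Num.max (V1 w) (V2 w)).
Proof.
move=> [f1 r1] [f2 r2] c1 c2.
have [_ i1 w1 _] := c1; have [_ i2 w2 _] := c2.
move/wrtP: (w1) => /(_ rC.1) m1; move/wrtP: (w2) => /(_ rC.1) m2.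
pose A := [set w | V2 w <= V1 w].
have CA : prior H r A.
  rewrite sigma_measurableE; last exact: rC.1.
  have /(_ [set true] Logic.I) := measurable_fun_ler m2 m1 measurableT.
  by rewrite setTI.
have mA := rC.2 _ CA.
pose th w := if w \in A then th1 w else th2 w.
have fth : finite_stopping_time H th by exact: (finite_stopping_glue HF CA fr.1).
have ath : above th by split => // w; rewrite /th; case: ifP.
exists th; split=> //; apply: is_condexp_intro => //.
- exact: X_intg.
- exact: intg_max.
- by apply/(wrtP _ rC.1); exact: measurable_maxr.
move=> B CB; have mB := rC.2 _ CB.
rewrite (Rintegral_setUC mB mA); last exact: intg_max.
rewrite (Rintegral_setUC mB mA); last exact: X_intg.
congr (_ + _).
  transitivity (\int[P]_(w in B `&` A) V1 w).
    by apply: eq_Rintegral => w /[!inE] -[_ Aw]; apply/max_idPl.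
  rewrite (condexp_Rintegral c1); last exact: sigmaI rC.1 _ _ CB CA.
  apply: eq_Rintegral => w /[!inE] -[_ Aw]; rewrite /at_time /th.
  by rewrite mem_set.
transitivity (\int[P]_(w in B `\` A) V2 w).
  apply: eq_Rintegral => w /[!inE] -[_ Aw]; apply/max_idPr.
  by have [/Aw//|/ltW] := leP (V2 w) (V1 w).
rewrite (condexp_Rintegral c2); last exact: sigmaD rC.1 _ _ CB CA.
apply: eq_Rintegral => w /[!inE] -[_ Aw]; rewrite /at_time /th.
by rewrite memNset.
Qed.

Let above_condexp th : above th ->
  exists V, is_condexp P (prior H r) (at_time X th) V.
Proof. by move=> [f _]; apply: condexp_exists => //; exact: X_intg. Qed.

(** A maximising sequence is made monotone by running maxima, each of which is again the conditional
    expectation for a glued time. The bound [M] makes the supremum finite. *)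
Lemma snell_attained : exists (th : nat -> T -> \bar R) (V : nat -> T -> R),
  [/\ forall n, above (th n) /\ is_condexp P (prior H r) (at_time X (th n)) (V n),
      forall w, {homo V ^~ w : m n / (m <= n)%N >-> m <= n} &
      forall th', above th' -> forall n,
        \int[P]_w at_time X th' w <= \int[P]_w V n w + n.+1%:R^-1].
Proof.
pose E := [set x | exists2 th, above th & x = \int[P]_w at_time X th w].
have supE : has_sup E.
  split; first by exists (\int[P]_w at_time X r w); exists r.
  by exists M => _ [th [fth _] ->]; exact: X_bounded.
have [th0 hth0] : {th : nat -> T -> \bar R & forall n, above (th n) /\
    sup E - n.+1%:R^-1 < \int[P]_w at_time X (th n) w}.
  apply: (@boolp.choice _ _ (fun n th => above th /\ sup E - n.+1%:R^-1 < \int[P]_w at_time X th w)) => n.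
  have [] := @sup_adherent _ E (n.+1%:R^-1) _ supE; first by rewrite invr_gt0.
  by move=> _ [th ath ->] ?; exists th.
have [V0 hV0] : {V : nat -> T -> R &
    forall n, is_condexp P (prior H r) (at_time X (th0 n)) (V n)}.
  apply: (@boolp.choice _ _ (fun n V => is_condexp P (prior H r) (at_time X (th0 n)) V)) => n.
  by apply: above_condexp; case: (hth0 n).
pose V := fix V n := if n is m.+1 then (fun w => Num.max (V m w) (V0 n w)) else V0 0%N.
have [th hth] : {th : nat -> T -> \bar R & forall n, above (th n) /\
    is_condexp P (prior H r) (at_time X (th n)) (V n)}.
  apply: (@boolp.choice _ _ (fun n th => above th /\ is_condexp P (prior H r) (at_time X th) (V n))).
  elim=> [|n [th [ath cth]]].
    by exists (th0 0%N); split; [case: (hth0 0%N)|exact: hV0].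
  exact: condexp_max ath (hth0 n.+1).1 cth (hV0 n.+1).
exists th, V; split => //.
- move=> w; apply: homo_leq => //=; first exact: le_trans.
  by move=> n /=; rewrite le_max lexx.
move=> th' ath' n; apply: (@le_trans _ _ (sup E)).
  by apply: sup_upper_bound => //; exists th'.
rewrite -lerBlDr (le_trans (ltW (hth0 n).2))//.
rewrite -(condexp_Rintegral (hV0 n)); last exact: sigmaT rC.1.
apply: le_Rintegral => //; [by case: (hV0 n)|by case: (hth n).2|].
by move=> w _; case: n => [|n] //=; rewrite le_max lexx orbT.
Qed.

(** Integrated form of the essential supremum: the envelope at [r] lies above every [V n] and below
    their limit. The error [e] is uniform in [A]. *)
Lemma snell_Rintegral :
  [/\ intg (at_time S r),
      forall th A, above th -> prior H r A ->
        \int[P]_(w in A) at_time X th w <= \int[P]_(w in A) at_time S r w &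
      forall e : R, 0 < e -> exists2 th, above th & forall A, prior H r A ->
        \int[P]_(w in A) at_time S r w <= \int[P]_(w in A) at_time X th w + e].
Proof.
have [th [V [hV homoV supV]]] := snell_attained.
have [oS /(_ _ fr) [_ S_ub S_least]] := S_snell.
have iV n : intg (V n) by case: (hV n).2.
have mS : measurable_fun setT (at_time S r).
  by apply: (wrt_measurable rC); exact: optional_at_time.
have VS n : \forall w \ae P, V n w <= at_time S r w.
  have [[fth rth] cth] := hV n.
  have : \forall w \ae P, ((V n w)%:E <= (at_time S r w)%:E)%E.
    by apply: S_ub; exists (th n), (V n); split.
  by apply: filterS => w; rewrite lee_fin.
(* Subtracting [V 0] makes the increasing sequence nonnegative, as monotone convergence requires;
   the limit is taken in the extended reals since its finiteness follows only from its integral. *)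
pose phi n w := V n w - V 0%N w.
have iphi n : intg (phi n) by exact: intgB.
have phi0 n w : 0 <= phi n w by rewrite subr_ge0 homoV.
pose phioo w := ereal_sup (range (fun n => (phi n w)%:E)).
have ndphi w : nondecreasing_seq (fun n => (phi n w)%:E).
  by move=> m n mn; rewrite lee_fin lerD2r homoV.
have cphi w : (phi n w)%:E @[n --> \oo] --> phioo w.
  exact: ereal_nondecreasing_cvgn.
have mphi n : measurable_fun setT (EFin \o phi n) by exact: measurable_int (iphi n).
have mphioo : measurable_fun setT phioo.
  by apply: (@emeasurable_fun_cvg _ _ _ _ (fun n => EFin \o phi n)) => // w _; exact: cphi.
have mV0 : measurable_fun setT (EFin \o V 0%N) by exact: measurable_int (iV _).
(* The maximum of [V n] and [V'] is an admissible conditional expectation, so its mean exceeds that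
   of [V n] by at most [1/(n+1)]; the limit of the [V n] thus dominates every competitor. *)
have V_phi th' V' : above th' -> is_condexp P (prior H r) (at_time X th') V' ->
    \forall w \ae P, ((V' w)%:E <= phioo w + (V 0%N w)%:E)%E.
  move=> ath' cV'; have [_ iV' _ _] := cV'.
  have : \forall w \ae P, forall e : R, 0 < e -> exists n,
      Num.max (V n w) (V' w) - V n w < e.
    apply: vanishing_integral_ae.
    - by move=> n; apply: intgB => //; exact: intg_max.
    - by move=> n w; rewrite subr_ge0 le_max lexx.
    - move=> e e0; exists (Num.truncn e^-1).
      rewrite RintegralB//; last exact: intg_max.
      have [th'' [ath'' c'']] := condexp_max (hV (Num.truncn e^-1)).1 ath' (hV _).2 cV'.
      rewrite (condexp_Rintegral c''); last exact: sigmaT rC.1.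
      rewrite lerBlDl (le_trans (supV _ ath'' (Num.truncn e^-1)))// lerD2l invf_ple ?posrE//.
      by have /truncn_itv/andP[_ /ltW] : 0 <= e^-1 by rewrite invr_ge0 ltW.
  apply: filterS => w hw; apply/lee_addgt0Pr => e e0.
  have [n] := hw _ e0; rewrite ltrBlDr => hn.
  apply: (@le_trans _ _ ((phi n w)%:E + (V 0%N w)%:E + e%:E)%E).
    rewrite -!EFinD lee_fin /phi subrK addrC.
    by rewrite (le_trans _ (ltW hn))// le_max lexx orbT.
  by rewrite leeD2r// leeD2r//; apply: ereal_sup_ubound; exists n.
have Sphi : \forall w \ae P, ((at_time S r w)%:E <= phioo w + (V 0%N w)%:E)%E.
  apply: (S_least (fun w => phioo w + (V 0%N w)%:E)%E).
    exact: emeasurable_funD.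
  by move=> _ [th' [V' [fth' rth' cV' ->]]]; exact: (V_phi th').
have phioo0 w : (0 <= phioo w)%E.
  apply: le_trans (_ : (phi 0%N w)%:E <= _)%E; first by rewrite lee_fin.
  by apply: ereal_sup_ubound; exists 0%N.
have EV n : \int[P]_w V n w = \int[P]_w at_time X (th n) w.
  by apply: (condexp_Rintegral (hV n).2); exact: sigmaT rC.1.
have Iphioo k : (\int[P]_w phioo w <=
    (\int[P]_w V k w + k.+1%:R^-1 - \int[P]_w V 0%N w)%:E)%E.
  rewrite (_ : phioo = fun w => limn (fun n => (phi n w)%:E)); last first.
    by apply/funext => w; apply/esym/cvg_lim.
  rewrite monotone_convergence//; last by move=> n w _; rewrite lee_fin; exact: phi0.
  apply: lime_le.
    apply: ereal_nondecreasing_is_cvgn => m n mn.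
    by apply: ge0_le_integral => //; try exact: mphi; move=> w _;
    rewrite lee_fin; first [exact: phi0|rewrite /phi lerD2r; exact: homoV].
  apply: nearW => n; rewrite -[leLHS]fineK; last exact: integrable_fin_num (iphi n).
  rewrite lee_fin -[leLHS]/(\int[P]_w (V n w - V 0%N w)) RintegralB//.
  by rewrite lerD2r EV supV//; exact: (hV n).1.
have mSV : measurable_fun setT (EFin \o (at_time S r \- V 0%N)).
  by apply/measurable_EFinP; apply: measurable_funB => //; exact/measurable_EFinP.
have IS_phioo : (\int[P]_w `|(at_time S r w - V 0%N w)%:E| <= \int[P]_w phioo w)%E.
  apply: ae_ge0_le_integral => //; first exact: measurableT_comp.
  apply: filterS2 Sphi (VS 0%N) => w Sphi V0S _ /=.
  by rewrite ger0_norm ?subr_ge0// EFinB leeBlDr.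
have iSV : intg (at_time S r \- V 0%N).
  apply/integrableP; split => //.
  exact: le_lt_trans IS_phioo (le_lt_trans (Iphioo 0%N) (ltry _)).
have iS : intg (at_time S r).
  rewrite (_ : at_time S r = (at_time S r \- V 0%N) \+ V 0%N).
    exact: intgD.
  by apply/funext => w /=; rewrite subrK.
have S_ge th' A : above th' -> prior H r A ->
    \int[P]_(w in A) at_time X th' w <= \int[P]_(w in A) at_time S r w.
  move=> ath' CA; have [V' cV'] := above_condexp ath'.
  have [_ iV' _ _] := cV'.
  rewrite -(condexp_Rintegral cV' CA); apply: le_Rintegral_ae => //; first exact: rC.2.
  have : \forall w \ae P, ((V' w)%:E <= (at_time S r w)%:E)%E.
    by apply: S_ub; exists th', V'; split => //; case: ath'.
  by apply: filterS => w; rewrite lee_fin.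
have IS n : \int[P]_w at_time S r w <= \int[P]_w V n w + n.+1%:R^-1.
  rewrite -(lerD2r (- \int[P]_w V 0%N w)) -RintegralB// -lee_fin.
  apply: le_trans (Iphioo n); apply: le_trans IS_phioo.
  rewrite /Rintegral fineK; last exact: integrable_fin_num iSV.
  apply: le_trans (lee_abs _) _; exact: le_abse_integral.
split => // e e0.
pose n := Num.truncn e^-1; exists (th n); first exact: (hV n).1.
move=> A CA; have mA := rC.2 _ CA.
rewrite -(condexp_Rintegral (hV n).2 CA).
have ne : n.+1%:R^-1 <= e.
  rewrite invf_ple ?posrE//.
  by have /truncn_itv/andP[_ /ltW] : 0 <= e^-1 by rewrite invr_ge0 ltW.
have := le_trans (IS n) (lerD (lexx _) ne).
rewrite (Rintegral_setUC measurableT mA)// (Rintegral_setUC measurableT mA (iV n)).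
rewrite setTI setTD.
(* Off [A] the envelope dominates [V n], so the excess on [A] is at most the total excess. *)
have : \int[P]_(w in ~` A) V n w <= \int[P]_(w in ~` A) at_time S r w.
  apply: le_Rintegral_ae => //; first exact: measurableC.
  by apply: filterS (VS n).
by move=> *; lra.
Qed.

End at_stopping_time.

Let S_intg r : finite_stopping_time H r -> intg (at_time S r).
Proof. by move=> fr; have [] := snell_Rintegral fr. Qed.

Lemma snell_ge r : finite_stopping_time H r ->
  \forall w \ae P, at_time X r w <= at_time S r w.
Proof.
move=> fr; have [iS S_ge _] := snell_Rintegral fr.
apply: (wrt_le_ae (prior_sub_sigma HF fr.1)) => //.
- exact: X_wrt.
- by apply: optional_at_time => //; case: S_snell.
- exact: X_intg.
- by move=> A CA; apply: S_ge.
Qed.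

Lemma snell_supermartingale r s A : finite_stopping_time H r ->
  finite_stopping_time H s -> (forall w, (r w <= s w)%E) -> prior H r A ->
  \int[P]_(w in A) at_time S s w <= \int[P]_(w in A) at_time S r w.
Proof.
move=> fr fs rs CA; apply/ler_addgt0Pr => e e0.
have [_ S_ge _] := snell_Rintegral fr.
have [_ _ /(_ _ e0) [th [fth sth] S_le]] := snell_Rintegral fs.
apply: (le_trans (S_le _ (sub_prior HF fs.1 rs CA))); rewrite lerD2r.
by apply: S_ge => //; split => // w; exact: le_trans (sth w).
Qed.

Lemma snell_value s : finite_stopping_time H s ->
  \int[P]_w at_time X s w <= \int[P]_w S 0 w.
Proof.
move=> fs; have f0 := finite_stopping_cst HF (lexx (0 : R)).
have [_ S_ge _] := snell_Rintegral f0.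
rewrite -[S 0](at_time_cst S); apply: S_ge; last exact: sigmaT (prior_sub_sigma HF f0.1).1.
by split => // w; exact: fs.1.1.
Qed.

Lemma snell_value_attained (e : R) : 0 < e ->
  exists2 s, finite_stopping_time H s & \int[P]_w S 0 w <= \int[P]_w at_time X s w + e.
Proof.
move=> e0; have f0 := finite_stopping_cst HF (lexx (0 : R)).
have [_ _ /(_ _ e0) [s [fs _] S_le]] := snell_Rintegral f0.
exists s => //; rewrite -[S 0](at_time_cst S); apply: S_le.
exact: sigmaT (prior_sub_sigma HF f0.1).1.
Qed.

(** Stands in for class (D). Being one-sided and localised on events of [H n], it involves only
    increments of the reward after [n], and these are what the two problems have in common. *)
Hypothesis X_tail : forall e : R, 0 < e -> exists N : nat, forall n, (N <= n)%N ->
  forall th A, finite_stopping_time H th -> (forall w, (n%:R%:E <= th w)%E) -> H n%:R A ->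
  \int[P]_(w in A) at_time X th w <= \int[P]_(w in A) X n%:R w + e.

Let cut (sigma : T -> \bar R) (n : nat) := fun w => Order.min (sigma w) n%:R%:E.

Let stopped0 (sigma : T -> \bar R) : stopping_time H sigma -> stopped S sigma 0 = S 0.
Proof.
move=> [s0 _]; apply/funext => w; rewrite /stopped; congr (S _ w).
by have /min_idPr -> := s0 w.
Qed.

(** The martingale property moves [S 0] to the truncated time. Where [sigma] has occurred, envelope
    and reward agree; elsewhere the envelope at [n] is nearly attained by a later time, whose
    advantage over stopping at [n] is small by [X_tail]. *)
Lemma optimal_lim sigma : optimal_times P H (fun=> +oo%E) X S sigma ->
  forall e : R, 0 < e -> exists N : nat, forall n, (N <= n)%N ->
    \int[P]_w S 0 w <= \int[P]_w at_time X (cut sigma n) w + e.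
Proof.
move=> [ss _ XS martS] e e0; have e20 : 0 < e / 2 by rewrite divr_gt0.
have [N tail] := X_tail e20; exists N => n Nn.
have n0 : (0 : R) <= n%:R by [].
have fn := finite_stopping_cst HF n0.
have fcut := stopping_min_cst HF n0 ss.
have := condexp_Rintegral (martS _ _ (lexx 0) n0) (sigmaT (HF.1 _ (lexx 0)).1).
rewrite (stopped0 ss) => ->; rewrite -at_time_min_cst.
pose A := [set w | (n%:R%:E < sigma w)%E].
have HA : H n%:R A by exact: stopping_gt.
have mA : measurable A by have [_] := HF.1 _ n0; apply.
have iX := X_intg fcut; have iS := S_intg fcut.
rewrite (Rintegral_setUC measurableT mA iS) (Rintegral_setUC measurableT mA iX).
rewrite setTI setTD addrAC; apply: lerD.
  have [_ _ /(_ _ e20) [th [fth nth] S_le]] := snell_Rintegral fn.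
  have E Y : \int[P]_(w in A) at_time Y (cut sigma n) w = \int[P]_(w in A) Y n%:R w.
    apply: eq_Rintegral => w /[!inE] Aw; rewrite at_time_min_cst /stopped.
    by rewrite (min_idPr (ltW Aw)).
  rewrite !E -[in leLHS](at_time_cst S).
  have HA' := HA; rewrite -(prior_cst HF n0) in HA.
  apply: (le_trans (S_le _ HA)).
  by have := tail _ Nn _ _ fth nth HA'; lra.
apply: le_Rintegral_ae => //; first exact: measurableC.
apply: filterS XS => w XS /= /negP; rewrite -leNgt => sn.
have sfin : sigma w \is a fin_num.
  by rewrite ge0_fin_numE ?(le_lt_trans sn) ?ltry//; exact: ss.1.
rewrite !at_time_min_cst /stopped (min_idPl sn).
by rewrite (XS (fine (sigma w))) ?fineK// fine_ge0//; exact: ss.1.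
Qed.

(** Rewards close to the value force the supermartingale to keep a constant mean along [sigma],
    hence the martingale property; the gap between envelope and reward is nonnegative with vanishing
    mean, hence the contact at [sigma]. *)
Lemma lim_optimal sigma : stopping_time H sigma ->
  (forall (e : R) (N : nat), 0 < e -> exists2 n : nat, (N <= n)%N &
    \int[P]_w S 0 w <= \int[P]_w at_time X (cut sigma n) w + e) ->
  optimal_times P H (fun=> +oo%E) X S sigma.
Proof.
move=> ss lim.
pose scut (t : R) w := Order.min (sigma w) t%:E.
have fcut t : 0 <= t -> finite_stopping_time H (scut t) by move=> t0; exact: stopping_min_cst.
have scut_le (t u : R) w : t <= u -> (scut t w <= scut u w)%E.
  by move=> tu; rewrite /scut le_min ge_min lexx ge_min lee_fin tu orbT.
(* For the lower bound: the reward at a later truncation is dominated by the envelope there, whose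
   mean is at most the mean at [t]. *)
have ES (t : R) : 0 <= t -> \int[P]_w at_time S (scut t) w = \int[P]_w S 0 w.
  move=> t0; apply/eqP; rewrite eq_le; apply/andP; split.
    rewrite -[X in _ <= \int[P]_w X w](stopped0 ss) -at_time_min_cst.
    apply: snell_supermartingale; [exact: fcut|exact: fcut| |].
      by move=> w; exact: scut_le.
    exact: sigmaT (prior_sub_sigma HF (fcut _ (lexx _)).1).1.
  apply/ler_addgt0Pr => e e0; have [n tn Sn] := lim e (Num.truncn t).+1 e0.
  apply: (le_trans Sn); rewrite lerD2r.
  have n0 : (0 : R) <= n%:R by [].
  apply: (@le_trans _ _ (\int[P]_w at_time S (scut n%:R) w)).
    apply: le_Rintegral_ae => //; [exact/X_intg/fcut|exact/S_intg/fcut|].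
    by apply: filterS (snell_ge (fcut _ n0)).
  apply: snell_supermartingale; [exact: fcut|exact: fcut| |].
    move=> w; apply: scut_le; apply: (@le_trans _ _ (Num.truncn t).+1%:R).
      by have /truncn_itv/andP[_ /ltW] := t0.
    by rewrite ler_nat.
  exact: sigmaT (prior_sub_sigma HF (fcut _ t0).1).1.
have XScut (m : nat) : \forall w \ae P, (sigma w <= m%:R%:E)%E ->
    at_time S (scut m%:R) w - at_time X (scut m%:R) w = 0.
  have fm := fcut m%:R (ler0n _ _).
  apply: (@Rintegral_le0_ae0 _ _ _ _ [set w | (sigma w <= m%:R%:E)%E]
    (at_time S (scut m%:R) \- at_time X (scut m%:R))).
  - exact: (stopping_le_measurable HF).
  - by apply: intgB; [exact: S_intg|exact: X_intg].
  - by apply: filterS (snell_ge fm) => w; rewrite /= subr_ge0.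
  (* On [sigma <= m] the gap is the same at every truncation beyond [m], so it may be measured at an
     [n] where the total gap is at most [e]. *)
  - apply/ler_addgt0Pr => e e0; have [n mn Sn] := lim e m e0; rewrite add0r.
    have fn := fcut n%:R (ler0n _ _).
    pose D := at_time S (scut n%:R) \- at_time X (scut n%:R).
    have iD : intg D by apply: intgB; [exact: S_intg|exact: X_intg].
    have mm := stopping_le_measurable HF m%:R ss.
    apply: (@le_trans _ _ (\int[P]_w D w)); last first.
      rewrite RintegralB//; [|exact: S_intg|exact: X_intg].
      by rewrite ES// lerBlDl.
    rewrite (Rintegral_setUC measurableT mm iD) setTI.
    rewrite (_ : \int[P]_(x in _) _ = \int[P]_(x in [set w | (sigma w <= m%:R%:E)%E]) D x).
      rewrite lerDl setTD.
      have mm' := measurableC mm.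
      rewrite -(mul0r (fine (P (~` [set w | (sigma w <= m%:R%:E)%E])))) -Rintegral_cst//.
      apply: le_Rintegral_ae => //; first exact: intg_cst.
      by apply: filterS (snell_ge fn) => w + _; rewrite subr_ge0.
    apply: eq_Rintegral => w /[!inE] /= sm.
    rewrite /D /= !at_time_min_cst /stopped (min_idPl sm) (min_idPl _)//.
    by rewrite (le_trans sm)// lee_fin ler_nat.
split => //; first by apply: aeW => w; rewrite leey.
- have : \forall w \ae P, forall m : nat, (sigma w <= m%:R%:E)%E ->
    at_time S (scut m%:R) w - at_time X (scut m%:R) w = 0.
    by apply/ae_foralln => m; exact: XScut.
  apply: filterS => w SX t t0 st.
  have tm : t <= (Num.truncn t).+1%:R by have /truncn_itv/andP[_ /ltW] := t0.
  have := SX (Num.truncn t).+1; rewrite st lee_fin => /(_ tm)/subr0_eq.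
  by rewrite !at_time_min_cst /stopped st (min_idPl _) ?lee_fin.
- move=> t u t0 tu; have u0 := le_trans t0 tu.
  have [sH Hm] := HF.1 _ t0.
  apply: is_condexp_intro.
  + by split.
  + by rewrite -at_time_min_cst; exact/S_intg/fcut.
  + by rewrite -at_time_min_cst; exact/S_intg/fcut.
  + by apply: stopped_wrt => //; case: S_snell.
  move=> A HA; have mA := Hm _ HA.
  rewrite -!at_time_min_cst -/(scut t) -/(scut u).
  (* Off [B] both sides are frozen at [sigma]. On the part of [A] in [B], the supermartingale
     inequality is an equality, since the total means agree and the complement satisfies the same
     inequality. *)
  pose B := [set w | (t%:E < sigma w)%E].
  have HB : H t B by exact: stopping_gt.
  have mB := Hm _ HB.
  have iSt := S_intg (fcut _ t0); have iSu := S_intg (fcut _ u0).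
  rewrite (Rintegral_setUC mA mB iSt) (Rintegral_setUC mA mB iSu).
  apply: f_equal2; last first.
    apply: eq_Rintegral => w /[!inE] -[_ /negP]; rewrite -leNgt => st.
    rewrite !at_time_min_cst /stopped (min_idPl st) (min_idPl _)//.
    by rewrite (le_trans st)// lee_fin.
  have CAB := prior_min_gt HF t0 ss HA.
  have sP := (prior_sub_sigma HF (fcut _ t0).1).1.
  have mAB : measurable (A `&` B) by exact: measurableI.
  apply/eqP; rewrite eq_le; apply/andP; split; last first.
    apply: snell_supermartingale => //; [exact: fcut|exact: fcut|].
    by move=> w; exact: scut_le.
  have : \int[P]_w at_time S (scut t) w = \int[P]_w at_time S (scut u) w by rewrite !ES.
  rewrite (Rintegral_setUC measurableT mAB iSt) (Rintegral_setUC measurableT mAB iSu).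
  rewrite setTI setTD => E.
  rewrite -(lerD2r (\int[P]_(w in ~` (A `&` B)) at_time S (scut t) w)) E lerD2l.
  apply: snell_supermartingale; [exact: fcut|exact: fcut| |].
    by move=> w; exact: scut_le.
  exact: sigmaC sP _ CAB.
Qed.

End snell_envelope.

(** * The enlarged filtration *)

Section enlargement.
Context {R : realType} {d : measure_display} {T : measurableType d}.
Variable P : probability T R.
Variables (F : R -> set (set T)) (tau : T -> \bar R).
Hypothesis F_usual : usual_filtration P F.
Hypothesis tau_random : random_time tau.

Lemma usual_is_filtration : is_filtration F.
Proof. by case: F_usual => F1 F2 _ _; split => // t t0; exact: F1. Qed.

Let HF := usual_is_filtration.

Let gen (s : R) := F s `|` [set E | exists u B, [/\ 0 <= u <= s, measurable B &
  E = (fun w => default_process tau w u) @^-1` B]].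

Lemma default_process_measurable (u : R) (B : set R) :
  measurable ((fun w => default_process tau w u) @^-1` B).
Proof.
have mtau : measurable [set w | (tau w <= u%:E)%E].
  by rewrite -[X in measurable X]setTI; apply: emeasurable_fun_infty_c => //; case: tau_random.
rewrite (_ : _ @^-1` B =
  ([set w | (tau w <= u%:E)%E] `&` [set _ | B 1]) `|`
  (~` [set w | (tau w <= u%:E)%E] `&` [set _ | B 0])); last first.
  apply/seteqP; split => w /=; rewrite /default_process /= /unit_jump.
    by case: leP => _ ?; [left|right].
  by case: leP => _ /= [[]|[]].
have mcst (Q : Prop) : measurable [set _ : T | Q].
  have [q|nq] := pselect Q.
    have -> : [set _ : T | Q] = setT by apply/seteqP; split.
    exact: measurableT.
  have -> : [set _ : T | Q] = set0 by apply/seteqP; split.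
  exact: measurable0.
by apply: measurableU; apply: measurableI => //; exact: measurableC.
Qed.

Lemma enlarged_is_filtration : is_filtration (enlarged F tau).
Proof.
split=> [t t0|t r t0 tr A HA s rs]; last by apply: HA; exact: le_lt_trans rs.
split; first split.
- by move=> s _; exact: sigma_algebra0.
- by move=> A HA s ts; apply: sigma_algebraCD; exact: HA.
- by move=> A HA s ts; apply: sigma_algebra_bigcup => n; exact: HA.
move=> A /(_ (t + 1)); rewrite /= ltrDl ltr01 => /(_ isT).
apply: smallest_sub; first exact: sigma_algebra_measurable.
move=> E [FE|[u [B [_ _ ->]]]]; last exact: default_process_measurable.
by have [_] := HF.1 _ (addr_ge0 t0 ler01); apply.
Qed.

Lemma sub_enlarged (t : R) : 0 <= t -> F t `<=` enlarged F tau t.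
Proof.
move=> t0 A FA s /= ts; apply: sub_sigma_algebra; left.
exact: (HF.2 _ _ t0 (ltW ts)).
Qed.

Lemma stopping_enlarged s : stopping_time F s -> stopping_time (enlarged F tau) s.
Proof. by move=> [s0 ss]; split => // t t0; apply: sub_enlarged => //; exact: ss. Qed.

Lemma finite_stopping_enlarged s :
  finite_stopping_time F s -> finite_stopping_time (enlarged F tau) s.
Proof. by move=> [? ?]; split => //; exact: stopping_enlarged. Qed.

Lemma random_time_stopping_enlarged : stopping_time (enlarged F tau) tau.
Proof.
split=> [|t t0 s /= ts]; first by case: tau_random.
apply: sub_sigma_algebra; right; exists t, [set 1]; split.
- by rewrite t0 ltW.
- exact: measurable_set1.
apply/seteqP; split => w /=; rewrite /default_process /= /unit_jump.
  by move=> ->.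
by case: leP => //= _ /esym/eqP; rewrite oner_eq0.
Qed.

(** On [s < tau] the default process vanishes up to [s], so the generators coming from [tau] become
    trivial there; the events that have an [F s]-trace form a sigma-algebra. *)
Lemma enlarged_trace (s : R) (E : set T) : 0 <= s -> <<s gen s >> E ->
  exists2 A, F s A & E `&` [set w | (s%:E < tau w)%E] = A `&` [set w | (s%:E < tau w)%E].
Proof.
move=> s0; have [sF _] := HF.1 _ s0.
move: E; apply: smallest_sub; first split.
- by exists set0; [exact: sigma0|].
- move=> E [A FA EA]; exists (~` A); first exact: sigmaC.
  rewrite setTD; apply/seteqP; split => w /= [nE sw]; split => //.
    by move=> Aw; apply: nE; have [] : (E `&` [set w | (s%:E < tau w)%E]) w by rewrite EA.
  by move=> Ew; apply: nE; have [] : (A `&` [set w | (s%:E < tau w)%E]) w by rewrite -EA.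
- move=> E HE; have [A HA] := @boolp.choice _ _ (fun n A => F s A /\
    E n `&` [set w | (s%:E < tau w)%E] = A `&` [set w | (s%:E < tau w)%E])
    (fun n => let: ex_intro2 A FA EA := HE n in ex_intro _ A (conj FA EA)).
  exists (\bigcup_n A n); first by apply: sigma_bigcup => // n; case: (HA n).
  by rewrite !setI_bigcupl; apply: eq_bigcupr => n _; case: (HA n).
move=> E [FE|[u [B [/andP[u0 us] mB ->]]]]; first by exists E.
have D0 w : (s%:E < tau w)%E -> default_process tau w u = 0.
  move=> sw; rewrite /default_process /= /unit_jump leNgt.
  by rewrite (le_lt_trans _ sw)// lee_fin.
have [B0|B0] := pselect (B 0).
  exists setT; first exact: sigmaT.
  by apply/seteqP; split => w /= [? sw]; split => //; rewrite D0.
exists set0; first exact: sigma0.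
by apply/seteqP; split => w //= [+ sw]; rewrite D0.
Qed.

(** The enlarged filtration is an intersection over later times, so [theta <= q] need not be
    generated by the data up to [q]. The strict inequality is a countable union of events at times
    before [q], and is. *)
Lemma enlarged_lt (theta : T -> \bar R) (q : R) :
  stopping_time (enlarged F tau) theta -> 0 < q ->
  exists A, F q A /\
    [set w | (theta w < q%:E)%E] `&` [set w | (q%:E < tau w)%E] = A `&` [set w | (q%:E < tau w)%E].
Proof.
move=> [th0 thG] q0.
have [||A FA EA] := @enlarged_trace q [set w | (theta w < q%:E)%E]; first exact: ltW.
  rewrite (_ : [set w | _] = \bigcup_n [set w | (theta w <= (q - n.+1%:R^-1)%:E)%E]).
    apply: sigma_algebra_bigcup => n.
    have [n0|n0] := leP 0 (q - n.+1%:R^-1).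
      by apply: (thG _ n0) => /=; rewrite ltrBlDr ltrDl invr_gt0.
    rewrite (_ : [set w | _] = set0); first exact: sigma_algebra0.
    apply/seteqP; split => w //= /(le_trans (th0 w)); rewrite lee_fin.
    by rewrite leNgt n0.
  apply/seteqP; split => w /=; last first.
    by move=> [n _ /= /le_lt_trans]; apply; rewrite lte_fin ltrBlDr ltrDl invr_gt0.
  move=> thq; have thfin : theta w \is a fin_num.
    by rewrite ge0_fin_numE ?(lt_trans thq) ?ltry.
  move: thq; rewrite -(fineK thfin) lte_fin => thq.
  exists (Num.truncn (q - fine (theta w))^-1) => //=.
  rewrite -(fineK thfin) lee_fin lerBrDl -lerBrDr invf_ple ?posrE ?subr_gt0//.
  by have /truncn_itv/andP[_ /ltW] : 0 <= (q - fine (theta w))^-1 by rewrite invr_ge0 subr_ge0 ltW.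
by exists A.
Qed.

(* Before tau the two filtrations have the same trace; the F-stopping time is
   the infimum of the rationals q at which the F_q-trace of {theta < q} holds. *)
Lemma enlarged_stopping_trace (theta : T -> \bar R) :
  stopping_time (enlarged F tau) theta ->
  exists2 sigma, stopping_time F sigma &
    forall w, Order.min (sigma w) (tau w) = Order.min (theta w) (tau w).
Proof.
move=> ths.
have exA (q : rat) : exists A, 0 < (ratr q : R) -> F (ratr q) A /\
    [set w | (theta w < (ratr q)%:E)%E] `&` [set w | ((ratr q)%:E < tau w)%E] =
    A `&` [set w | ((ratr q)%:E < tau w)%E].
  have [q0|q0] := pselect (0 < (ratr q : R)); last by exists set0.
  by have [A FA] := enlarged_lt ths q0; exists A.
have [A HA] := @boolp.choice _ _ _ exA.
pose Q w := [set (ratr q : R)%:E | q in [set q | 0 < (ratr q : R) /\ A q w]].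
pose sigma w := ereal_inf (Q w).
have sigma_lt w (c : R) : (sigma w < c%:E)%E ->
    exists q, [/\ 0 < (ratr q : R), A q w & (ratr q : R) < c].
  by move=> /ereal_inf_lt[_ [q [q0 Aq] <-]]; rewrite lte_fin; exists q.
have sigma_le w q : 0 < (ratr q : R) -> A q w -> (sigma w <= (ratr q)%:E)%E.
  by move=> q0 Aq; apply: ereal_inf_lbound; exists q.
exists sigma; first split.
- move=> w; apply: le_ereal_inf_tmp => _ [q [q0 _] <-].
  by rewrite lee_fin ltW.
- suff key (t : R) : 0 <= t -> F t [set w | (sigma w <= t%:E)%E] by exact: key.
  move=> t0; have [_ _ _ Frc] := F_usual.
  (* The infimum decides [sigma <= t] only just after [t]; right continuity of [F] absorbs this,
     with levels [c n] decreasing to [t]. *)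
  rewrite Frc// => u /= tu; have u0 : 0 <= u by rewrite (le_trans t0)// ltW.
  have [sF _] := HF.1 _ u0.
  pose c n := t + (u - t) / n.+1%:R.
  have cu n : c n <= u.
    have ut0 : 0 <= u - t by rewrite subr_ge0 ltW.
    by rewrite /c -lerBrDl ler_pdivrMr// ler_peMr// ler1n.
  have tc n : t < c n by rewrite ltrDl divr_gt0// subr_gt0.
  pose C n (q : rat) : set T := if (0 < (ratr q : R) < c n) then A q else set0.
  rewrite (_ : [set w | _] = \bigcap_n \bigcup_q C n q).
    apply: sigma_bigcap => // n; apply: sigma_bigcup_rat => // q.
    rewrite /C; case: ifPn => [/andP[q0 qc]|_]; last exact: sigma0.
    apply: HF.2 (proj1 (HA q q0)); first exact: ltW.
    by rewrite (le_trans (ltW qc)).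
  apply/seteqP; split => w /=.
    move=> st n _; have : (sigma w < (c n)%:E)%E by rewrite (le_lt_trans st)// lte_fin.
    by move=> /sigma_lt[q [q0 Aq qc]]; exists q => //; rewrite /C q0 qc.
  move=> sC; apply/lee_addgt0Pr => e e0.
  have [q _] := sC (Num.truncn ((u - t) / e)) Logic.I.
  rewrite /C; case: ifPn => // /andP[q0 qc] Aq.
  apply: (le_trans (sigma_le _ _ q0 Aq)); rewrite lee_fin (le_trans (ltW qc))//.
  rewrite /c lerD2l ler_pdivrMr// mulrC -ler_pdivrMr//.
  by have /truncn_itv/andP[_ /ltW] : 0 <= (u - t) / e by rewrite divr_ge0 ?subr_ge0 ?ltW.
move=> w; have th0 := ths.1 w.
have le1 : (Order.min (theta w) (tau w) <= sigma w)%E.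
  apply: le_ereal_inf_tmp => _ [q [q0 Aq] <-].
  rewrite ge_min; have [qt|qt] := ltP (ratr q)%:E (tau w); last by rewrite orbT.
  rewrite orbF; have [_ EA] := HA _ q0.
  have [/= thq _] : ([set w | (theta w < (ratr q)%:E)%E] `&` [set w | ((ratr q)%:E < tau w)%E]) w.
    by rewrite EA.
  exact: ltW.
apply/eqP; rewrite eq_le; apply/andP; split; last first.
  by rewrite le_min le1 ge_min lexx orbT.
rewrite le_min [X in _ && X]ge_min lexx orbT andbT.
rewrite leNgt; apply/negP; rewrite lt_min => /andP[ths1 thtau].
have thfin : theta w \is a fin_num by rewrite ge0_fin_numE ?(lt_le_trans ths1) ?leey.
pose m := Order.min (sigma w) (tau w).
have thm : (theta w < m)%E by rewrite lt_min ths1.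
(* A real level above [theta] and at most [m], even when [m] is infinite. A rational [q] between
   [theta] and this level belongs to the set whose infimum is [sigma], against [q < sigma]. *)
have [r thr rm] : exists2 r : R, fine (theta w) < r & (r%:E <= m)%E.
  move: thm; rewrite -(fineK thfin); case: m => [r|_|//].
    by rewrite lte_fin; exists r.
  by exists (fine (theta w) + 1); rewrite ?ltrDl ?leey.
have [q] := rat_in_itvoo thr; rewrite in_itv/= => /andP[thq qr].
have q0 : 0 < (ratr q : R) by rewrite (le_lt_trans _ thq)// fine_ge0.
have qm : ((ratr q)%:E < m)%E by rewrite (lt_le_trans _ rm)// lte_fin.
have [qs qtau] : (((ratr q)%:E < sigma w) /\ ((ratr q)%:E < tau w))%E.
  by move: qm; rewrite lt_min => /andP.
have [_ EA] := HA _ q0.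
have [Aq _] : (A q `&` [set w | ((ratr q)%:E < tau w)%E]) w.
  by rewrite -EA; split => //=; rewrite -(fineK thfin) lte_fin.
by have := le_lt_trans (sigma_le _ _ q0 Aq) qs; rewrite ltxx.
Qed.

End enlargement.

(** * The reward of a stopped process *)

Section uniform_integrability.
Context {R : realType} {d : measure_display} {T : measurableType d}.
Variable P : probability T R.
Local Notation intg f := (P.-integrable setT (EFin \o f)).
Variable Phi : set (T -> R).
Hypothesis uiPhi : uniformly_integrable P Phi.

Let mabs (f : T -> R) : measurable_fun setT f -> measurable_fun setT (fun w => `|f w|%:E).
Proof. by move=> mf; exact/measurable_EFinP/measurableT_comp. Qed.

Let mtail (f : T -> R) (c : R) : measurable_fun setT f -> measurable [set w | c < `|f w|].
Proof.
move=> mf; have mf' : measurable_fun setT (fun w => `|f w|) by exact: measurableT_comp.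
have /(_ [set true] Logic.I) := measurable_fun_ltr (measurable_cst c) mf' measurableT.
by rewrite setTI.
Qed.

Lemma ui_bound (e : R) : 0 < e -> exists2 c : R, 0 <= c & forall f, Phi f ->
  (\int[P]_(w in [set w | (c < `|f w|)%R]) `|f w|%:E <= e%:E)%E /\
  forall A, measurable A -> (\int[P]_(w in A) `|f w|%:E <= e%:E + c%:E * P A)%E.
Proof.
move=> e0; have [mPhi /(_ _ e0) [c0 hc0]] := uiPhi.
exists (Num.max c0 0); first by rewrite le_max lexx orbT.
set c := Num.max c0 0; have c_ge0 : 0 <= c by rewrite le_max lexx orbT.
move=> f Phif; have mf := mPhi _ Phif.
have tail : (\int[P]_(w in [set w | (c < `|f w|)%R]) `|f w|%:E <= e%:E)%E.
  apply: le_trans (hc0 _ Phif); apply: ge0_subset_integral => //.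
  - exact: mtail.
  - exact: mtail.
  - by apply: measurable_funTS; exact: mabs.
  - by move=> w /=; apply: le_lt_trans; rewrite le_max lexx.
split=> // A mA; set B := [set w | c < `|f w|] in tail *.
have mB : measurable B by exact: mtail.
rewrite -(setDUK (@subIsetl _ A B)).
have -> : A `\` (A `&` B) = A `\` B by rewrite setDIr setDv set0U.
rewrite ge0_integral_setU//; last 4 first.
- exact: measurableI.
- exact: measurableD.
- by apply: measurable_funTS; exact: mabs.
- by apply/disj_setPS => w [[_ Bw] [_ +]].
apply: leeD.
  apply: le_trans tail; apply: ge0_subset_integral => //.
  - exact: measurableI.
  - by apply: measurable_funTS; exact: mabs.
apply: (@le_trans _ _ (\int[P]_(w in A `\` B) c%:E)%E).
  apply: ge0_le_integral => //.
  - exact: measurableD.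
  - by apply: measurable_funTS; exact: mabs.
  - by move=> w [_ /negP]; rewrite -leNgt lee_fin.
rewrite integral_cst//; last exact: measurableD.
rewrite lee_wpmul2l ?lee_fin// le_measure ?inE//.
- exact: measurableD.
- by apply: measurableU; [exact: measurableI|exact: measurableD].
Qed.

Lemma ui_intg f : Phi f -> intg f.
Proof.
move=> Phif; have [mPhi _] := uiPhi; have mf := mPhi _ Phif.
apply/integrableP; split; first exact/measurable_EFinP.
have [c _ /(_ _ Phif) [_ /(_ _ measurableT)]] := ui_bound ltr01.
by move=> /le_lt_trans; apply; rewrite probability_setT mule1 -EFinD ltry.
Qed.

Lemma ui_Rintegral_bound (e : R) : 0 < e -> exists2 c : R, 0 <= c &
  forall f, Phi f -> forall A, measurable A ->
  \int[P]_(w in A) `|f w| <= e + c * fine (P A).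
Proof.
move=> e0; have [c c0 hc] := ui_bound e0; exists c => // f Phif A mA.
have [_ /(_ _ mA)] := hc _ Phif.
have iA : (\int[P]_(w in A) `|f w|%:E)%E \is a fin_num.
  have := integrable_norm (intgS mA (ui_intg Phif)).
  by move/(integrable_fin_num mA).
by rewrite -(fineK iA) -[P A in X in X -> _]fineK ?fin_num_measure.
Qed.

(** Clipping at level [c] costs at most [e / 3] for every member of the family, and the clipped
    functions fall under dominated convergence; [clip] is 1-Lipschitz, so pointwise limits survive
    it. *)
Lemma ui_cvg_Rintegral (f_ : nat -> T -> R) f : (forall n, Phi (f_ n)) -> Phi f ->
  (\forall w \ae P, f_ n w @[n --> \oo] --> f w) ->
  \int[P]_w f_ n w @[n --> \oo] --> \int[P]_w f w.
Proof.
move=> Phif_ Phif cf; have [mPhi _] := uiPhi.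
apply/cvgrPdist_le => e e0; have e30 : 0 < e / 3 by rewrite divr_gt0.
have [c c0 hc] := ui_bound e30.
pose clip (x : R) := Num.max (- c) (Num.min x c).
have clip_le x : `|clip x| <= c.
  rewrite /clip ler_norml le_max lexx/= ge_max ge_min lexx orbT andbT.
  by rewrite (le_trans _ c0)// oppr_le0.
have clip_sub x : c < `|x| -> `|x - clip x| <= `|x|.
  rewrite /clip; case: (ger0P x) => x0 cx.
    rewrite (min_idPr (ltW cx)) (max_idPr _); last lra.
    by rewrite ler_norml; apply/andP; split; lra.
  rewrite (min_idPl _) ?(max_idPl _); try lra.
  by rewrite ler_norml; apply/andP; split; lra.
have clip_id x : `|x| <= c -> clip x = x.
  by rewrite ler_norml => /andP[cx xc]; rewrite /clip (min_idPl xc) (max_idPr cx).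
have clip_lip x y : `|clip x - clip y| <= `|x - y|.
  have xy := ler_norm (x - y); have := ler_norm (y - x); rewrite distrC.
  move: `|x - y| xy => D xy yx; rewrite /clip ler_norml.
  have cc : - c <= c by lra.
  case: (leP x c) => xc; case: (leP y c) => yc; rewrite ?(max_idPr cc).
  - by case: (leP (- c) x) => ?; case: (leP (- c) y) => ?; apply/andP; split; lra.
  - by case: (leP (- c) x) => ?; apply/andP; split; lra.
  - by case: (leP (- c) y) => ?; apply/andP; split; lra.
  - by apply/andP; split; lra.
have mclip : measurable_fun setT clip.
  by apply: measurable_maxr => //; exact: measurable_minr.
have iclip g : Phi g -> intg (clip \o g).
  move=> Phig; apply: measurable_bounded_integrable => //.
  - by rewrite -ge0_fin_numE// fin_num_measure.
  - by apply: measurableT_comp => //; exact: mPhi.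
  - exists c; split; first exact: num_real.
    by move=> x cx w _; rewrite /= (le_trans (clip_le _))// ltW.
have clip_err g : Phi g -> `|\int[P]_w g w - \int[P]_w (clip \o g) w| <= e / 3.
  move=> Phig; have mg := mPhi _ Phig.
  rewrite -RintegralB//; [|exact: ui_intg|exact: iclip].
  have iB : intg (g \- (clip \o g)) by apply: intgB; [exact: ui_intg|exact: iclip].
  apply: (le_trans (le_normr_Rintegral measurableT iB)).
  rewrite -lee_fin fineK; last exact: integrable_fin_num (integrable_norm iB).
  apply: le_trans (hc _ Phig).1; rewrite [leRHS]integral_mkcond.
  apply: ge0_le_integral => //.
  - exact: (measurable_int P (integrable_norm iB)).
  - by apply/(measurable_restrictT _ (mtail c mg)); apply: measurable_funTS; exact: mabs.
  - move=> w _; rewrite patchE; case: ifPn => [|/negP].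
      by rewrite inE /= lee_fin; exact: clip_sub.
    by rewrite inE /= => /negP; rewrite -leNgt => /clip_id ->; rewrite subrr normr0.
have /cvgrPdist_le/(_ _ e30) clip_cvg :
    \int[P]_w (clip \o f_ n) w @[n --> \oo] --> \int[P]_w (clip \o f) w.
  apply: fine_cvg; rewrite fineK; last exact: integrable_fin_num (iclip _ Phif).
  have [//|//|//|//|//|_ _] := @dominated_convergence _ _ _ P setT measurableT
    (fun n w => ((clip \o f_ n) w)%:E) (fun w => ((clip \o f) w)%:E) (cst c%:E).
  - by move=> n; apply/measurable_EFinP/measurableT_comp => //; exact: mPhi.
  - by apply/measurable_EFinP/measurableT_comp => //; exact: mPhi.
  - apply: filterS cf => w cf _; apply: cvg_EFin; first exact: nearW.
    move/cvgrPdist_le : cf => cf; apply/cvgrPdist_le => e' /cf.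
    by apply: filterS => n; apply: le_trans; exact: clip_lip.
  - exact: finite_measure_integrable_cst.
  - by apply: aeW => w n _; rewrite lee_fin; exact: clip_le.
  by [].
near=> n.
have := clip_err _ Phif; have := clip_err _ (Phif_ n).
have : `|\int[P]_w (clip \o f) w - \int[P]_w (clip \o f_ n) w| <= e / 3.
  by near: n.
set a := \int[P]_w (clip \o f_ n) w; set b := \int[P]_w (clip \o f) w.
move: (\int[P]_w f w) (\int[P]_w f_ n w) => x y.
rewrite !ler_norml => /andP[? ?] /andP[? ?] /andP[? ?].
by apply/andP; split; lra.
Unshelve. all: by end_near. Qed.

End uniform_integrability.

(** * Class (D) processes frozen at an almost surely finite stopping time *)

Section stopped_reward.
Context {R : realType} {d : measure_display} {T : measurableType d}.
Variable P : probability T R.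
Local Notation intg f := (P.-integrable setT (EFin \o f)).
Variables (H : R -> set (set T)) (tau : T -> \bar R) (X : R -> T -> R).
Hypothesis HF : is_filtration H.
Hypothesis H_negligible : forall A, P.-negligible A -> H 0 A.
Hypothesis tau_stopping : stopping_time H tau.
Hypothesis tau_fin : \forall w \ae P, (tau w < +oo)%E.
Hypothesis X_rcll : \forall w \ae P, rcll (X ^~ w).
Hypothesis X_classD : classD P H X.
Hypothesis X_stopped : indistinguishable P (stopped X tau) X.

(** [tau] is finite only almost surely, while finite stopping times are finite everywhere. Moving a
    null set to 0 keeps a stopping time, as [H 0] contains the negligible sets. *)
Definition finite_part : T -> \bar R :=
  fun w => if w \in [set w | tau w = +oo%E] then 0%E else tau w.

Lemma finite_part_ae : \forall w \ae P, finite_part w = tau w.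
Proof.
apply: filterS tau_fin => w tw; rewrite /finite_part memNset//= => E.
by rewrite E ltxx in tw.
Qed.

Lemma finite_part_stopping : finite_stopping_time H finite_part.
Proof.
split.
  apply: stopping_modify => //; apply: H_negligible.
  have [N [mN N0 sN]] := tau_fin; exists N; split => // w /= tw.
  by apply: sN => /=; rewrite tw.
move=> w; rewrite /finite_part; case: ifPn => [_|/negP]; first by rewrite ltry.
by rewrite inE /= ltey => /eqP.
Qed.

Let fs_tau theta : stopping_time H theta ->
  finite_stopping_time H (fun w => Order.min (theta w) (finite_part w)).
Proof.
move=> ths; have [f1 f2] := finite_part_stopping; split; first exact: stopping_min.
by move=> w; rewrite gt_min f2 orbT.
Qed.

Let Phi := [set f | exists2 s, finite_stopping_time H s & f = at_time X s].

Let PhiX s : finite_stopping_time H s -> Phi (at_time X s).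
Proof. by exists s. Qed.

Lemma classD_intg s : finite_stopping_time H s -> intg (at_time X s).
Proof. by move=> fs; apply: (ui_intg X_classD); exact: PhiX. Qed.

Lemma classD_bounded : exists M, forall s, finite_stopping_time H s ->
  \int[P]_w at_time X s w <= M.
Proof.
have [c c0 hc] := ui_Rintegral_bound X_classD ltr01.
exists (1 + c) => s fs; have := hc _ (PhiX fs) _ measurableT.
rewrite probability_setT mulr1; apply: le_trans.
apply: le_Rintegral => //; first exact: classD_intg.
  exact: integrable_norm (classD_intg fs).
by move=> w _; exact: ler_norm.
Qed.

Lemma at_time_stopped s : finite_stopping_time H s ->
  \forall w \ae P, at_time X s w =
    at_time X (fun w => Order.min (s w) (finite_part w)) w.
Proof.
move=> fs; apply: filterS2 finite_part_ae X_stopped => w tw Xw.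
rewrite /at_time fs.2 gt_min fs.2 /= tw minC.
have sfin : s w \is a fin_num by rewrite ge0_fin_numE ?fs.2//; exact: fs.1.1.
rewrite -Xw ?fine_ge0//; last exact: fs.1.1.
by rewrite /stopped fineK.
Qed.

(** The cap gives a reward also to times that take the value infinity; since [X] is frozen at [tau],
    finite times keep their expected reward. *)
Definition reward theta : R :=
  \int[P]_w at_time X (fun w => Order.min (theta w) (finite_part w)) w.

Lemma reward_finite s : finite_stopping_time H s ->
  \int[P]_w at_time X s w = reward s.
Proof.
move=> fs; apply: eq_Rintegral_ae => //; [exact: classD_intg| |].
  by apply/classD_intg/fs_tau; case: fs.
by apply: filterS (at_time_stopped fs).
Qed.

Lemma reward_ext theta theta' :
  (forall w, Order.min (theta w) (tau w) = Order.min (theta' w) (tau w)) ->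
  stopping_time H theta -> stopping_time H theta' -> reward theta = reward theta'.
Proof.
move=> E ths ths'; apply: eq_Rintegral_ae => //; [exact/classD_intg/fs_tau|exact/classD_intg/fs_tau|].
apply: filterS finite_part_ae => w tw _; rewrite /at_time tw.
by have -> : Order.min (theta w) (tau w) = Order.min (theta' w) (tau w).
Qed.

(** Almost every path of the sequence is stationary once [n] exceeds [tau]. *)
Lemma reward_cut theta : stopping_time H theta ->
  \int[P]_w at_time X (fun w => Order.min (theta w) n%:R%:E) w @[n --> \oo] --> reward theta.
Proof.
move=> ths; apply: (ui_cvg_Rintegral X_classD).
- by move=> n; apply: PhiX; exact: stopping_min_cst.
- exact/PhiX/fs_tau.
have : \forall w \ae P, forall n : nat, at_time X (fun w => Order.min (theta w) n%:R%:E) w =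
    at_time X (fun w => Order.min (Order.min (theta w) n%:R%:E) (finite_part w)) w.
  apply/ae_foralln => n; apply: at_time_stopped; exact: stopping_min_cst.
apply: filterS => w E; apply: cvg_near_cst; near=> n; rewrite E.
rewrite /at_time -minA [Order.min n%:R%:E _](min_idPr _)//.
have [f1 f2] := finite_part_stopping.
have tfin : finite_part w \is a fin_num by rewrite ge0_fin_numE ?f2//; exact: f1.1.
rewrite -(fineK tfin) lee_fin.
by near: n; exact: nbhs_infty_ger.
Unshelve. all: by end_near. Qed.

(** The capped times decrease to the capped limit, and right continuity carries the rewards
    along. *)
Lemma reward_decreasing (theta_ : nat -> T -> \bar R) theta :
  (forall n, stopping_time H (theta_ n)) -> stopping_time H theta ->
  (forall w m n, (m <= n)%N -> (theta_ n w <= theta_ m w)%E) ->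
  (forall w, theta w = ereal_inf (range (theta_ ^~ w))) ->
  reward (theta_ n) @[n --> \oo] --> reward theta.
Proof.
move=> ths_ ths ni infE; apply: (ui_cvg_Rintegral X_classD).
- by move=> n; exact/PhiX/fs_tau.
- exact/PhiX/fs_tau.
apply: filterS X_rcll => w [rX _].
have [f1 f2] := finite_part_stopping.
pose m (x : \bar R) := Order.min x (finite_part w).
have m0 th : stopping_time H th -> (0 <= m (th w))%E.
  by move=> th0; rewrite le_min f1.1 th0.1.
have mfin th : stopping_time H th -> m (th w) \is a fin_num.
  by move=> th0; rewrite ge0_fin_numE ?m0// gt_min f2 orbT.
have mlt x : (m x < +oo)%E by rewrite gt_min f2 orbT.
rewrite /at_time; under eq_fun do rewrite mlt; rewrite mlt.
pose x n := fine (m (theta_ n w)); pose y := fine (m (theta w)).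
have yx n : y <= x n.
  rewrite fine_le ?mfin// /m le_min ge_min [X in _ && X]ge_min lexx orbT andbT.
  by rewrite infE ereal_inf_lbound//; exists n.
have xy (e : R) : 0 < e -> \forall n \near \oo, x n < y + e.
  move=> e0; have [n0 hn0] : exists n0, x n0 < y + e.
    (* If the cap binds at the limit, it binds along the whole sequence; otherwise the limit is
       finite and is approached as an infimum. *)
    have [tw|tw] := leP (finite_part w) (theta w).
      exists 0%N; rewrite (_ : x 0%N = y) ?ltrDl// /x /y /m (min_idPr tw) (min_idPr _)//.
      by rewrite (le_trans tw)// infE ereal_inf_lbound//; exists 0%N.
    have yE : y = fine (theta w) by rewrite /y /m (min_idPl (ltW tw)).
    have tfin : theta w \is a fin_num by rewrite ge0_fin_numE ?(lt_trans tw)//; exact: ths.1.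
    have : (theta w < (y + e)%:E)%E by rewrite -(fineK tfin) lte_fin yE ltrDl.
    rewrite infE => /ereal_inf_lt[_ [n _ <-] hn]; exists n.
    rewrite -lte_fin fineK ?mfin// (le_lt_trans _ hn)// /m ge_min lexx//.
  exists n0 => // n /= n0n; apply: le_lt_trans hn0.
  rewrite fine_le ?mfin// /m le_min !ge_min lexx orbT andbT.
  by rewrite ni.
have y0 : 0 <= y by rewrite fine_ge0// m0.
have /cvgrPdist_le Xy := rX _ y0.
apply/cvgrPdist_le => e e0; have := Xy _ e0.
rewrite /at_right near_withinE => /nbhs_ballP[r /= r0 Xr].
apply: filterS (xy _ r0) => n xnr.
(* The filter of right limits excludes [y], so indices at which the limit is attained are treated
   apart. *)
have := yx n; rewrite le_eqVlt => /orP[/eqP yxn|yxn].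
  by rewrite -/(x n) -yxn -/y subrr normr0 ltW.
apply: Xr => //; rewrite /ball/= ltr_distlC.
by rewrite (lt_trans _ yxn) ?xnr// ltrBlDr ltrDl.
Qed.

(** Where [tau <= n] the process no longer moves. The rest has probability tending to 0, and each of
    the two integrals over it is at most [e / 2]: one [e / 4] from the tails of the family, one from
    the small probability. *)
Lemma classD_tail (e : R) : 0 < e -> exists N : nat, forall n, (N <= n)%N ->
  forall th A, finite_stopping_time H th -> (forall w, (n%:R%:E <= th w)%E) ->
  measurable A ->
  \int[P]_(w in A) at_time X th w <= \int[P]_(w in A) X n%:R w + e.
Proof.
move=> e0; have e40 : 0 < e / 4 by rewrite divr_gt0.
have [c c0 hc] := ui_Rintegral_bound X_classD e40.
pose B n := [set w | (n%:R%:E < finite_part w)%E].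
have ft := finite_part_stopping.
have mB n : measurable (B n).
  have [_] := HF.1 n%:R (ler0n _ _); apply; exact: (stopping_gt HF ft.1).
have PB : fine (P (B n)) @[n --> \oo] --> (0 : R).
  apply: fine_cvg; rewrite -[X in _ --> X](measure0 P).
  have <- : \bigcap_n B n = set0.
    apply/seteqP; split => w //= Bw.
    have tfin : finite_part w \is a fin_num by rewrite ge0_fin_numE ?ft.2//; exact: ft.1.1.
    have := Bw (Num.truncn (fine (finite_part w))).+1 Logic.I.
    rewrite /B /= -(fineK tfin) lte_fin ltNge => /negP; apply; apply: ltW.
    by have /truncn_itv/andP[] : 0 <= fine (finite_part w) by rewrite fine_ge0//; exact: ft.1.1.
  apply: nonincreasing_cvg_mu => //.
  - by rewrite -ge0_fin_numE// fin_num_measure.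
  - exact: bigcapT_measurable.
  - move=> m n mn; apply/subsetPset => w; rewrite /B /=; apply: le_lt_trans.
    by rewrite lee_fin ler_nat.
have [N _ PN] : \forall n \near \oo, c * fine (P (B n)) <= e / 4.
  have /cvgrPdist_le/(_ _ e40) : c * fine (P (B n)) @[n --> \oo] --> c * 0.
    by apply: cvgM => //; exact: cvg_cst.
  apply: filterS => n; rewrite mulr0 sub0r normrN ger0_norm// mulr_ge0// fine_ge0//.
exists N => n Nn th A fth nth mA.
have n0 : (0 : R) <= n%:R by [].
have fn := finite_stopping_cst HF n0.
have iX := classD_intg fth; have iXn := classD_intg fn.
rewrite at_time_cst in iXn.
rewrite (Rintegral_setUC mA (mB n) iX) (Rintegral_setUC mA (mB n) iXn).
have mAB : measurable (A `&` B n) by exact: measurableI.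
have mAB' : measurable (A `\` B n) by exact: measurableD.
have E : \int[P]_(w in A `\` B n) at_time X th w = \int[P]_(w in A `\` B n) X n%:R w.
  apply: eq_Rintegral_ae => //.
  apply: filterS2 (at_time_stopped fth) (at_time_stopped fn) => w -> + [_ /negP].
  rewrite at_time_cst => ->; rewrite -leNgt => tn.
  by rewrite /at_time (min_idPr tn) (min_idPr (le_trans tn (nth w))).
rewrite E addrAC lerD2r.
have bd f : Phi f -> `|\int[P]_(w in A `&` B n) f w| <= e / 2.
  move=> Phif; have intf := ui_intg X_classD Phif.
  apply: (le_trans (le_normr_Rintegral mAB (intgS mAB intf))).
  apply: (le_trans (hc _ Phif _ mAB)).
  have : c * fine (P (A `&` B n)) <= c * fine (P (B n)).
    rewrite ler_wpM2l// fine_le ?fin_num_measure// le_measure ?inE//.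
  have := PN _ Nn; rewrite /=; lra.
have := bd _ (PhiX fth); have := bd _ (PhiX fn); rewrite at_time_cst.
rewrite !ler_norml => /andP[? ?] /andP[? ?]; lra.
Qed.

End stopped_reward.

(** * Stieltjes integrals and dual projections *)

Section optional_sigma_algebra.
Context {R : realType} {d : measure_display} {T : measurableType d}.
Variable H : R -> set (set T).
Hypothesis HF : is_filtration H.
Implicit Types (X : R -> T -> R) (s : T -> \bar R).

(** Optional sets live over nonnegative times. Leaving the negative part free gives a sigma-algebra
    on the whole product, so that optional processes inherit the closure properties of measurable
    functions. *)
Definition optional_algebra : set (set (T * R)) :=
  [set E | optional_sets H (E `&` [set p | 0 <= p.2])].

Local Notation OT := (g_sigma_algebraType optional_algebra).

Lemma optional_algebra_sigma : sigma_algebra setT optional_algebra.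
Proof.
split.
- by rewrite /optional_algebra /= set0I; exact: sigma_algebra0.
- move=> A /= HA; rewrite /optional_algebra /=.
  rewrite (_ : _ `&` _ = [set p | 0 <= p.2] `\` (A `&` [set p | 0 <= p.2])).
    exact: sigma_algebraCD.
  by apply/seteqP; split => p /=; [case=> -[_ ?] ?|case=> ? ?]; tauto.
- move=> A /= HA; rewrite /optional_algebra /= setI_bigcupl.
  exact: sigma_algebra_bigcup.
Qed.

Lemma optionalP X :
  optional H X <-> measurable_fun [set: OT] (fun p => X p.2 p.1).
Proof.
have sO := optional_algebra_sigma.
split=> oX.
  move=> _ B mB; rewrite setTI -sigma_measurableE// /optional_algebra /=.
  by rewrite setIC; exact: oX.
move=> B mB; have := oX measurableT B mB.
by rewrite setTI -sigma_measurableE// /optional_algebra /= setIC.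
Qed.

(* The process (t - s)^+ 1_A is continuous and adapted, so that the open
   interval ]]s, +oo[[ restricted to A is one of the generators. *)
Lemma optional_after s A : finite_stopping_time H s -> prior H s A ->
  measurable ([set p | A p.1 /\ (s p.1 < p.2%:E)%E] : set OT).
Proof.
move=> [ss fs] [mA HA]; rewrite -sigma_measurableE; last exact: optional_algebra_sigma.
rewrite /optional_algebra /=; apply: sub_sigma_algebra.
pose Z (t : R) w : R := if w \in A then Num.max 0 (t - fine (s w)) else 0.
have sfin w : s w \is a fin_num by rewrite ge0_fin_numE ?fs//; exact: ss.1.
exists Z, [set x | 0 < x]; split.
- move=> t t0; have [sH _] := HF.1 _ t0.
  suff : measurable_fun [set: g_sigma_algebraType (H t)] (Z t).
    by move=> mZ B mB; apply: (proj2 (wrtP _ sH) mZ).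
  apply: (measurability _ (RGenCInfty.measurableE R)) => // _ [_ [r ->] <-].
  rewrite setTI -sigma_measurableE//.
  have [r0|r0] := leP r 0.
    rewrite (_ : _ @^-1` _ = setT); first exact: sigmaT.
    apply/seteqP; split => w //= _; rewrite in_itv/= andbT /Z.
    by case: ifP => // _; rewrite le_max r0.
  have [tr|tr] := leP 0 (t - r); last first.
    rewrite (_ : _ @^-1` _ = set0); first exact: sigma0.
    apply/seteqP; split => w //=; rewrite in_itv/= andbT /Z.
    case: ifP => _; last by rewrite leNgt r0.
    rewrite le_max leNgt r0/= => h.
    have : 0 <= fine (s w) by rewrite fine_ge0//; exact: ss.1.
    by move: h tr; lra.
  rewrite (_ : _ @^-1` _ = A `&` [set w | (s w <= (t - r)%:E)%E]).
    by apply: HF.2 (HA _ tr) => //; rewrite lerBlDr lerDl ltW.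
  apply/seteqP; split => w /=; rewrite in_itv/= andbT /Z.
    case: ifPn => [/set_mem Aw|_]; last by rewrite leNgt r0.
    rewrite le_max leNgt r0/= => h; split => //.
    by rewrite -(fineK (sfin w)) lee_fin; lra.
  move=> [Aw]; rewrite mem_set// -(fineK (sfin w)) lee_fin => h.
  by rewrite le_max; apply/orP; right; rewrite fineK//; lra.
- move=> w; have cZ : continuous (Z ^~ w).
    have [wA|wA] := boolP (w \in A); last first.
      rewrite (_ : Z ^~ w = cst 0); first exact: cst_continuous.
      by apply/funext => t; rewrite /Z (negbTE wA).
    rewrite (_ : Z ^~ w = fun t => ((t - fine (s w)) + `|t - fine (s w)|) * 2^-1).
      move=> x; apply: cvgM; last exact: cvg_cst.
      have cB : t - fine (s w) @[t --> x] --> x - fine (s w).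
        by apply: cvgB; [exact: cvg_id|exact: cvg_cst].
      by apply: cvgD => //; exact: cvg_norm.
    by apply/funext => t; rewrite /Z wA maxr_absE add0r sub0r normrN.
  split=> [t _|t _]; first exact/cvg_at_right_filter/cZ.
  by apply/cvg_ex; exists (Z t w); apply/cvg_at_left_filter/cZ.
- by rewrite -[X in measurable X]setTI; have := measurable_itv (`]0%R, +oo[ : interval R);
    rewrite setTI; congr (measurable _); apply/seteqP; split => x /=; rewrite in_itv/= andbT.
apply/seteqP; split => -[w t] /=; rewrite /Z.
  move=> [[Aw st] t0]; rewrite mem_set//; split => //.
  rewrite lt_max ltxx/= subr_gt0.
  by rewrite -lte_fin fineK.
move=> [t0]; case: ifPn => [/set_mem Aw|_]; last by rewrite ltxx.
rewrite lt_max ltxx/= subr_gt0 => h; split => //; split => //.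
by rewrite -(fineK (sfin w)) lte_fin.
Qed.

(** Integrating against it produces the increment from [s] to [u] on [A], hence open at [s] and
    closed at [u]. *)
Definition interval_process (A : set T) s u : R -> T -> R :=
  fun t w => ((w \in A) && ((s w < t%:E)%E && (t%:E <= u w)%E))%:R.

Lemma interval_process_optional A s u : finite_stopping_time H s ->
  finite_stopping_time H u -> prior H s A -> optional H (interval_process A s u).
Proof.
move=> fs fu CA; apply/optionalP.
have PT : prior H u setT by exact: sigmaT (prior_sub_sigma HF fu.1).1.
have m1 := optional_after fs CA; have m2 := optional_after fu PT.
have := @measurable_indic _ _ R setT _ (measurableD m1 m2); apply: eq_measurable_fun => -[w t] _.
rewrite indicE /interval_process; congr (_%:R); congr nat_of_bool.
apply/idP/idP.
  rewrite inE /= => -[[Aw st]] ut; rewrite mem_set// st/= leNgt.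
  by apply/negP => ?; apply: ut; split.
move=> /andP[/set_mem Aw /andP[st tu]]; rewrite inE /=; split => // -[_].
by rewrite ltNge tu.
Qed.

Lemma interval_process_bound A s u t w : `|interval_process A s u t w| <= 1.
Proof. by rewrite /interval_process; case: (_ && _); rewrite ?normr1 ?normr0. Qed.

Lemma interval_process_ge0 A s u t w : 0 <= interval_process A s u t w.
Proof. by rewrite /interval_process; case: (_ && _). Qed.

End optional_sigma_algebra.

(** * Stieltjes measures depending measurably on a parameter *)

Section stieltjes_kernel.
Context {R : realType}.
Local Notation MR := (measurableTypeR R).

Lemma lebesgue_stieltjes_itv (f : cumulative R R) (a b : R) : a <= b ->
  lebesgue_stieltjes_measure f `]a, b] = (f b - f a)%:E.
Proof.
move=> ab; rewrite /lebesgue_stieltjes_measure /measure_extension measurable_mu_extE/=; last exact: is_ocitv.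
by rewrite wlength_itv_bnd.
Qed.

Lemma lebesgue_stieltjes_unit_jump (r : R) (A : set MR) : measurable A ->
  lebesgue_stieltjes_measure (unit_jump r%:E) A = \d_(r : MR) A.
Proof.
move=> mA; apply: (@lebesgue_stieltjes_measure_unique R _ (dirac (r : MR))) => // X.
case/ocitvP => [->|[[a b] /= ab ->]]; first by rewrite !measure0.
rewrite lebesgue_stieltjes_itv ?ltW// /dirac indicE /= /unit_jump !lee_fin.
congr EFin; have [ra|ra] := leP r a.
  rewrite (le_trans ra (ltW ab)) subrr memNset//= in_itv/= ltNge ra//.
rewrite subr0; congr (_%:R); congr nat_of_bool; apply/idP/idP.
  by move=> rb; rewrite inE /= in_itv/= ra.
by rewrite inE /= in_itv/= => /andP[].
Qed.

Lemma lebesgue_stieltjes_unit_jump_infty (A : set MR) : measurable A ->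
  lebesgue_stieltjes_measure (unit_jump +oo%E) A = 0%E.
Proof.
move=> mA; apply: (@lebesgue_stieltjes_measure_unique R _ (@mzero _ (measurableTypeR R) R)) => // X.
case/ocitvP => [->|[[a b] /= ab ->]]; first by rewrite !measure0.
by rewrite lebesgue_stieltjes_itv ?ltW//= /unit_jump /mzero /= subrr.
Qed.

Lemma integral_unit_jump (x : \bar R) (D : set MR) (f : MR -> \bar R) :
  (0 <= x)%E -> measurable D -> measurable_fun D f ->
  (\int[lebesgue_stieltjes_measure (unit_jump x)]_(y in D) f y)%E =
  if ((x < +oo)%E && (fine x \in D)) then f (fine x) else 0%E.
Proof.
move=> x0 mD mf; case: x x0 => [r _|_|//].
  rewrite ltry /= (eq_measure_integral (dirac (r : MR) : {measure set MR -> \bar R})); last first.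
    by move=> A mA _; exact: lebesgue_stieltjes_unit_jump.
  by rewrite integral_dirac// diracE; case: ifP => _; rewrite ?mul1e ?mul0e.
rewrite ltxx /= (eq_measure_integral (mzero : {measure set MR -> \bar R})); last first.
  by move=> A mA _; exact: lebesgue_stieltjes_unit_jump_infty.
exact: integral_measure_zero.
Qed.

(** Dynkin induction from half-open intervals; finiteness of each [k z] handles complements. *)
Lemma measurable_kernel_itv d (Z : measurableType d) (k : Z -> {measure set MR -> \bar R}) :
  (forall z, (k z setT < +oo)%E) -> measurable_fun setT (fun z => k z setT) ->
  (forall a b, a < b -> measurable_fun setT (fun z => k z `]a, b]%classic)) ->
  forall U, measurable U -> measurable_fun setT (k ^~ U).
Proof.
move=> kfin kT kab U mU.
have kfinU z A : measurable A -> k z A \is a fin_num.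
  move=> mA; rewrite ge0_fin_numE// (le_lt_trans _ (kfin z))//.
  by rewrite le_measure// inE.
have GE : @measurable _ MR = <<s @ocitv R >> by [].
apply: (@dynkin_induction _ MR (@ocitv R) (fun U => measurable_fun setT (k ^~ U)) GE) => //.
- exact: ocitvI.
- move=> X /ocitvP[->|[[a b] /= ab ->]]; last exact: kab.
  rewrite (_ : (fun z => k z set0) = cst 0%E); first exact: measurable_cst.
  by apply/funext => z; rewrite measure0.
- move=> S mS mkS; rewrite (_ : (fun z => k z (~` S)) = (fun z => k z setT - k z S)%E).
    exact: emeasurable_funB.
  by apply/funext => z; rewrite -setTD measureD// ?setTI// -ge0_fin_numE// kfinU.
- move=> A mA tA mkA.
  rewrite (_ : (fun z => k z _) = (fun z => \sum_(0 <= n <oo) k z (A n))%E).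
    exact: ge0_emeasurable_sum.
  by apply/funext => z; rewrite measure_bigcup//; apply: eq_eseriesl => n; exact: in_setT.
Qed.

Import HBNNSimple.

(** The measures restricted to []0, s z]] form a kernel whose mass on half-open intervals involves
    [lam] only at times capped by [s z]. This is why the result can be used with the sigma-field of
    a stopping time. *)
Lemma measurable_stieltjes_integral d (Z : measurableType d) (lam : Z -> cumulative R R)
    (s : Z -> R) (f : Z * MR -> \bar R) :
  measurable_fun setT s -> (forall z, 0 <= s z) ->
  (forall x, 0 <= x -> measurable_fun setT (fun z => lam z (Num.min x (s z)))) ->
  measurable_fun setT f -> (forall p, 0 <= f p)%E ->
  measurable_fun setT
    (fun z => \int[lebesgue_stieltjes_measure (lam z)]_(y in `]0%R, s z]) f (z, y))%E.
Proof.
move=> ms s0 mlam mf f0.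
pose D z := `]0%R, s z]%classic.
have mD z : measurable (D z) by exact: measurable_itv.
pose k z : {measure set MR -> \bar R} := mrestr (lebesgue_stieltjes_measure (lam z)) (mD z).
have kE z (a b : R) : a < b -> k z (`]a, b]%classic : set MR) = (lam z (Num.min (Num.max b (Num.max a 0)) (s z)) -
    lam z (Num.min (Num.max a 0) (s z)))%:E.
  move=> ab; rewrite /k /= /mrestr /D.
  (* The clamped ends describe the intersection with []0, s z]]; the maximum with [a'] keeps the
     right end from dropping below the left one when [b] is negative. *)
  pose a' := Num.max a 0; pose b' := Num.max b a'.
  rewrite (_ : _ `&` _ = `]Num.min a' (s z), Num.min b' (s z)]%classic).
    have ab' : Num.min a' (s z) <= Num.min b' (s z).
      by rewrite le_min !ge_min lexx !orbT andbT /b' le_max lexx !orbT.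
    by rewrite lebesgue_stieltjes_itv.
  apply/seteqP; split => x /=; rewrite !in_itv/= /b' /a'.
    move=> [/andP[ax xb] /andP[x0 xs]]; rewrite gt_min gt_max ax x0/=.
      by rewrite le_min xs le_max xb.
    move=> /andP[]; rewrite le_min gt_min gt_max => h /andP[+ xs].
    move: h; rewrite [s z < x]ltNge xs orbF => /andP[ax x0].
    rewrite !le_max => /orP[xb|/orP[xa|x0']]; first by rewrite ax xb x0; split; rewrite ?xs.
      by move: ax; rewrite ltNge xa.
    by move: x0; rewrite ltNge x0'.
have a'0 (a : R) : 0 <= Num.max a 0 by rewrite le_max lexx orbT.
have kTE z : k z setT = (lam z (s z) - lam z (Num.min 0 (s z)))%:E.
  rewrite /k /= /mrestr setTI lebesgue_stieltjes_itv//.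
  by rewrite (min_idPl (s0 z)).
have mlams : measurable_fun setT (fun z => lam z (s z)).
  apply: (@measurable_fun_cvg _ _ _ _ (fun n z => lam z (Num.min n%:R (s z)))).
    by move=> n; exact: mlam.
  move=> z _; apply: cvg_near_cst; near=> n; congr (lam z _); apply/min_idPr.
  by near: n; exact: nbhs_infty_ger.
have mk U : measurable U -> measurable_fun setT (k ^~ U).
  apply: measurable_kernel_itv => [z||a b ab].
  - by rewrite kTE ltry.
  - under eq_fun do rewrite kTE.
    by apply/measurable_EFinP; apply: measurable_funB => //; exact: mlam.
  - under eq_fun do rewrite (kE _ _ _ ab).
    by apply/measurable_EFinP; apply: measurable_funB; apply: mlam => //; rewrite le_max a'0 orbT.
pose g (p : Z * MR) : \bar R := if (0 < p.2) && (p.2 <= s p.1) then f p else 0%E.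
have mg : measurable_fun setT g.
  apply: measurable_fun_ifT => //.
  have m2 : measurable_fun [set: Z * MR] (fun p => p.2 : R) by exact: measurable_snd.
  have m1 : measurable_fun [set: Z * MR] (fun p => s p.1).
    exact: measurableT_comp ms (measurable_fst).
  apply: measurable_and; last exact: measurable_fun_ler m2 m1.
  have m0 : measurable_fun [set: Z * MR] (fun=> 0 : R) by exact: measurable_cst.
  exact: measurable_fun_ltr m0 m2.
have g0 p : (0 <= g p)%E by rewrite /g; case: ifP.
rewrite (_ : (fun z => _) = (fun z => \int[k z]_y g (z, y))%E); last first.
  apply/funext => z.
  rewrite (eq_measure_integral (k z)); last first.
    by move=> A mA AD; rewrite /k /= /mrestr setIidl.
  rewrite integral_mkcond; apply: eq_integral => y _.
  rewrite patchE /g /=; case: ifPn => [|/negP]; rewrite inE /= in_itv/=.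
    by move=> ->.
  by move=> /negP/negbTE ->.
pose kk := HB.pack_for (R.-ker Z ~> MR) k (isKernel.Build _ _ Z MR R k mk).
pose g_ := nnsfun_approx measurableT mg.
apply: (measurable_fun_xsection_integral g k g_).
- by move=> a b ab; exact/nd_nnsfun_approx.
- by move=> z; apply: cvg_nnsfun_approx.
move=> n r.
have mA : measurable (g_ n @^-1` [set r]) by [].
(* The bound may depend on [z]; the added 1 makes it strict. *)
have kbd z : exists M : R, forall X : set MR, measurable X ->
    (mrestr (kk z) measurableT X < M%:E)%E.
  exists (lam z (s z) - lam z (Num.min 0 (s z)) + 1) => X mX; rewrite /mrestr /= setIT.
  apply: (@le_lt_trans _ _ (k z setT)); first by rewrite le_measure// inE.
  by rewrite kTE lte_fin [ltRHS]addrC ltrDr.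
have [_] := measurable_prod_subset_xsection_kernel kbd mA.
by apply: eq_measurable_fun => z _; rewrite /mrestr setIT.
Unshelve. all: by end_near. Qed.

End stieltjes_kernel.

(** * The dual optional projection on stochastic intervals *)

Section dual_projection.
Context {R : realType} {d : measure_display} {T : measurableType d}.
Local Notation MR := (measurableTypeR R).
Variable P : probability T R.
Variables (F : R -> set (set T)) (tau : T -> \bar R) (DoF : T -> cumulative R R).
Hypothesis F_usual : usual_filtration P F.
Hypothesis tau_random : random_time tau.
Hypothesis DoF_dual : is_dual_optional_projection P F (default_process tau) DoF.
Implicit Types (f X : R -> T -> R) (s u : T -> \bar R).

Let HF : is_filtration F := usual_is_filtration F_usual.

Let nu w := lebesgue_stieltjes_measure (DoF w).

Lemma optional_section_nonneg f w : optional F f ->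
  measurable_fun (`[0, +oo[%classic : set MR) (fun t => (f t w)%:E).
Proof.
move=> of_; apply/measurable_EFinP.
have mf : measurable_fun (`[0, +oo[%classic : set MR) (fun t => f (Num.max 0 t) w).
  by apply: measurable_funTS; exact: (optional_section HF w of_).
apply: eq_measurable_fun mf => t; rewrite inE /= in_itv/= andbT => t0.
by rewrite (max_idPr t0).
Qed.

Lemma inner_default f w : measurable_fun (`[0, +oo[%classic : set MR) (fun t => (f t w)%:E) ->
  (\int[lebesgue_stieltjes_measure (default_process tau w)]_(t in `[0%R, +oo[) (f t w)%:E =
   (at_time f tau w)%:E)%E.
Proof.
move=> mf; have [_ tau0] := tau_random.
have mD : measurable (`[0, +oo[%classic : set MR) by exact: measurable_itv.
rewrite /default_process (integral_unit_jump (tau0 w) mD mf).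
rewrite /at_time; case: ifPn => [/andP[->]//|]; rewrite negb_and.
move=> /orP[/negbTE ->//|]; case: ifP => // tw.
by rewrite notin_setE /= in_itv/= andbT fine_ge0// => /(_ isT).
Qed.

Lemma at_random_time_measurable f : optional F f -> measurable_fun setT (at_time f tau).
Proof.
move=> of_; have [mtau tau0] := tau_random.
have mfin : measurable [set w | (tau w < +oo)%E].
  by rewrite -[X in measurable X]setTI; exact: emeasurable_fun_infty_o.
have mft : measurable_fun setT (fun w => f (Num.max 0 (fine (tau w))) w).
  apply: (measurableT_comp (optional_measurable HF of_) (g := fun w => (w, fine (tau w)))).
  apply: measurable_fun_pair; first exact: measurable_id.
  exact: measurableT_comp (fine_measurable measurableT) mtau.
apply: (eq_measurable_fun (fun w => if w \in [set w | (tau w < +oo)%E]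
    then f (Num.max 0 (fine (tau w))) w else 0)).
  move=> w _; rewrite /at_time; case: ifPn => [/set_mem /= ->|/negP].
    by rewrite (max_idPr _)// fine_ge0.
  by rewrite inE /= => /negP/negbTE ->.
apply: measurable_fun_ifT => //.
apply: (measurable_fun_bool true); rewrite setTI.
by rewrite (_ : _ @^-1` _ = [set w | (tau w < +oo)%E])//; apply/seteqP; split => w /=; [move/set_mem|move=> tw; rewrite mem_set].
Qed.

Section on_stochastic_interval.
Variable u : T -> \bar R.
Hypothesis fu : finite_stopping_time F u.

Let TC := g_sigma_algebraType (prior F u).

Let sC := prior_sub_sigma HF fu.1.

(** Freezing [f] at [u] does not alter it on the interval of integration, and [DoF] is seen only up
    to [u]; the integral is therefore known at [u]. *)
Lemma inner_dual_wrt f : optional F f -> (forall t w, 0 <= f t w) ->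
  measurable_fun [set: TC]
    (fun w => \int[nu w]_(t in `]0%R, fine (u w)]) (f t w)%:E)%E.
Proof.
move=> of_ f0; have [u0 uoo] := fu; have [oD D0 _] := DoF_dual.
have u0' w : 0 <= fine (u w) by rewrite fine_ge0//; exact: u0.1.
have ufin w : u w \is a fin_num by rewrite ge0_fin_numE ?uoo//; exact: u0.1.
pose g (p : TC * MR) : \bar R := (f (Num.min (Num.max 0 p.2) (fine (u p.1))) p.1)%:E.
rewrite (_ : (fun w => _) = (fun w : TC => \int[nu w]_(t in `]0%R, fine (u w)]) g (w, t))%E); last first.
  apply/funext => w; apply: eq_integral => t; rewrite inE /= in_itv/= => /andP[t0 tu].
  by rewrite /g /= (max_idPr (ltW t0)) (min_idPl tu).
apply: (measurable_stieltjes_integral (Z := TC) (s := fun w => fine (u w))).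
- apply/(wrtP _ sC.1) => B mB.
  have := @optional_at_time _ _ _ _ HF (fun t _ => t) u _ fu B mB.
  rewrite (_ : at_time _ u = fun w => fine (u w)); last first.
    by apply/funext => w; rewrite /at_time uoo.
  apply=> B' mB'; apply: sub_sigma_algebra; exists (fun t _ => t), B'; split => //.
    move=> t t0 B2 _; have [sF _] := HF.1 _ t0.
    have [tB|tB] := pselect (B2 t).
      by rewrite (_ : _ @^-1` _ = setT); [exact: sigmaT|apply/seteqP; split].
    by rewrite (_ : _ @^-1` _ = set0); [exact: sigma0|apply/seteqP; split].
  move=> w; split=> [t _|t _]; first exact/cvg_at_right_filter/cvg_id.
  by apply/cvg_ex; exists t; apply/cvg_at_left_filter/cvg_id.
- exact: u0'.
- move=> x x0; apply/(wrtP _ sC.1) => B mB.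
  have := optional_at_time HF oD (stopping_min_cst HF x0 u0) mB.
  rewrite at_time_min_cst.
  rewrite (_ : stopped _ _ _ = fun w => DoF w (Num.min x (fine (u w)))); last first.
    by apply/funext => w; rewrite /stopped minC -[in Order.min _ (u w)](fineK (ufin w)) -EFin_min.
  apply: (sub_prior HF) => //.
  by move=> w; rewrite ge_min lexx.
- by apply/measurable_EFinP; exact: (optional_joint HF of_ fu).
- by move=> p; rewrite lee_fin.
Qed.

Lemma inner_dual_measurable f : optional F f -> (forall t w, 0 <= f t w) ->
  measurable_fun [set: T]
    (fun w => \int[nu w]_(t in `]0%R, fine (u w)]) (f t w)%:E)%E.
Proof.
move=> of_ f0; have := inner_dual_wrt of_ f0.
pose j : T -> TC := idfun.
suff mj : measurable_fun setT j by move=> m; exact: measurableT_comp m mj.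
by move=> _ B mB; rewrite setTI; apply: sC.2; rewrite sigma_measurableE//; exact: sC.1.
Qed.

Definition supported f := forall t w, ~~ ((0 < t) && (t <= fine (u w))) -> f t w = 0.

Lemma inner_supported f w : supported f ->
  (\int[nu w]_(t in `[0%R, +oo[) (f t w)%:E = \int[nu w]_(t in `]0%R, fine (u w)]) (f t w)%:E)%E.
Proof.
move=> sf; rewrite integral_mkcond [RHS]integral_mkcond; apply: eq_integral => t _.
rewrite !patchE !mem_setE !in_itv/= andbT.
have [t0|t0] := leP 0 t; last by rewrite ltNge (ltW t0).
by case: ifPn => // tu; rewrite sf.
Qed.

(** The defining identity covers bounded integrands; truncation at height [n] and monotone
    convergence on both sides extend it. The support in []0, u]] reduces the inner integral to one
    that is measurable in the sample point. *)
Lemma dual_ge0 f : optional F f -> (forall t w, 0 <= f t w) -> supported f ->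
  expected_integral P DoF f = (\int[P]_w (at_time f tau w)%:E)%E.
Proof.
move=> of_ f0 sf.
pose fn (n : nat) t w := Num.min (f t w) n%:R.
have ofn n : optional F (fn n).
  apply/optionalP; apply: measurable_minr; first exact: (proj1 (optionalP _ _)).
  exact: measurable_cst.
have fn0 n t w : 0 <= fn n t w by rewrite le_min f0/=.
have sfn n : supported (fn n) by move=> t w tu; rewrite /fn sf// (min_idPl _).
have fn_nd t w : {homo (fun n => fn n t w) : m n / (m <= n)%N >-> m <= n}.
  by move=> m n mn; rewrite /fn le_min ge_min lexx/= ge_min ler_nat mn orbT.
have fn_cvg t w : (fn n t w)%:E @[n --> \oo] --> (f t w)%:E.
  apply: cvg_near_cst; near=> n; congr EFin; apply/min_idPl.
  by near: n; exact: nbhs_infty_ger.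
have [_ _ dual] := DoF_dual.
have En n : expected_integral P DoF (fn n) = (\int[P]_w (at_time (fn n) tau w)%:E)%E.
  rewrite dual; last first.
    split; first exact: ofn.
    by exists n%:R => t w _; rewrite ger0_norm// ge_min lexx orbT.
  by apply: eq_integral => w _; apply: inner_default; exact: optional_section_nonneg.
have inner0 g w : (forall t w, 0 <= g t w) -> (0 <= \int[nu w]_(t in `]0%R, fine (u w)]) (g t w)%:E)%E.
  by move=> g0; apply: integral_ge0 => t _; rewrite lee_fin.
have mitv w : measurable (`]0, fine (u w)]%classic : set MR) by exact: measurable_itv.
have msec g w : optional F g -> measurable_fun (`]0, fine (u w)]%classic : set MR) (fun t => (g t w)%:E).
  move=> og; apply: measurable_funS (optional_section_nonneg w og) => //.
  by move=> t /=; rewrite !in_itv/= => /andP[/ltW ->].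
have EE g : supported g -> expected_integral P DoF g =
    (\int[P]_w \int[nu w]_(t in `]0%R, fine (u w)]) (g t w)%:E)%E.
  by move=> sg; apply: eq_integral => w _; exact: inner_supported.
have c1 : expected_integral P DoF (fn n) @[n --> \oo] --> expected_integral P DoF f.
  rewrite EE//; under eq_fun do rewrite EE//.
  rewrite (_ : (\int[P]_w _)%E = (\int[P]_w
      limn (fun n => \int[nu w]_(t in `]0%R, fine (u w)]) (fn n t w)%:E))%E); last first.
    apply: eq_integral => w _; apply/esym/cvg_lim => //.
    rewrite (_ : (\int[nu w]_(t in _) _)%E =
        (\int[nu w]_(t in `]0%R, fine (u w)]) limn (fun n => (fn n t w)%:E))%E); last first.
      by apply: eq_integral => t _; apply/esym/cvg_lim => //; exact: fn_cvg.
    apply: cvg_monotone_convergence => //.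
    - by move=> n; exact: msec.
    - by move=> n t _; rewrite lee_fin.
    - by move=> t _ m n mn; rewrite lee_fin fn_nd.
  apply: cvg_monotone_convergence => //.
  - by move=> n; exact: inner_dual_measurable.
  - by move=> n w _; exact: inner0.
  - move=> w _ m n mn; apply: ge0_le_integral => //.
    + by move=> t _; rewrite lee_fin.
    + exact: msec.
    + exact: msec.
    + by move=> t _; rewrite lee_fin fn_nd.
have c2 : (\int[P]_w (at_time (fn n) tau w)%:E)%E @[n --> \oo] --> (\int[P]_w (at_time f tau w)%:E)%E.
  rewrite (_ : (\int[P]_w (at_time f tau w)%:E)%E =
      (\int[P]_w limn (fun n => (at_time (fn n) tau w)%:E))%E); last first.
    apply: eq_integral => w _; apply/esym/cvg_lim => //; rewrite /at_time.
    by case: ifP => _; [exact: fn_cvg|exact: cvg_cst].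
  apply: cvg_monotone_convergence => //.
  - by move=> n; apply/measurable_EFinP; exact: at_random_time_measurable.
  - by move=> n w _; rewrite lee_fin /at_time; case: ifP.
  - by move=> w _ m n mn; rewrite lee_fin /at_time; case: ifP => // _; exact: fn_nd.
have : (\int[P]_w (at_time (fn n) tau w)%:E)%E @[n --> \oo] --> expected_integral P DoF f.
  by under eq_fun do rewrite -En.
by move=> /cvg_lim <-//; apply/cvg_lim.
Unshelve. all: by end_near. Qed.

End on_stochastic_interval.
End dual_projection.

(** * The reduced reward *)

Section reduced_reward.
Context {R : realType} {d : measure_display} {T : measurableType d}.
Local Notation MR := (measurableTypeR R).
Variable P : probability T R.
Local Notation intg f := (P.-integrable setT (EFin \o f)).
Variables (F : R -> set (set T)) (tau : T -> \bar R) (DoF : T -> cumulative R R).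
Variables (G XG XF kpr kop : R -> T -> R).
Hypothesis P_complete : measure_is_complete P.
Hypothesis F_usual : usual_filtration P F.
Hypothesis tau_random : random_time tau.
Hypothesis tau_fin : \forall w \ae P, (tau w < +oo)%E.
Hypothesis G_optional : optional F G.
Hypothesis G_gt0 : \forall w \ae P, forall t, 0 <= t -> 0 < G t w.
Hypothesis DoF_dual : is_dual_optional_projection P F (default_process tau) DoF.
Hypothesis XG_classD : classD P (enlarged F tau) XG.
Hypothesis XF_kpr : associated_pair P F tau G XG XF kpr.
Hypothesis kop_kpr : is_mu_condexp P F (default_process tau) kpr kop.

Let HF : is_filtration F := usual_is_filtration F_usual.
Let nu w := lebesgue_stieltjes_measure (DoF w).
Let kop_optional : optional F kop. Proof. by case: kop_kpr. Qed.

Lemma enlarged_negligible A : P.-negligible A -> enlarged F tau 0 A.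
Proof.
move=> nA; apply: (sub_enlarged F_usual) => //.
by have [_ _ + _] := F_usual; exact.
Qed.

Let Xtilde := reduced_reward G XF kop DoF.

Lemma kop_at_tau_intg : intg (at_time (fun t w => `|kop t w|) tau).
Proof.
have okabs : optional F (fun t w => `|kop t w|).
  by apply/optionalP; apply: measurableT_comp => //; exact: (proj1 (optionalP _ _)).
have [_ fink _] := kop_kpr.
apply/integrableP; split; first by apply/measurable_EFinP; exact: (at_random_time_measurable F_usual).
apply: le_lt_trans fink; rewrite le_eqVlt; apply/orP; left; apply/eqP.
apply: eq_integral => w _; rewrite (inner_default tau_random (optional_section_nonneg F_usual w okabs)).
by rewrite /= /at_time; case: (tau w < +oo)%E; rewrite ?normr_id ?normr0.
Qed.

Let kop_section w : measurable_fun (`[0, +oo[%classic : set MR) (fun t => (kop t w)%:E).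
Proof. exact: (optional_section_nonneg F_usual). Qed.

Let kop_section_itv w (a b : R) : 0 <= a ->
  measurable_fun (`]a, b]%classic : set MR) (fun t => (kop t w)%:E).
Proof.
move=> a0; have mD : measurable (`[0, +oo[%classic : set MR) by exact: measurable_itv.
apply: measurable_funS (kop_section w) => //.
by move=> t /=; rewrite !in_itv/= andbT => /andP[/ltW + _]; exact: le_trans.
Qed.

Section finite_horizon.
Variable u : T -> \bar R.
Hypothesis fu : finite_stopping_time F u.

Let u0 w : 0 <= fine (u w). Proof. by rewrite fine_ge0//; exact: fu.1.1. Qed.

Let ufin w : u w \is a fin_num.
Proof. by rewrite ge0_fin_numE ?fu.2//; exact: fu.1.1. Qed.

Definition stieltjes_at w := stieltjes_integral kop DoF (fine (u w)) w.

Let mD w : measurable (`]0, fine (u w)]%classic : set MR).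
Proof. exact: measurable_itv. Qed.

Let N w : \bar R := (\int[nu w]_(t in `]0%R, fine (u w)]) `|kop t w|%:E)%E.

Let kabs_optional : optional F (fun t w => `|kop t w|).
Proof. by apply/optionalP; apply: measurableT_comp => //; exact: (proj1 (optionalP _ _)). Qed.

Let N_measurable : measurable_fun setT N.
Proof. exact: (inner_dual_measurable F_usual DoF_dual fu). Qed.

(** By duality this is the mean of [|kop|] at [tau] on [0 < tau <= u], which is finite because [kop]
    is integrable for [mu]. It makes the Stieltjes integral of [kop] absolutely convergent almost
    surely. *)
Lemma finite_variation_integral : (\int[P]_w N w < +oo)%E.
Proof.
pose I := interval_process setT (fun=> 0%E) u.
have f00 : finite_stopping_time F (fun=> 0%:E) by exact: finite_stopping_cst.
have oI : optional F I.
  by apply: interval_process_optional => //; exact: sigmaT (prior_sub_sigma HF f00.1).1.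
have I0 t w : 0 <= I t w by exact: interval_process_ge0.
pose f t w := `|kop t w| * I t w.
have of_ : optional F f.
  apply/optionalP; apply: measurable_funM; first exact: (proj1 (optionalP _ _) kabs_optional).
  exact: (proj1 (optionalP _ _) oI).
have sf : supported u f.
  move=> t w; rewrite /f /I /interval_process -lee_fin fineK// -lte_fin.
  by case: (_ && _) => //= _; rewrite andbF mulr0.
have := dual_ge0 F_usual tau_random DoF_dual fu of_ (fun t w => mulr_ge0 (normr_ge0 _) (I0 t w)) sf.
rewrite (_ : expected_integral P DoF f = \int[P]_w N w)%E; last first.
  apply: eq_integral => w _; rewrite (inner_supported _ _ sf); apply: eq_integral => t.
  rewrite inE /= in_itv/= => /andP[t0 tu]; rewrite /f /I /interval_process.
  by rewrite in_setT lte_fin t0 -(fineK (ufin w)) lee_fin tu mulr1.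
move=> ->; have /integrableP[_] := kop_at_tau_intg; apply: le_lt_trans.
apply: ge0_le_integral => //.
- by move=> w _; rewrite lee_fin /at_time; case: ifP => // _; rewrite mulr_ge0.
- by apply/measurable_EFinP; exact: (at_random_time_measurable F_usual tau_random).
- apply: measurableT_comp => //; apply/measurable_EFinP.
  exact: (at_random_time_measurable F_usual tau_random).
- move=> w _; rewrite /= lee_fin /at_time; case: ifP => _; last by rewrite normr0.
  rewrite normr_id -[leRHS]mulr1 /f ler_wpM2l//.
  by have := interval_process_bound setT (fun=> 0%E) u (fine (tau w)) w; rewrite ger0_norm.
Qed.

Lemma finite_variation_ae : \forall w \ae P, (N w < +oo)%E.
Proof.
have iN : P.-integrable setT N.
  apply/integrableP; split => //.
  rewrite (eq_integral N); first exact: finite_variation_integral.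
  by move=> w _; rewrite gee0_abs// integral_ge0// => t _; rewrite lee_fin.
have := integrable_ae measurableT iN; apply: filterS => w /(_ Logic.I).
by rewrite ge0_fin_numE// integral_ge0// => t _; rewrite lee_fin.
Qed.

Let kpos_optional : optional F (fun t w => Num.max (kop t w) 0).
Proof.
by apply/optionalP; apply: measurable_maxr => //; exact: (proj1 (optionalP _ _)).
Qed.

Let kneg_optional : optional F (fun t w => Num.max (- kop t w) 0).
Proof.
apply/optionalP; apply: measurable_maxr => //; apply: measurable_funN.
exact: (proj1 (optionalP _ _)).
Qed.

Lemma stieltjes_at_wrt : wrt (prior F u) stieltjes_at.
Proof.
have sC := (prior_sub_sigma HF fu.1).1; apply/(wrtP _ sC).
have mp := inner_dual_wrt F_usual DoF_dual fu kpos_optional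
  (fun t w => (_ : 0 <= Num.max (kop t w) 0)).
have mn := inner_dual_wrt F_usual DoF_dual fu kneg_optional
  (fun t w => (_ : 0 <= Num.max (- kop t w) 0)).
(* This identity holds at every point, even where both parts are infinite, since [Rintegral] is
   [fine] of this very difference. *)
rewrite (_ : stieltjes_at = (fun w => fine
   ((\int[nu w]_(t in `]0%R, fine (u w)]) (Num.max (kop t w) 0)%:E) -
    (\int[nu w]_(t in `]0%R, fine (u w)]) (Num.max (- kop t w) 0)%:E))%E)); last first.
  apply/funext => w; rewrite /stieltjes_at /stieltjes_integral /Rintegral integralE.
  congr (fine (_ - _)%E); apply: eq_integral => t _.
    by rewrite funeposE EFin_max.
  by rewrite funenegE EFin_max.
apply: (measurableT_comp (fine_measurable measurableT)).
apply: emeasurable_funB; [apply: mp|apply: mn] => t w; by rewrite le_max lexx orbT.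
Qed.

Lemma stieltjes_at_intg : intg stieltjes_at.
Proof.
have sC := prior_sub_sigma HF fu.1.
have mS : measurable_fun setT stieltjes_at by exact: wrt_measurable sC stieltjes_at_wrt.
apply/integrableP; split; first exact/measurable_EFinP.
apply: le_lt_trans finite_variation_integral; apply: ge0_le_integral => //.
- by apply: measurableT_comp => //; exact/measurable_EFinP.
- move=> w _; have := le_abse_integral (nu w) (mD w) (kop_section_itv w (lexx _)).
  rewrite /stieltjes_at /stieltjes_integral /Rintegral => /(le_trans _); apply.
  rewrite -/(nu w) /=; move: (\int[nu w]_(x in _) _)%E => [r| |] /=; rewrite ?normr0 ?leey//.
Qed.

Lemma inner_le_variation f w : optional F f -> (forall t w, 0 <= f t w) ->
  (forall t w, f t w <= `|kop t w|) ->
  (\int[nu w]_(t in `]0%R, fine (u w)]) (f t w)%:E <= N w)%E.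
Proof.
move=> of_ f0 fk; apply: ge0_le_integral => //.
- by move=> t _; rewrite lee_fin.
- have mD' : measurable (`[0, +oo[%classic : set MR) by exact: measurable_itv.
  apply: measurable_funS (optional_section_nonneg F_usual w of_) => //.
  by move=> t /=; rewrite !in_itv/= andbT => /andP[/ltW + _].
- have mD' : measurable (`[0, +oo[%classic : set MR) by exact: measurable_itv.
  apply: measurable_funS (optional_section_nonneg F_usual w kabs_optional) => //.
  by move=> t /=; rewrite !in_itv/= andbT => /andP[/ltW + _].
- by move=> t _; rewrite lee_fin.
Qed.

Lemma inner_Rintegral f : optional F f -> (forall t w, 0 <= f t w) ->
  (forall t w, f t w <= `|kop t w|) -> supported u f ->
  intg (fun w => \int[nu w]_(t in `]0, fine (u w)]) f t w) /\
  \int[P]_w (\int[nu w]_(t in `]0, fine (u w)]) f t w) = \int[P]_w at_time f tau w.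
Proof.
move=> of_ f0 fk sf.
pose a w : \bar R := (\int[nu w]_(t in `]0%R, fine (u w)]) (f t w)%:E)%E.
have ma : measurable_fun setT a by exact: (inner_dual_measurable F_usual DoF_dual fu).
have a0 w : (0 <= a w)%E by apply: integral_ge0 => t _; rewrite lee_fin.
have aN w : (a w <= N w)%E by exact: inner_le_variation.
have mfa : measurable_fun setT (fine \o a) by exact: measurableT_comp (fine_measurable measurableT) ma.
have fa : \forall w \ae P, (fine (a w))%:E = a w.
  apply: filterS finite_variation_ae => w Nw; rewrite fineK//.
  by rewrite ge0_fin_numE// (le_lt_trans (aN w)).
have Ea : (\int[P]_w (fine (a w))%:E = \int[P]_w a w)%E.
  apply: ae_eq_integral => //; first exact/measurable_EFinP.
  by apply: filterS fa => w fa _.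
split.
  apply/integrableP; split; first exact/measurable_EFinP.
  apply: le_lt_trans finite_variation_integral; apply: ge0_le_integral => //.
  - by apply: measurableT_comp => //; exact/measurable_EFinP.
  - move=> w _; apply: le_trans (aN w); rewrite /= /Rintegral -/(a w).
    by rewrite ger0_norm ?fine_ge0//; case: (a w) (a0 w) => [r| |] //= _; rewrite leey.
rewrite {1}/Rintegral /Rintegral; congr fine.
transitivity (expected_integral P DoF f).
  rewrite [LHS]Ea; apply: eq_integral => w _.
  by rewrite (inner_supported _ _ sf).
exact: (dual_ge0 F_usual tau_random DoF_dual fu).
Qed.

End finite_horizon.

(** Multiplying by [G] undoes the division in [XF]: the first part of the reduced reward is the
    optional projection of the reward before [tau]. *)
Lemma reduced_reward_ae : exists2 Y,
  is_optional_projection P F (fun t w => XG t w * survival tau t w) Y &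
  forall s, finite_stopping_time F s ->
    \forall w \ae P, at_time Xtilde s w = at_time Y s w + stieltjes_at s w.
Proof.
have [_ _ _ [Y pY XFY]] := XF_kpr; exists Y => // s fs.
apply: filterS2 XFY G_gt0 => w XFw Gw; rewrite /at_time fs.2 /Xtilde /reduced_reward.
have s0 : 0 <= fine (s w) by rewrite fine_ge0//; exact: fs.1.1.
by rewrite XFw// mulfVK// gt_eqF// Gw.
Qed.

Lemma reduced_reward_wrt s : finite_stopping_time F s ->
  wrt (prior F s) (at_time Xtilde s).
Proof.
move=> fs; have [oXF _ _ _] := XF_kpr; have sC := (prior_sub_sigma HF fs.1).1.
have mXF := optional_at_time HF oXF fs; have mG := optional_at_time HF G_optional fs.
have mS := stieltjes_at_wrt fs.
rewrite (_ : at_time _ _ = fun w => at_time XF s w * at_time G s w + stieltjes_at s w).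
  move: mXF mG mS => /(wrtP _ sC) mXF /(wrtP _ sC) mG /(wrtP _ sC) mS.
  by apply/(wrtP _ sC); apply: measurable_funD => //; exact: measurable_funM.
by apply/funext => w; rewrite /at_time fs.2.
Qed.

Lemma reduced_reward_intg s : finite_stopping_time F s -> intg (at_time Xtilde s).
Proof.
move=> fs; have sC := prior_sub_sigma HF fs.1.
have [Y [_ pY] XY] := reduced_reward_ae.
have [_ iY _ _] := pY _ fs.1.
apply: (intg_ae (f := at_time Y s \+ stieltjes_at s)).
- by apply: filterS (XY _ fs) => w ->.
- by exact: wrt_measurable sC (reduced_reward_wrt fs).
- by apply: intgD => //; exact: stieltjes_at_intg.
Qed.

Section increment.
Variables (A : set T) (s u : T -> \bar R).
Hypothesis fs : finite_stopping_time F s.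
Hypothesis fu : finite_stopping_time F u.
Hypothesis su : forall w, (s w <= u w)%E.
Hypothesis CA : prior F s A.

Let mA : measurable A.
Proof. by have [_] := prior_sub_sigma HF fs.1; apply. Qed.

Let s0 w : 0 <= fine (s w). Proof. by rewrite fine_ge0//; exact: fs.1.1. Qed.
Let sfin w : s w \is a fin_num.
Proof. by rewrite ge0_fin_numE ?fs.2//; exact: fs.1.1. Qed.
Let ufin w : u w \is a fin_num.
Proof. by rewrite ge0_fin_numE ?fu.2//; exact: fu.1.1. Qed.
Let u0 w : 0 <= fine (u w). Proof. by rewrite fine_ge0//; exact: fu.1.1. Qed.
Let sule w : fine (s w) <= fine (u w). Proof. by rewrite fine_le. Qed.

Let I := interval_process A s u.
Let oI : optional F I. Proof. exact: interval_process_optional. Qed.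
Let g t w := kop t w * I t w.
Let og : optional F g.
Proof.
apply/optionalP; apply: measurable_funM; first exact: (proj1 (optionalP _ _) kop_optional).
exact: (proj1 (optionalP _ _) oI).
Qed.

Let IE t w : I t w = ((w \in A) && ((fine (s w) < t) && (t <= fine (u w))))%:R.
Proof.
rewrite /I /interval_process -[in (s w < _)%E](fineK (sfin w)) lte_fin.
by rewrite -[in (_ <= u w)%E](fineK (ufin w)) lee_fin.
Qed.

Let gabs t w : `|g t w| <= `|kop t w|.
Proof.
by rewrite /g normrM ler_piMr//; exact: interval_process_bound.
Qed.

Let sg t w : ~~ ((0 < t) && (t <= fine (u w))) -> g t w = 0.
Proof.
rewrite /g IE; case: (leP t (fine (u w))) => tu; last by rewrite !andbF mulr0.
rewrite andbT -leNgt => t0; rewrite [_ < t]ltNge (le_trans t0 (s0 w)) andbF.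
by rewrite mulr0.
Qed.

Let itv w : `]0, fine (u w)]%classic = `]0, fine (s w)]%classic `|` `]fine (s w), fine (u w)]%classic.
Proof.
by rewrite -itv_bndbnd_setU// bnd_simp.
Qed.

(** Duality for the positive and negative parts of [kop], cut down to the interval from [s] to [u]
    on [A]; recombining them is legitimate because [kop] is almost surely integrable on []0, u]]. *)
Lemma stieltjes_increment :
  \int[P]_(w in A) stieltjes_at u w - \int[P]_(w in A) stieltjes_at s w =
  \int[P]_w at_time g tau w.
Proof.
pose gp t w := Num.max (g t w) 0; pose gn t w := Num.max (- g t w) 0.
have ogp : optional F gp.
  by apply/optionalP; apply: measurable_maxr => //; exact: (proj1 (optionalP _ _) og).
have ogn : optional F gn.
  apply/optionalP; apply: measurable_maxr => //; apply: measurable_funN.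
  exact: (proj1 (optionalP _ _) og).
have gp0 t w : 0 <= gp t w by rewrite le_max lexx orbT.
have gn0 t w : 0 <= gn t w by rewrite le_max lexx orbT.
have gpk t w : gp t w <= `|kop t w|.
  by rewrite ge_max normr_ge0 andbT (le_trans (ler_norm _)).
have gnk t w : gn t w <= `|kop t w|.
  by rewrite ge_max normr_ge0 andbT (le_trans (ler_norm _))// normrN.
have sgp : supported u gp by move=> t w tu; rewrite /gp sg// maxxx.
have sgn' : supported u gn by move=> t w tu; rewrite /gn sg// oppr0 maxxx.
have [ia Ea] := inner_Rintegral fu ogp gp0 gpk sgp.
have [ib Eb] := inner_Rintegral fu ogn gn0 gnk sgn'.
have ias := stieltjes_at_intg fs; have iau := stieltjes_at_intg fu.
have mat f : optional F f -> measurable_fun setT (at_time f tau).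
  exact: (at_random_time_measurable F_usual tau_random).
have iat f : optional F f -> (forall t w, `|f t w| <= `|kop t w|) -> intg (at_time f tau).
  move=> of_ fk; apply: le_integrable kop_at_tau_intg => //.
    by apply/measurable_EFinP; exact: mat.
  by move=> w _; rewrite /= lee_fin /at_time; case: ifP => _; rewrite ?normr_id ?normr0.
have -> : \int[P]_w at_time g tau w =
    \int[P]_w at_time gp tau w - \int[P]_w at_time gn tau w.
  rewrite -RintegralB//; [|by apply: iat => // t w; rewrite ger0_norm|by apply: iat => // t w; rewrite ger0_norm].
  apply: eq_Rintegral => w _; rewrite /at_time; case: ifP => _; last by rewrite subrr.
  rewrite /gp /gn; case: (leP (g (fine (tau w)) w) 0) => h.
    by rewrite (max_idPl _) ?sub0r ?opprK// oppr_ge0.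
  by rewrite (max_idPr _) ?subr0// oppr_le0 ltW.
rewrite -Ea -Eb -(RintegralB _ ia ib)// -(RintegralB mA (intgS mA iau) (intgS mA ias)).
rewrite [LHS]Rintegral_mkcond; apply: eq_Rintegral_ae => //.
  by rewrite -restrict_EFin; apply/(integrable_mkcond _ mA)/intgS => //; exact: intgB.
  exact: intgB.
apply: filterS (finite_variation_ae fu) => w Nw _.
pose D := `]0, fine (u w)]%classic : set MR.
have mD : measurable D by exact: measurable_itv.
have mkD : measurable_fun D (fun t => (kop t w)%:E) by exact: kop_section_itv.
have ik : (nu w).-integrable D (EFin \o kop ^~ w) by apply/integrableP.
have ig : (nu w).-integrable D (EFin \o g ^~ w).
  apply: le_integrable ik => //; last by move=> t _; rewrite /= lee_fin.
  have mD' : measurable (`[0, +oo[%classic : set MR) by exact: measurable_itv.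
  apply: measurable_funS (optional_section_nonneg F_usual w og) => //.
  by move=> t /=; rewrite !in_itv/= andbT => /andP[/ltW + _].
have -> : (\int[nu w]_(t in D) gp t w) - (\int[nu w]_(t in D) gn t w) = \int[nu w]_(t in D) g t w.
  have igp : (nu w).-integrable D (EFin \o gp ^~ w).
    apply: eq_integrable (integrable_funepos mD ig) => // t _.
    by rewrite funeposE /= EFin_max.
  have ign : (nu w).-integrable D (EFin \o gn ^~ w).
    apply: eq_integrable (integrable_funeneg mD ig) => // t _.
    by rewrite funenegE /= EFin_max.
  rewrite -(RintegralB mD igp ign); apply: eq_Rintegral => t _.
  rewrite /gp /gn; case: (leP (g t w) 0) => h.
    by rewrite (max_idPl _) ?sub0r ?opprK// oppr_ge0.
  by rewrite (max_idPr _) ?subr0// oppr_le0 ltW.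
rewrite patchE; case: ifPn => Aw; last first.
  apply/esym; rewrite -[RHS](@mul0r _ (fine (nu w D))) -Rintegral_cst//.
  by apply: eq_Rintegral => t _; rewrite /g IE (negbTE Aw) mulr0.
rewrite /stieltjes_at /stieltjes_integral -/(nu w) itv Rintegral_setU//.
- rewrite addrC addKr [RHS](_ : _ = \int[nu w]_(t in D) ((kop ^~ w) \_ `]fine (s w), fine (u w)]) t).
    rewrite -Rintegral_mkcondr; congr Rintegral.
    by rewrite setIidr//; move=> t; rewrite /D itv; right.
  apply: eq_Rintegral => t _; rewrite patchE mem_setE in_itv/= /g IE Aw /=.
  by case: ifP => _; rewrite ?mulr1 ?mulr0.
- by rewrite -itv.
- apply/disj_setPS => t [/=]; rewrite !in_itv/= => /andP[_ ts] /andP[st _].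
  by move: (lt_le_trans st ts); rewrite ltxx.
Qed.

(** When [tau] is 0 the integral over []0, t]] misses the jump, and the separate term with [kpr 0]
    supplies the same payment. *)
Lemma XG_at_default : \forall w \ae P, forall t, 0 <= t ->
  XG t w = if (t%:E < tau w)%E then XF t w else kpr (fine (tau w)) w.
Proof.
have [_ pk XE _] := XF_kpr; have [_ tau0] := tau_random.
apply: filterS XE => w E t t0; rewrite (E t t0) /stieltjes_integral /Rintegral.
have mDt : measurable (`]0, t]%classic : set MR) by exact: measurable_itv.
have mk : measurable_fun (`]0, t]%classic : set MR) (fun v => (kpr v w)%:E).
  have mDt' : measurable (`[0, t]%classic : set MR) by exact: measurable_itv.
  apply: measurable_funS (_ : measurable_fun (`[0, t]%classic : set MR) _) => //.
    by move=> v /=; rewrite !in_itv/= => /andP[/ltW -> ->].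
  by apply/measurable_EFinP; exact: (progressive_section w pk t0).
rewrite /default_process (integral_unit_jump (tau0 w) mDt mk) /survival.
rewrite mem_setE in_itv /=.
case: (ltP t%:E (tau w)) => tt; rewrite ?mulr1 ?mulr0 ?addr0.
  have -> : (tau w == 0%E) = false.
    by apply/negbTE; rewrite gt_eqF// (le_lt_trans _ tt)// lee_fin.
  rewrite mulr0 add0r; case: ifPn => [/and3P[tf _ tl]|_]; last by rewrite addr0.
  by move: tt; rewrite -(fineK (_ : tau w \is a fin_num)) ?ge0_fin_numE// lte_fin ltNge tl.
have tf : (tau w < +oo)%E by rewrite (le_lt_trans tt)// ltry.
have tn : tau w \is a fin_num by rewrite ge0_fin_numE.
rewrite tf /= -[in (tau w == _)](fineK tn) eqe.
have -> : fine (tau w) <= t by rewrite -lee_fin fineK.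
have : 0 <= fine (tau w) by rewrite fine_ge0.
by rewrite le_eqVlt eq_sym andbT; case: eqVneq => [->|_ /= ->] /=;
  rewrite ?ltxx ?mulr1 ?addr0 ?mulr0 ?add0r.
Qed.

Let h w := at_time (fun t w => kpr t w * I t w) tau w.

(** Outside [s < tau <= u] the two increments agree: either [tau] has not been reached at [u], or
    the reward is already frozen at [s] and its part before [tau] is zero. On [s < tau <= u] they
    differ by the payment [kpr] at [tau]. *)
Let h_ae : \forall w \ae P, forall X', X' = (fun t w => XG t w * (t%:E < tau w)%E%:R) ->
  (at_time XG u w - at_time XG s w) * (w \in A)%:R =
  (at_time X' u w - at_time X' s w) * (w \in A)%:R + h w.
Proof.
have [_ tau0] := tau_random.
apply: filterS2 XG_at_default tau_fin => w E tf X' ->.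
rewrite /h /at_time fs.2 fu.2 tf IE.
have tn : tau w \is a fin_num by rewrite ge0_fin_numE.
rewrite -(fineK tn) /= !lte_fin.
have := E _ (s0 w); have := E _ (u0 w); rewrite -(fineK tn) !lte_fin /=.
have := sule w; case: (w \in A); last by rewrite !mulr0 addr0.
move: (fine (s w)) (fine (u w)) (fine (tau w)) => a b c ab.
case: (ltP b c) => bc -> /=.
  by rewrite (le_lt_trans ab bc) => -> /=; rewrite !mulr1 mulr0 addr0.
by case: (ltP a c) => ac -> /=; rewrite ?mulr1 ?mulr0; lra.
Qed.

Let H_intg th : finite_stopping_time F th -> intg (at_time XG th).
Proof. by move=> fth; apply: (classD_intg XG_classD); exact: (finite_stopping_enlarged tau F_usual). Qed.

Let X' := fun t w => XG t w * survival tau t w.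

Let X'_intg th : finite_stopping_time F th -> intg (at_time X' th).
Proof.
by move=> fth; have [Y [_ pY] _] := reduced_reward_ae; have [iX _ _ _] := pY _ fth.1.
Qed.

Let indic_intg f : intg f -> intg (fun w => f w * (w \in A)%:R).
Proof.
move=> intf; rewrite (_ : EFin \o _ = (EFin \o f) \_ A); last first.
  by apply/funext => w; rewrite patchE /=; case: (w \in A); rewrite ?mulr1 ?mulr0.
by apply/(integrable_mkcond _ mA)/intgS.
Qed.

Let indic_Rintegral f : \int[P]_w (f w * (w \in A)%:R) = \int[P]_(w in A) f w.
Proof.
rewrite [RHS]Rintegral_mkcond; apply: eq_Rintegral => w _.
by rewrite patchE; case: (w \in A); rewrite ?mulr1 ?mulr0.
Qed.

Let c w := (at_time XG u w - at_time XG s w) * (w \in A)%:R -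
           (at_time X' u w - at_time X' s w) * (w \in A)%:R.

Let c_intg : intg c.
Proof. by apply: intgB; apply: indic_intg; apply: intgB; do ?[exact: H_intg|exact: X'_intg]. Qed.

Let ch : \forall w \ae P, c w = h w.
Proof.
apply: filterS h_ae => w /(_ X' erefl); rewrite /c => ->.
by rewrite addrAC subrr add0r.
Qed.

(** The interval process is a bounded optional test function for the [mu]-conditional
    expectation. *)
Let h_kop : \int[P]_w h w = \int[P]_w at_time g tau w.
Proof.
have [_ _ kk] := kop_kpr.
have bI : bounded_optional F I.
  by split => //; exists 1 => t w _; exact: interval_process_bound.
have := kk _ bI; rewrite /expected_integral /Rintegral => E; congr fine.
have -> : (\int[P]_w (h w)%:E = expected_integral P (default_process tau) (fun t w => kpr t w * I t w)%R)%E.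
  apply: eq_integral => w _.
  rewrite (inner_default (f := fun t w => kpr t w * I t w) tau_random)//.
  apply/measurable_EFinP; apply: measurable_funM; last first.
    by apply/measurable_EFinP; exact: (optional_section_nonneg F_usual).
  have [_ pk _ _] := XF_kpr.
  rewrite (_ : `[0, +oo[%classic = \bigcup_n `[0, n%:R]%classic); last first.
    apply/seteqP; split => t /=; rewrite ?in_itv/= ?andbT.
      move=> t0; exists (Num.truncn t).+1 => //=; rewrite in_itv/= t0 ltW//.
      exact: truncnS_gt.
    by move=> [n _] /=; rewrite in_itv/= => /andP[].
  apply/measurable_fun_bigcup => n; first exact: measurable_itv.
  exact: (progressive_section w pk (ler0n _ n)).
transitivity (expected_integral P (default_process tau) g); first exact: E.
apply: eq_integral => w _.
by rewrite (inner_default tau_random (optional_section_nonneg F_usual w og)).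
Qed.

(** Projection accounts for the part of the reward before [tau], duality for the payment at
    [tau]. *)
Lemma reduced_reward_increment :
  \int[P]_(w in A) at_time Xtilde u w - \int[P]_(w in A) at_time Xtilde s w =
  \int[P]_(w in A) at_time XG u w - \int[P]_(w in A) at_time XG s w.
Proof.
have [Y [_ pY] XY] := reduced_reward_ae.
have CuA : prior F u A by exact: (sub_prior HF fu.1 su).
have red th : finite_stopping_time F th -> prior F th A ->
    \int[P]_(w in A) at_time Xtilde th w =
    \int[P]_(w in A) at_time X' th w + \int[P]_(w in A) stieltjes_at th w.
  move=> fth CthA; have cY := pY _ fth.1; have [_ iY _ _] := cY.
  have iS := stieltjes_at_intg fth.
  rewrite -(condexp_Rintegral cY CthA) -RintegralD//; [|exact: intgS|exact: intgS].
  apply: eq_Rintegral_ae => //; [exact: reduced_reward_intg|exact: intgD|].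
  by apply: filterS (XY _ fth) => w ->.
rewrite !red// opprD addrACA stieltjes_increment -h_kop.
(* Completeness of [P] makes [h] measurable: it agrees almost surely with [c], a combination of
   integrable rewards. *)
have -> : \int[P]_w h w = \int[P]_w c w.
  apply: eq_Rintegral_ae => //; last by apply: filterS ch => w ->.
  apply: (intg_ae ch) c_intg; apply/measurable_EFinP.
  apply: (ae_measurable_fun P_complete (f := EFin \o c)); last exact: measurable_int c_intg.
  by apply: filterS ch => w cw _ /=; rewrite cw.
have iX := H_intg; have iX' := X'_intg.
rewrite /c RintegralB//; [|apply: indic_intg; apply: intgB; do ?[exact: iX|exact: iX']..].
rewrite !indic_Rintegral !RintegralB//; try by apply: intgS => //; do ?[exact: iX|exact: iX'].
by rewrite addrC subrK.
Qed.

End increment.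
End reduced_reward.

(** * Optimal stopping times *)

Section infimum_stopping.
Context {R : realType} {d : measure_display} {T : measurableType d}.
Variables (P : probability T R) (F : R -> set (set T)).
Hypothesis F_usual : usual_filtration P F.
Let HF : is_filtration F := usual_is_filtration F_usual.

Lemma stopping_inf (s_ : nat -> T -> \bar R) s :
  (forall n, stopping_time F (s_ n)) ->
  (forall w, s w = ereal_inf (range (s_ ^~ w))) -> stopping_time F s.
Proof.
move=> ss sE; have [_ _ _ rc] := F_usual.
split=> [w|t t0]; first by rewrite sE; apply: le_ereal_inf_tmp => _ [n _ <-]; exact: (ss n).1.
rewrite rc// => u /= tu.
pose h k : R := t + (u - t) / k.+1%:R.
have hu k : h k <= u.
  rewrite /h -lerBrDl ler_pdivrMr ?ltr0n// ler_peMr ?ler1n// subr_ge0; exact: ltW.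
have th k : t < h k by rewrite /h ltrDl divr_gt0 ?subr_gt0 ?ltr0n.
have h0 k : 0 <= h k by rewrite (le_trans t0)// ltW.
have u0 : 0 <= u by rewrite (le_trans t0)// ltW.
have sC : sigma_algebra setT (F u) by exact: (HF.1 _ u0).1.
rewrite (_ : [set _ | _] = \bigcap_k \bigcup_n [set w | (s_ n w <= (h k)%:E)%E]).
  apply: sigma_bigcap => // k; apply: sigma_bigcup => // n.
  by apply: (HF.2 _ _ (h0 k) (hu k)); exact: (ss n).2.
apply/seteqP; split => w /=.
  move=> st k _; have : (s w < (h k)%:E)%E by rewrite (le_lt_trans st)// lte_fin.
  rewrite sE => /ereal_inf_lt [_ [n _ <-] sn]; exists n => //=; exact: ltW.
move=> sh; apply/lee_addgt0Pr => e e0.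
have ut : 0 < u - t by rewrite subr_gt0.
pose k := Num.truncn ((u - t) / e).
have [n _ /= sn] := sh k Logic.I; apply: le_trans (_ : (h k)%:E <= _)%E.
  by apply: le_trans sn; rewrite sE; apply: ereal_inf_lbound; exists n.
rewrite -EFinD lee_fin /h lerD2l ler_pdivrMr ?ltr0n// -ler_pdivrMl//.
by rewrite mulrC ltW// truncnS_gt.
Qed.

End infimum_stopping.

Section extremal_elements.
Context {R : realType} {d : measure_display} {T : measurableType d}.
Variables (P : probability T R) (Th : set (T -> \bar R)) (th : T -> \bar R).
Hypothesis m_th : measurable_fun setT th.
Hypothesis Th_th : Th th.

Lemma is_maximal_intro :
  (forall th', Th th' -> \forall w \ae P, (th' w <= th w)%E) -> is_maximal P Th th.
Proof. by move=> ub; split => //; split => // Z' _ ubZ'; exact: ubZ'. Qed.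

Lemma is_minimal_intro :
  (forall th', Th th' -> \forall w \ae P, (th w <= th' w)%E) -> is_minimal P Th th.
Proof. by move=> lb; split => //; split => // Z' _ lbZ'; exact: lbZ'. Qed.

End extremal_elements.

Lemma is_maximal_unique {R : realType} {d : measure_display} {T : measurableType d}
  (P : probability T R) (Th : set (T -> \bar R)) th th' :
  is_maximal P Th th -> is_maximal P Th th' -> \forall w \ae P, th w = th' w.
Proof.
move=> [[_ ub _] Th1] [[_ ub' _] Th2]; apply: filterS2 (ub _ Th2) (ub' _ Th1) => w h1 h2.
by apply/eqP; rewrite eq_le h1 h2.
Qed.

(** * Comparison of the solutions in the two filtrations *)

Section optimal_stopping.
Context {R : realType} {d : measure_display} {T : measurableType d}.
Variable P : probability T R.
Local Notation intg f := (P.-integrable setT (EFin \o f)).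
Variables (F : R -> set (set T)) (tau : T -> \bar R) (DoF : T -> cumulative R R).
Variables (G XG XF kpr kop SG SF : R -> T -> R).
Hypothesis P_complete : measure_is_complete P.
Hypothesis F_usual : usual_filtration P F.
Hypothesis tau_random : random_time tau.
Hypothesis G_azema : is_optional_projection P F (survival tau) G.
Hypothesis DoF_dual : is_dual_optional_projection P F (default_process tau) DoF.
Hypothesis G_gt0 : \forall w \ae P, forall t, 0 <= t -> 0 < G t w.
Hypothesis tau_fin : \forall w \ae P, (tau w < +oo)%E.
Hypothesis XG_rcll : \forall w \ae P, rcll (XG ^~ w).
Hypothesis XG_optional : optional (enlarged F tau) XG.
Hypothesis XG_classD : classD P (enlarged F tau) XG.
Hypothesis XG_stopped : indistinguishable P (stopped XG tau) XG.
Hypothesis XF_kpr : associated_pair P F tau G XG XF kpr.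
Hypothesis kop_kpr : is_mu_condexp P F (default_process tau) kpr kop.
Hypothesis SG_snell : is_snell P (enlarged F tau) XG SG.
Hypothesis SF_snell : is_snell P F (reduced_reward G XF kop DoF) SF.

Let TG := optimal_times P (enlarged F tau) (fun=> +oo%E) XG SG.
Let TGtau := optimal_times P (enlarged F tau) tau XG SG.
Let TF := optimal_times P F (fun=> +oo%E) (reduced_reward G XF kop DoF) SF.

Let HF : is_filtration F := usual_is_filtration F_usual.
Let HG : is_filtration (enlarged F tau) := enlarged_is_filtration F_usual tau_random.
Let nul := enlarged_negligible F_usual (tau := tau).
Let tauG : stopping_time (enlarged F tau) tau := random_time_stopping_enlarged F tau_random.
Let Xt := reduced_reward G XF kop DoF.
Let G_optional : optional F G := G_azema.1.
Let J := reward P tau XG.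
Let v := \int[P]_w SG 0 w.
(** The mean of the reward on [tau = 0]: the reduced reward starts integrating after time 0 and does
    not see a default there. A constant shift leaves optimality unchanged. *)
Let c := \int[P]_w XG 0 w - \int[P]_w Xt 0 w.

Let fin_tau' := finite_part_stopping HG nul tauG tau_fin.

Let stG s : stopping_time F s -> stopping_time (enlarged F tau) s.
Proof. exact: (stopping_enlarged tau F_usual). Qed.

Let fstG s : finite_stopping_time F s -> finite_stopping_time (enlarged F tau) s.
Proof. exact: (finite_stopping_enlarged tau F_usual). Qed.

Let fs_tau th : stopping_time (enlarged F tau) th ->
  finite_stopping_time (enlarged F tau) (fun w => Order.min (th w) (finite_part tau w)).
Proof.
move=> ths; have [f1 f2] := fin_tau'; split; first exact: stopping_min.
by move=> w; rewrite gt_min f2 orbT.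
Qed.

Let G_intg s : finite_stopping_time (enlarged F tau) s -> intg (at_time XG s).
Proof. exact: classD_intg. Qed.

Let F_intg s : finite_stopping_time F s -> intg (at_time Xt s).
Proof.
exact: (reduced_reward_intg F_usual tau_random G_optional G_gt0 DoF_dual XF_kpr kop_kpr).
Qed.

Let F_wrt s : finite_stopping_time F s -> wrt (prior F s) (at_time Xt s).
Proof. exact: (reduced_reward_wrt F_usual G_optional DoF_dual XF_kpr kop_kpr). Qed.

Let increment (A : set T) (s u : T -> \bar R) :
  finite_stopping_time F s -> finite_stopping_time F u -> (forall w, (s w <= u w)%E) ->
  prior F s A ->
  \int[P]_(w in A) at_time Xt u w - \int[P]_(w in A) at_time Xt s w =
  \int[P]_(w in A) at_time XG u w - \int[P]_(w in A) at_time XG s w.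
Proof.
exact: (reduced_reward_increment P_complete F_usual tau_random tau_fin G_optional
  G_gt0 DoF_dual XG_classD XF_kpr kop_kpr).
Qed.

Let F_value u : finite_stopping_time F u ->
  \int[P]_w at_time Xt u w = \int[P]_w at_time XG u w - c.
Proof.
move=> fu; have f0 := finite_stopping_cst HF (lexx (0 : R)).
have := increment f0 fu fu.1.1 (sigmaT (prior_sub_sigma HF f0.1).1).
by rewrite !at_time_cst /c; lra.
Qed.

Let F_bounded : exists M, forall s, finite_stopping_time F s -> \int[P]_w at_time Xt s w <= M.
Proof.
have [M hM] := classD_bounded XG_classD; exists (M - c) => s fs.
by rewrite F_value// lerB// hM//; exact: fstG.
Qed.

(** Increments after [n] have the same mean for both rewards on events of [F n], so the estimate for
    [XG] carries over. *)
Let F_tail (e : R) : 0 < e -> exists N : nat, forall n, (N <= n)%N ->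
  forall th A, finite_stopping_time F th -> (forall w, (n%:R%:E <= th w)%E) -> F n%:R A ->
  \int[P]_(w in A) at_time Xt th w <= \int[P]_(w in A) Xt n%:R w + e.
Proof.
move=> e0; have [N tail] := classD_tail HG nul tauG tau_fin XG_classD XG_stopped e0.
exists N => n Nn th A fth nth FA.
have fn := finite_stopping_cst HF (ler0n R n).
have PA : prior F (fun=> n%:R%:E) A by rewrite prior_cst.
have := increment fn fth nth PA; rewrite !at_time_cst => E.
have := tail n Nn th A (fstG fth) nth (_ : measurable A).
have mA : measurable A by have [_] := prior_sub_sigma HF fn.1; apply.
by move=> /(_ mA); move: E; lra.
Qed.

Let G_tail (e : R) : 0 < e -> exists N : nat, forall n, (N <= n)%N ->
  forall th A, finite_stopping_time (enlarged F tau) th ->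
  (forall w, (n%:R%:E <= th w)%E) -> enlarged F tau n%:R A ->
  \int[P]_(w in A) at_time XG th w <= \int[P]_(w in A) XG n%:R w + e.
Proof.
move=> e0; have [N tail] := classD_tail HG nul tauG tau_fin XG_classD XG_stopped e0.
exists N => n Nn th A fth nth HA; apply: tail => //.
by have [_] := HG.1 _ (ler0n R n); apply.
Qed.

Let J_le th : stopping_time (enlarged F tau) th -> J th <= v.
Proof.
move=> ths; have [M hM] := classD_bounded XG_classD.
by apply: (snell_value HG G_intg hM SG_snell); exact: fs_tau.
Qed.

Let J_cut th : stopping_time (enlarged F tau) th -> forall e : R, 0 < e ->
  exists N : nat, forall n, (N <= n)%N ->
  `|J th - \int[P]_w at_time XG (fun w => Order.min (th w) n%:R%:E) w| < e.
Proof.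
move=> ths e e0.
have /cvgrPdist_lt /(_ _ e0) [N _ hN] := reward_cut HG nul tauG tau_fin XG_classD XG_stopped ths.
by exists N => n Nn; exact: hN.
Qed.

Lemma enlarged_optimal th : TG th <-> stopping_time (enlarged F tau) th /\ J th = v.
Proof.
have [M hM] := classD_bounded XG_classD.
have XW s : finite_stopping_time (enlarged F tau) s -> wrt (prior (enlarged F tau) s) (at_time XG s).
  exact: (optional_at_time HG).
split=> [Tth|[ths Jth]].
  have ths : stopping_time (enlarged F tau) th by case: Tth.
  split => //; apply/eqP; rewrite eq_le J_le//=; apply/ler_addgt0Pr => e e0.
  have e20 : 0 < e / 2 by rewrite divr_gt0.
  have [N lim] := optimal_lim HG G_intg hM SG_snell G_tail Tth e20.
  have [N' cut] := J_cut ths e20.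
  have := lim _ (leq_maxl N N'); have := cut _ (leq_maxr N N').
  by rewrite -/v ltr_distl => /andP[+ _]; lra.
apply: (lim_optimal HG XW G_intg hM SG_snell) => // e N e0.
have [N' cut] := J_cut ths e0; exists (maxn N N'); first exact: leq_maxl.
by have := cut _ (leq_maxr N N'); rewrite Jth -/v ltr_distl => /andP[_]; lra.
Qed.

(** A nearly optimal time for [XG] is replaced by its [F]-trace, which has the same [J] but may be
    infinite; truncation makes it finite at arbitrarily small cost. *)
Let F_snell_value : \int[P]_w SF 0 w = v - c.
Proof.
have [M hM] := classD_bounded XG_classD; have [M' hM'] := F_bounded.
apply/eqP; rewrite eq_le; apply/andP; split; apply/ler_addgt0Pr => e e0.
  have [s fs] := snell_value_attained HF F_intg hM' SF_snell e0.
  rewrite F_value//; have := snell_value HG G_intg hM SG_snell (fstG fs).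
  by rewrite -/v; lra.
have e30 : 0 < e / 2 by rewrite divr_gt0.
have [th fth] := snell_value_attained HG G_intg hM SG_snell e30.
rewrite (reward_finite HG nul tauG tau_fin XG_classD XG_stopped fth) -/J -/v.
have [s ss sth] := enlarged_stopping_trace F_usual fth.1.
have <- : J s = J th.
  by apply: (reward_ext HG nul tauG tau_fin XG_classD sth) => //; [exact: stG|exact: fth.1].
have [N cut] := J_cut (stG ss) e30; have := cut _ (leqnn N).
have fc := stopping_min_cst HF (ler0n R N) ss.
have := snell_value HF F_intg hM' SF_snell fc; rewrite F_value//.
by rewrite ltr_distl => ? /andP[_]; lra.
Qed.

Lemma reduced_optimal s : TF s <-> stopping_time F s /\ J s = v.
Proof.
have [M hM] := F_bounded.
split=> [Ts|[ss Js]].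
  have ss : stopping_time F s by case: Ts.
  split => //; apply/eqP; rewrite eq_le J_le//=; last exact: stG.
  apply/ler_addgt0Pr => e e0.
  have e20 : 0 < e / 2 by rewrite divr_gt0.
  have [N lim] := optimal_lim HF F_intg hM SF_snell F_tail Ts e20.
  have [N' cut] := J_cut (stG ss) e20.
  have := lim _ (leq_maxl N N'); have := cut _ (leq_maxr N N').
  rewrite F_snell_value F_value; last exact: stopping_min_cst.
  by rewrite ltr_distl => /andP[+ _]; lra.
apply: (lim_optimal HF F_wrt F_intg hM SF_snell) => // e N e0.
have [N' cut] := J_cut (stG ss) e0; exists (maxn N N'); first exact: leq_maxl.
rewrite F_snell_value F_value; last exact: stopping_min_cst.
by have := cut _ (leq_maxr N N'); rewrite Js ltr_distl => /andP[_]; lra.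
Qed.

Let m_F s : stopping_time F s -> measurable_fun setT s.
Proof. exact: stopping_measurable. Qed.

Let J_trace th s : stopping_time F s -> stopping_time (enlarged F tau) th ->
  (forall w, Order.min (s w) (tau w) = Order.min (th w) (tau w)) -> J s = J th.
Proof.
by move=> ss ths E; apply: (reward_ext HG nul tauG tau_fin XG_classD E) => //; exact: stG.
Qed.

Lemma optimal_trace th : TG th -> exists2 s, TF s &
  forall w, Order.min (s w) (tau w) = Order.min (th w) (tau w).
Proof.
move=> /enlarged_optimal[ths Jth]; have [s ss E] := enlarged_stopping_trace F_usual ths.
by exists s => //; apply/reduced_optimal; split => //; rewrite (J_trace ss ths E).
Qed.

Lemma reduced_optimal_enlarged s : TF s -> TG s.
Proof.
by move=> /reduced_optimal[ss Js]; apply/enlarged_optimal; split => //; exact: stG.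
Qed.

Lemma enlarged_optimal_ext s th : TF s -> stopping_time (enlarged F tau) th ->
  (forall w, Order.min (s w) (tau w) = Order.min (th w) (tau w)) -> TG th.
Proof.
move=> /reduced_optimal[ss Js] ths E; apply/enlarged_optimal; split => //.
by rewrite -(J_trace ss ths E).
Qed.

Lemma optimal_bounded th : TGtau th <-> TG th /\ \forall w \ae P, (th w <= tau w)%E.
Proof.
split=> [[ths lt E martS]|[[ths _ E martS] lt]]; split => //; split => //.
by apply: aeW => w; rewrite leey.
Qed.

(** Pathwise, the rewards at minimum and maximum add up to the rewards at [s] and [s']; as neither
    mean exceeds [v], both equal it. *)
Lemma reduced_optimal_min s s' : TF s -> TF s' -> TF (fun w => Order.min (s w) (s' w)).
Proof.
move=> /reduced_optimal[ss Js] /reduced_optimal[ss' Js']; apply/reduced_optimal.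
have smin := stopping_min HF ss ss'; have smax := stopping_max HF ss ss'.
split => //; apply/eqP; rewrite eq_le J_le//=; last exact: stG.
have := J_le (stG smax).
suff : J (fun w => Order.min (s w) (s' w)) + J (fun w => Order.max (s w) (s' w)) = J s + J s'.
  by rewrite Js Js'; lra.
have ifs th : stopping_time F th ->
    intg (at_time XG (fun w => Order.min (th w) (finite_part tau w))).
  by move=> ths; exact/G_intg/fs_tau/stG.
rewrite /J /reward -!RintegralD//; try exact: ifs.
apply: eq_Rintegral => w _; rewrite /at_time.
by case: (leP (s w) (s' w)) => _ //; rewrite addrC.
Qed.

Lemma reduced_optimal_inf (s_ : nat -> T -> \bar R) s : (forall n, TF (s_ n)) ->
  (forall w m n, (m <= n)%N -> (s_ n w <= s_ m w)%E) ->
  (forall w, s w = ereal_inf (range (s_ ^~ w))) -> TF s.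
Proof.
move=> Ts ni sE; have ss n : stopping_time F (s_ n) by have /reduced_optimal[] := Ts n.
have st : stopping_time F s by exact: (stopping_inf F_usual ss sE).
apply/reduced_optimal; split => //.
have := reward_decreasing HG nul tauG tau_fin XG_rcll XG_classD (fun n => stG (ss n)) (stG st) ni sE.
rewrite (_ : (fun n => _) = cst v); last first.
  by apply/funext => n; have /reduced_optimal[_] := Ts n.
by move=> /cvg_lim E; rewrite /J -E// lim_cst.
Qed.

(** A bounded, strictly decreasing scale on [[0, +oo]], worth 0 at infinity: two ordered times with
    equal mean discount coincide almost surely. *)
Let discount (s : T -> \bar R) : T -> R := at_time (fun t _ => expR (- t)) s.

Let discount_ge0 s w : 0 <= discount s w.
Proof. by rewrite /discount /at_time; case: ifP => // _; exact: expR_ge0. Qed.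

Let discount_le s s' w : (0 <= s w)%E -> (s w <= s' w)%E -> discount s' w <= discount s w.
Proof.
rewrite /discount /at_time => s0 ss'; case: ifPn => s'oo.
  have soo : (s w < +oo)%E by rewrite (le_lt_trans ss').
  rewrite soo ler_expR lerN2 fine_le//; first by rewrite ge0_fin_numE.
  by rewrite ge0_fin_numE// (le_trans s0).
by case: ifP => // _; exact: expR_ge0.
Qed.

Let discount_inj s s' w : (0 <= s w)%E -> (s w <= s' w)%E -> discount s' w = discount s w ->
  s w = s' w.
Proof.
rewrite /discount /at_time => s0 ss'; have s'0 := le_trans s0 ss'.
case: ifPn => s'oo.
  have soo : (s w < +oo)%E by rewrite (le_lt_trans ss').
  rewrite soo => /expR_inj/oppr_inj E.
  by rewrite -[LHS]fineK ?ge0_fin_numE// -E fineK// ge0_fin_numE.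
case: ifPn => soo; first by move=> /esym/eqP; rewrite gt_eqF ?expR_gt0.
by move: soo s'oo; rewrite -!leNgt !leye_eq => /eqP -> /eqP ->.
Qed.

Let discount_le1 s w : (0 <= s w)%E -> discount s w <= 1.
Proof.
move=> s0; apply: le_trans (discount_le (s := fun=> 0%E) _ s0) _ => //.
by rewrite /discount /at_time ltry /= oppr0 expR0.
Qed.

Let discount_intg s : stopping_time F s -> intg (discount s).
Proof.
move=> ss; have ms := m_F ss.
apply: (@le_integrable _ _ _ P setT measurableT _ (EFin \o cst 1)).
- apply/measurable_EFinP; apply: measurable_fun_ifT => //.
    by apply: measurable_fun_lte => //; exact: measurable_cst.
  by apply: measurableT_comp => //; apply: measurable_funN;
    exact: measurableT_comp (fine_measurable measurableT) ms.
- move=> w _; rewrite /= lee_fin normr1 ger0_norm// discount_le1//; exact: ss.1.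
- exact: intg_cst.
Qed.

(** Exhaustion: along a sequence maximising the mean discount, the running minima decrease to a
    solution that attains the supremum. Its minimum with any other solution cannot raise the
    discount further, so it is already the smaller one. *)
Lemma reduced_minimal_exists : (exists s, TF s) -> exists s, is_minimal P TF s.
Proof.
move=> [r Tr]; pose V := [set \int[P]_w discount s w | s in TF].
have TFst s : TF s -> stopping_time F s by move=> /reduced_optimal[].
have supV : has_sup V.
  split; first by exists (\int[P]_w discount r w), r.
  exists 1 => _ [s /TFst ss <-]; have <- : \int[P]_w (cst 1 : T -> R) w = 1.
    by rewrite Rintegral_cst//= mul1r probability_setT.
  apply: le_Rintegral => //; [exact: discount_intg|exact: intg_cst|].
  by move=> w _; rewrite discount_le1//; exact: ss.1.
have /choice[a ha] : forall n : nat, exists s, TF s /\ sup V - n.+1%:R^-1 < \int[P]_w discount s w.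
  move=> n; have n0 : 0 < n.+1%:R^-1 :> R by rewrite invr_gt0.
  by have [_ [s Ts <-] sV] := sup_adherent n0 supV; exists s.
pose b := fix b n : T -> \bar R :=
  if n is m.+1 then (fun w => Order.min (b m w) (a n w)) else a 0%N.
have Tb n : TF (b n).
  elim: n => [|n IH] /=; first exact: (ha 0%N).1.
  by apply: reduced_optimal_min => //; exact: (ha _).1.
have ba n w : (b n w <= a n w)%E by case: n => [|n] /=; rewrite ?ge_min ?lexx ?orbT.
have nib w m n : (m <= n)%N -> (b n w <= b m w)%E.
  elim: n => [|n IH]; first by rewrite leqn0 => /eqP ->.
  rewrite leq_eqVlt => /predU1P[->//|]; rewrite ltnS => /IH; apply: le_trans.
  by rewrite /= ge_min lexx.
pose s w := ereal_inf (range (b ^~ w)).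
have Ts : TF s by apply: (reduced_optimal_inf Tb).
have ss := TFst _ Ts.
have sb n w : (s w <= b n w)%E by apply: ereal_inf_lbound; exists n.
have Vs : sup V <= \int[P]_w discount s w.
  apply/ler_addgt0Pr => e e0.
  pose n := Num.truncn e^-1.
  have ne : n.+1%:R^-1 <= e :> R.
    by rewrite -[leRHS]invrK lef_pV2 ?posrE ?invr_gt0// ltW// truncnS_gt.
  have [Ta Va] := ha n.
  have : \int[P]_w discount (a n) w <= \int[P]_w discount s w.
    apply: le_Rintegral => //; [exact/discount_intg/TFst|exact: discount_intg|].
    move=> w _; apply: discount_le; first exact: ss.1.
    exact: le_trans (sb n w) (ba n w).
  rewrite -lerBlDr; apply: le_trans; apply: le_trans (ltW Va).
  by rewrite lerD2l lerN2.
exists s; apply: is_minimal_intro => //; first exact: m_F.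
move=> s' Ts'; pose u w := Order.min (s w) (s' w).
have Tu : TF u by exact: reduced_optimal_min.
have su := TFst _ Tu.
have us w : (u w <= s w)%E by rewrite ge_min lexx.
have iu := discount_intg su; have is_ := discount_intg ss.
have Vu : \int[P]_w discount u w <= sup V by apply: ub_le_sup; [exact: supV.2|exists u].
have := Rintegral_le0_ae measurableT (intgB iu is_).
have -> : \int[P]_w (discount u \- discount s) w = \int[P]_w discount u w - \int[P]_w discount s w.
  by rewrite RintegralB.
move=> /(_ _ _)/wrap[]; [|by rewrite subr_le0 (le_trans Vu)|].
  by move=> w _; rewrite subr_ge0 discount_le//; exact: su.1.
apply: filterS => w /(_ Logic.I)/eqP; rewrite subr_eq0 => /eqP E.
have := discount_inj (su.1 w) (us w) (esym E); rewrite /u => <-.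
by rewrite ge_min lexx orbT.
Qed.

(* Testing [G] at [s], restricted to [s < s'], turns [P(s < s', s < tau) = 0] into
   [E[G_s; s < s'] = 0]. *)
Lemma survival_comparison s s' : stopping_time F s -> stopping_time F s' ->
  (\forall w \ae P, (Order.min (s' w) (tau w) <= Order.min (s w) (tau w))%E) ->
  \forall w \ae P, (s' w <= s w)%E.
Proof.
move=> ss ss' le_tau.
pose r w := if (s w < s' w)%E then s w else +oo%E.
have sr : stopping_time F r by exact: stopping_restrict.
have cG := G_azema.2 _ sr; have [_ iG _ _] := cG.
have G0 : \int[P]_w at_time G r w <= 0.
  rewrite (condexp_Rintegral cG (sigmaT (prior_sub_sigma HF sr).1)).
  rewrite le_eqVlt; apply/orP; left; apply/eqP.
  have [iS _ _ _] := cG.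
  transitivity (\int[P]_w (cst 0 : T -> R) w); last by rewrite Rintegral_cst// mul0r.
  apply: eq_Rintegral_ae => //; first exact: intg_cst.
  apply: filterS le_tau => w le _; rewrite /at_time /survival /r.
  case: ifPn => // soo; case: (ltP (s w) (s' w)) soo => // lts soo.
  have sfin : s w \is a fin_num by rewrite ge0_fin_numE//; exact: ss.1.
  rewrite fineK//; case: (ltP (s w) (tau w)) => // ltt; exfalso.
  by move: le; rewrite (min_idPl (ltW ltt)) leNgt lt_min lts ltt.
have := Rintegral_le0_ae0 measurableT iG _ G0.
have Gge : \forall w \ae P, setT w -> 0 <= at_time G r w.
  apply: filterS G_gt0 => w Gw _; rewrite /at_time; case: ifP => // _.
  by apply/ltW/Gw; rewrite fine_ge0//; exact: sr.1.
move=> /(_ Gge); apply: filterS2 G_gt0 => w Gw /(_ Logic.I).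
rewrite /at_time /r; case: (ltP (s w) (s' w)) => // lts.
have soo : (s w < +oo)%E by rewrite (lt_le_trans lts)// leey.
rewrite soo => /eqP; rewrite gt_eqF// Gw// fine_ge0//; exact: ss.1.
Qed.

Lemma minimal_trace s : is_minimal P TF s ->
  is_minimal P TG (fun w => Order.min (s w) (tau w)).
Proof.
move=> [[_ lb _] Ts]; have /reduced_optimal[ss _] := Ts.
have sm : stopping_time (enlarged F tau) (fun w => Order.min (s w) (tau w)).
  by apply: stopping_min => //; exact: stG.
apply: is_minimal_intro; first exact: (stopping_measurable HG sm).
  by apply: (enlarged_optimal_ext Ts sm) => w; rewrite -minA minxx.
move=> th /optimal_trace[s' Ts' E]; apply: filterS (lb _ Ts') => w lw.
apply: (@le_trans _ _ (Order.min (s' w) (tau w))); first exact: le_min2.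
by rewrite E ge_min lexx.
Qed.

(** The reward is frozen from [tau] on, so a solution that waits until [tau] may wait forever. This
    is the largest time with the same trace before [tau] as [s]. *)
Let restricted s w := if (s w < tau w)%E then s w else +oo%E.

Lemma maximal_enlarged s : is_maximal P TF s -> is_maximal P TG (restricted s).
Proof.
move=> [[_ ub _] Ts]; have /reduced_optimal[ss _] := Ts.
have sr : stopping_time (enlarged F tau) (restricted s).
  by apply: stopping_restrict => //; exact: stG.
apply: is_maximal_intro; first exact: (stopping_measurable HG sr).
  apply: (enlarged_optimal_ext Ts sr) => w; rewrite /restricted.
  case: (ltP (s w) (tau w)) => // ts; first by rewrite (min_idPl (ltW ts)).
  by rewrite (min_idPr _) ?leey.
move=> th /optimal_trace[s' Ts' E]; apply: filterS (ub _ Ts') => w uw.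
rewrite /restricted; case: (ltP (s w) (tau w)) => ts; last exact: leey.
rewrite leNgt; apply/negP => sth.
have : (Order.min (th w) (tau w) <= s w)%E by rewrite -E ge_min uw.
by rewrite leNgt lt_min sth ts.
Qed.

Lemma maximal_stopped s : is_maximal P TF s ->
  is_maximal P TGtau (fun w => Order.min (s w) (tau w)).
Proof.
move=> [[_ ub _] Ts]; have /reduced_optimal[ss _] := Ts.
have sm : stopping_time (enlarged F tau) (fun w => Order.min (s w) (tau w)).
  by apply: stopping_min => //; exact: stG.
apply: is_maximal_intro; first exact: (stopping_measurable HG sm).
  apply/optimal_bounded; split; last by apply: aeW => w; rewrite ge_min lexx orbT.
  by apply: (enlarged_optimal_ext Ts sm) => w; rewrite -minA minxx.
move=> th /optimal_bounded[/optimal_trace[s' Ts' E] lt]; apply: filterS2 lt (ub _ Ts') => w tw uw.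
by rewrite -(min_idPl tw) -E; exact: le_min2.
Qed.

(** The [F]-trace of [th] dominates all solutions up to [tau], and positivity of [G] removes the
    restriction. Bounding only the capped times lets the lemma serve both notions of maximality. *)
Lemma maximal_reduced th : TG th ->
  (forall s, TF s -> \forall w \ae P, (Order.min (s w) (tau w) <= th w)%E) ->
  exists s, is_maximal P TF s.
Proof.
move=> /optimal_trace[s Ts E] ub; exists s; have /reduced_optimal[ss _] := Ts.
apply: is_maximal_intro => //; first exact: m_F.
move=> s' Ts'; have /reduced_optimal[ss' _] := Ts'; apply: survival_comparison => //.
by apply: filterS (ub _ Ts') => w uw; rewrite E le_min uw ge_min lexx orbT.
Qed.

(** In (b), the maximum over all solutions in the enlarged filtration is infinite where it waits
    until [tau], so the identity is asserted after capping at [tau]; among solutions bounded by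
    [tau] it holds without capping. *)
Lemma optimal_stopping_reduction :
  (((exists th, TG th) <-> (exists th, TF th)) /\
   ((exists th, TG th) \/ (exists th, TF th) ->
    exists thG thF, [/\ is_minimal P TG thG, is_minimal P TF thF &
      \forall w \ae P, thG w = Order.min (thF w) (tau w)])) /\
  ((((exists th, is_maximal P TG th) <-> (exists th, is_maximal P TF th)) /\
    (forall thG thF, is_maximal P TG thG -> is_maximal P TF thF ->
      \forall w \ae P, Order.min (thG w) (tau w) = Order.min (thF w) (tau w))) /\
   (((exists th, is_maximal P TGtau th) <-> (exists th, is_maximal P TF th)) /\
    (forall thG thF, is_maximal P TGtau thG -> is_maximal P TF thF ->
      \forall w \ae P, thG w = Order.min (thF w) (tau w)))).
Proof.
have GF : (exists th, TG th) <-> (exists th, TF th).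
  split=> [[th /optimal_trace[s Ts _]]|[s Ts]]; first by exists s.
  by exists s; exact: reduced_optimal_enlarged.
split; [split => // nonempty|split; split].
- have /reduced_minimal_exists[s ms] : exists th, TF th by case: nonempty => // /GF.
  exists (fun w => Order.min (s w) (tau w)), s; split => //; first exact: minimal_trace.
  exact: aeW.
- split=> [[th [[_ ub _] Tth]]|[s /maximal_enlarged ms]]; last by exists (restricted s).
  apply: (maximal_reduced Tth) => s Ts.
  by apply: filterS (ub _ (reduced_optimal_enlarged Ts)) => w uw; rewrite ge_min uw.
- move=> thG thF mG /maximal_enlarged mF; apply: filterS (is_maximal_unique mG mF) => w ->.
  rewrite /restricted; case: (ltP (thF w) (tau w)) => // ts; first by rewrite (min_idPl (ltW ts)).
  by rewrite (min_idPr _) ?leey.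
- split=> [[th [[_ ub _] /optimal_bounded[Tth _]]]|[s ms]]; last first.
    by exists (fun w => Order.min (s w) (tau w)); exact: maximal_stopped.
  apply: (maximal_reduced Tth) => s Ts; apply: ub; apply/optimal_bounded; split.
    have /reduced_optimal[ss _] := Ts.
    apply: (enlarged_optimal_ext Ts); first by apply: stopping_min => //; exact: stG.
    by move=> w; rewrite -minA minxx.
  by apply: aeW => w; rewrite ge_min lexx orbT.
- move=> thG thF mG /maximal_stopped mF; exact: is_maximal_unique mG mF.
Qed.

End optimal_stopping.

Theorem theorem3p8 (R : realType) (d : measure_display) (T : measurableType d)
  (P : probability T R) (F : R -> set (set T)) (tau : T -> \bar R)
  (G XG XF kpr kop SG SF : R -> T -> R) (DoF : T -> cumulative R R)
  (P_complete : measure_is_complete P)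
  (F_usual : usual_filtration P F)
  (tau_random_time : random_time tau)
  (G_azema : is_optional_projection P F (survival tau) G)
  (DoF_dual : is_dual_optional_projection P F (default_process tau) DoF)
  (G_gt0 : \forall w \ae P, forall t, 0 <= t -> 0 < G t w)
  (tau_fin : \forall w \ae P, (tau w < +oo)%E)
  (XG_rcll : \forall w \ae P, rcll (XG ^~ w))
  (XG_optional : optional (enlarged F tau) XG)
  (XG_classD : classD P (enlarged F tau) XG)
  (XG_stopped : indistinguishable P (stopped XG tau) XG)
  (XF_kpr : associated_pair P F tau G XG XF kpr)
  (kop_kpr : is_mu_condexp P F (default_process tau) kpr kop)
  (SG_snell : is_snell P (enlarged F tau) XG SG)
  (SF_snell : is_snell P F (reduced_reward G XF kop DoF) SF) :
  let TG := optimal_times P (enlarged F tau) (fun=> +oo%E) XG SG in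
  let TGtau := optimal_times P (enlarged F tau) tau XG SG in
  let TF := optimal_times P F (fun=> +oo%E) (reduced_reward G XF kop DoF) SF in
  (* (a) *)
  (((exists th, TG th) <-> (exists th, TF th)) /\
   ((exists th, TG th) \/ (exists th, TF th) ->
    exists thG thF, [/\ is_minimal P TG thG, is_minimal P TF thF &
      \forall w \ae P, thG w = Order.min (thF w) (tau w)])) /\
  (* (b) *)
  ((((exists th, is_maximal P TG th) <-> (exists th, is_maximal P TF th)) /\
    (forall thG thF, is_maximal P TG thG -> is_maximal P TF thF ->
      \forall w \ae P, Order.min (thG w) (tau w) = Order.min (thF w) (tau w))) /\
   (((exists th, is_maximal P TGtau th) <-> (exists th, is_maximal P TF th)) /\
    (forall thG thF, is_maximal P TGtau thG -> is_maximal P TF thF ->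
      \forall w \ae P, thG w = Order.min (thF w) (tau w)))).
Proof.
exact: (optimal_stopping_reduction P_complete F_usual tau_random_time G_azema DoF_dual
  G_gt0 tau_fin XG_rcll XG_optional XG_classD XG_stopped XF_kpr kop_kpr SG_snell SF_snell).
Qed.
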